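(* Let $q$ be a power of a prime $p$, let $\ell\ge1$ and $k\ge 1$ be integers, and put $c:=k/q$ and $\gamma:=(\ell-1)/\sqrt q$. Let $\delta_0>0$ be a constant (independent of $k$). Suppose that one of the following two conditions holds: Condition A: $$\frac{p-1}{p}\,c\ln\frac1c+(1-c)\ln\frac1{1-c}-\frac{1+c}{p}\ln(1+c)\ \ge\ \gamma\ln(2p)+\delta_0;$$ Condition B: $p\to\infty$, $\gamma\ge \dfrac{c}{p}$, and $$c\ln\frac1c+(1-c)\ln\frac{1}{1-c}\ \ge\ \gamma+\gamma\ln\frac{c+\gamma}{\gamma}+\delta_0 .$$ Then, as $k\to\infty$, uniformly for all integers $0\le r\le k+\ell$ and all monic $f\in\mathbb F_q[x]$ of degree $k+\ell$, $$N(f,r)\sim \mu_{k+\ell-r}(r)\binom{q}{r}q^{k-r},\qquad\text{where } \mu_m(r)=\sum_{j=0}^{m}(-1)^j\binom{q-r}{j}q^{-j},$$ and $N(f,r)$ is the number of codewords of the Reed–Solomon code $\mathcal{RS}_{q,k}$ at Hamming distance exactly $q-r$ from the word $(f(x):x\in\mathbb F_q)$.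
   Context: The (standard) Reed–Solomon code $\mathcal{RS}_{q,k}$ consists of the codewords $(g(x):x\in\mathbb F_q)$, where $g$ ranges over the polynomials over $\mathbb F_q$ of degree less than $k$. A polynomial $f$ represents the received word $(f(x):x\in\mathbb F_q)$. The statement concerns sequences of parameters $(q,\ell,k)$ with $k\to\infty$, where $\delta_0$ is fixed along the sequence, and where either every member satisfies the inequality in Condition A, or $p\to\infty$ along the sequence and every member satisfies the two inequalities of Condition B. The conditions presuppose $0<c<1$, so that their expressions are defined. ''Uniformly'' means that $N(f,r)=(1+o(1))\,\mu_{k+\ell-r}(r)\binom qr q^{k-r}$ with the $o(1)$ tending to $0$ uniformly over $r$ and $f$. *)

(* Defs.v *)
From HB Require Import structures.
From mathcomp Require Import all_boot all_order all_algebra.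
From mathcomp Require Import all_classical all_reals all_analysis.

Set Implicit Arguments.
Unset Strict Implicit.
Unset Printing Implicit Defensive.

Import Order.TTheory GRing.Theory Num.Theory.
Import numFieldNormedType.Exports.
Local Open Scope ring_scope.

Section ReedSolomon.
Variable F : finFieldType.
Implicit Types (u v : {ffun F -> F}) (f : {poly F}).

Definition word_of f : {ffun F -> F} := [ffun x => f.[x]].

Definition hamming_dist u v : nat := #|[set x | u x != v x]|.

(* [{poly_k F}] is the type of polynomials of size at most k, that is, of
   degree less than k. *)
Definition RS_code (k : nat) : {set {ffun F -> F}} :=
  [set word_of (val g) | g : {poly_k F}].

(* The codewords at distance exactly q - r from the word of f. The condition
   [d + r == q] avoids truncated subtraction: no codeword is counted if q < r. *)
Definition codewords_at (k : nat) f (r : nat) : nat :=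
  #|[set u in RS_code k | hamming_dist u (word_of f) + r == #|F| ]%N|.

End ReedSolomon.

Section Asymptotics.
Variable R : realType.

(* For r > q the truncated q - r is harmless: mu is only used multiplied by
   'C(q, r), which is then 0. *)
Definition mu (q m r : nat) : R :=
  \sum_(j < m.+1) (-1) ^+ j * 'C(q - r, j)%:R * q%:R ^- j.

(* The exponent k - r is an integer, possibly negative. *)
Definition main_term (q l k r : nat) : R :=
  mu q (k + l - r) r * 'C(q, r)%:R * q%:R ^ (k%:Z - r%:Z).

Definition rate (q k : nat) : R := k%:R / q%:R.

Definition excess (q l : nat) : R := (l%:R - 1) / Num.sqrt q%:R.

Definition condA (delta0 : R) (p q l k : nat) : Prop :=
  let c := rate q k in
  let gamma := excess q l in
  0 < c < 1 /\
  (p%:R - 1) / p%:R * c * ln c^-1 + (1 - c) * ln (1 - c)^-1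
    - (1 + c) / p%:R * ln (1 + c)
  >= gamma * ln (2 * p%:R) + delta0.

Definition condB (delta0 : R) (p q l k : nat) : Prop :=
  let c := rate q k in
  let gamma := excess q l in
  [/\ 0 < c < 1, gamma >= c / p%:R &
      c * ln c^-1 + (1 - c) * ln (1 - c)^-1
      >= gamma + gamma * ln ((c + gamma) / gamma) + delta0].

End Asymptotics.

(* Main.v *)
(* The words g of the code correspond to the monic polynomials f - g of degree
   k + l whose l coefficients below the leading one agree with those of f, and
   g is at distance q - r exactly when f - g has r roots in F. The class of
   t^d h(1/t) in the group of 1-units of F[t]/(t^(l+1)) records these
   coefficients, so the condition is detected by the characters xi of that group,
   and inclusion-exclusion over the roots turns N(f, r) into a sum over xi and j of
   the products of e_j(xi(X - a) : a in F) with the coefficient L_(k+l-j) of the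
   L-function of xi. The trivial character gives the main term. For nontrivial
   xi the L-function is a polynomial of degree < l, so only j > k matters, and
   the Weil bound |sum_a xi(X - a)^i| <= D, with D about (l - 1) sqrt q, holds
   for all i prime to p. Newton's identities then bound |e_j| by the coefficient
   of z^j in (1 - z)^(-D) (1 - z^p)^(-q/p), which is at most rho^(-j) times the
   value of this function at any rho in (0, 1). Under condition A one takes
   rho^p = c / (1 + c), under condition B rho = c / (c + gamma); compared with
   binomial(q, k), at least about exp(q * entropy c), this leaves a relative
   error of at most exp(-delta0 q / 2) (2 q)^(3 l + 4), and l = O(sqrt q).

   The Weil bound is proved by Stepanov's method in Bombieri's form. The ray
   class cover of the affine line with group the 1-units is an explicit tower
   of degree q^l, on whose coordinate ring the place at infinity gives a degree
   function. An auxiliary function of small degree divisible by all primes with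
   a given Frobenius bounds the number of these primes from above, for every
   Frobenius class at once; as their total is known, the power sums of the
   inverse roots of every L-function are O(q^m) at exponent 2m, so the inverse
   roots have absolute value at most sqrt q. *)

Require Import Defs.
From mathcomp Require Import all_boot all_order all_algebra all_fingroup all_solvable all_field all_character.
From mathcomp Require Import all_classical all_reals all_analysis.
From mathcomp Require Import zify ring lra.
Set Implicit Arguments.
Unset Strict Implicit.
Unset Printing Implicit Defensive.
Import Order.TTheory GRing.Theory Num.Theory.
Import numFieldNormedType.Exports.
Local Open Scope ring_scope.

(** * Rings with a degree function *)

(* sz is one plus a degree, with sz 0 = 0, like size on polynomials; sz_lead says
   that the residue field at infinity is F. *)
Record degree_ring (F : finFieldType) (A : comNzRingType)
    (kappa : {rmorphism F -> A}) (sz : A -> nat) : Prop := DegreeRing {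
  sz_eq0 : forall a, (sz a == 0%N) = (a == 0);
  sz_sub : forall a b, (sz (a - b)%R <= maxn (sz a) (sz b))%N;
  sz_mul : forall a b, a != 0 -> b != 0 -> sz (a * b)%R = (sz a + sz b).-1;
  sz_lead : forall a b, a != 0 -> sz a = sz b ->
    exists c : F, (sz (a - kappa c * b)%R < sz a)%N }.

Section DegreeRingTheory.
Variables (F : finFieldType) (A : comNzRingType) (kappa : {rmorphism F -> A}).
Variables (sz : A -> nat) (dA : degree_ring kappa sz).
Implicit Types a b : A.

Lemma dr_sz0 : sz 0 = 0%N.
Proof. by apply/eqP; rewrite (sz_eq0 dA). Qed.

Lemma dr_sz_gt0 a : (0 < sz a)%N = (a != 0).
Proof. by rewrite lt0n (sz_eq0 dA). Qed.

Lemma dr_sz1 : sz 1 = 1%N.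
Proof.
have n1 : (1 : A) != 0 by apply: oner_neq0.
have := sz_mul dA n1 n1; rewrite mulr1.
by have := n1; rewrite -dr_sz_gt0 => h e; lia.
Qed.

Lemma dr_szN a : sz (- a) = sz a.
Proof.
suff le b : (sz (- b)%R <= sz b)%N.
  by apply/eqP; rewrite eqn_leq le -{1}[a]opprK le.
by rewrite -[- b]add0r; apply: leq_trans (sz_sub dA _ _) _; rewrite dr_sz0 max0n.
Qed.

Lemma dr_szD a b : (sz (a + b)%R <= maxn (sz a) (sz b))%N.
Proof. by rewrite -[b in (a + b)]opprK -(dr_szN b); apply: (sz_sub dA). Qed.

Lemma dr_szD_lt a b n : (sz a < n)%N -> (sz b < n)%N -> (sz (a + b)%R < n)%N.
Proof. by move=> an bn; apply: leq_ltn_trans (dr_szD _ _) _; rewrite gtn_max an. Qed.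

Lemma dr_szDl a b : (sz b < sz a)%N -> sz (a + b) = sz a.
Proof.
move=> lt; apply/eqP; rewrite eqn_leq; apply/andP; split.
  by apply: leq_trans (dr_szD _ _) _; rewrite geq_max leqnn ltnW.
have := sz_sub dA (a + b) b; rewrite addrK leq_max => /orP [//|].
by rewrite leqNgt lt.
Qed.

Lemma dr_sz_sum_lt (I : Type) (r : seq I) (P : pred I) (f : I -> A) n :
  (0 < n)%N -> (forall i, P i -> (sz (f i) < n)%N) ->
  (sz (\sum_(i <- r | P i) f i)%R < n)%N.
Proof.
move=> n0 H; apply: (big_ind (fun x => sz x < n)%N) => //; first by rewrite dr_sz0.
by move=> x y; apply: dr_szD_lt.
Qed.

Lemma dr_sz_sum_le (I : Type) (r : seq I) (P : pred I) (f : I -> A) n :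
  (forall i, P i -> (sz (f i) <= n)%N) -> (sz (\sum_(i <- r | P i) f i)%R <= n)%N.
Proof. by move=> H; rewrite -ltnS; apply: dr_sz_sum_lt. Qed.

Lemma dr_mulf_eq0 a b : (a * b == 0) = (a == 0) || (b == 0).
Proof.
have [->|na] := eqVneq a 0; first by rewrite mul0r eqxx.
have [->|nb] := eqVneq b 0; first by rewrite mulr0 eqxx.
apply/negbTE; rewrite -dr_sz_gt0 (sz_mul dA) //.
by have := na; have := nb; rewrite -!dr_sz_gt0; lia.
Qed.

Lemma dr_expf_neq0 a n : a != 0 -> a ^+ n != 0.
Proof.
move=> na; elim: n => [|n IH]; first by rewrite expr0 oner_neq0.
by rewrite exprS dr_mulf_eq0 negb_or na.
Qed.

Lemma dr_szX a n : a != 0 -> sz (a ^+ n) = ((sz a).-1 * n).+1.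
Proof.
move=> na; elim: n => [|n IH]; first by rewrite expr0 dr_sz1 muln0.
rewrite exprS (sz_mul dA) ?dr_expf_neq0 // IH.
by have := na; rewrite -dr_sz_gt0 mulnS; case: (sz a) => // s _; lia.
Qed.

Lemma dr_sz_const (c : F) : c != 0 -> sz (kappa c) = 1%N.
Proof.
move=> nc; have nk x : x != 0 -> kappa x != 0 by rewrite fmorph_eq0.
have := sz_mul dA (nk _ nc) (nk _ (invr_neq0 nc)).
rewrite -rmorphM mulfV // rmorph1 dr_sz1.
have := nk _ nc; have := nk _ (invr_neq0 nc).
by rewrite -!dr_sz_gt0; lia.
Qed.

Lemma dr_sz_scale_le (c : F) a : (sz (kappa c * a)%R <= sz a)%N.
Proof.
have [->|nc] := eqVneq c 0; first by rewrite rmorph0 mul0r dr_sz0.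
have [->|na] := eqVneq a 0; first by rewrite mulr0 dr_sz0.
by rewrite (sz_mul dA) ?fmorph_eq0 // dr_sz_const // add1n.
Qed.

Lemma dr_sz_scale (c : F) a : c != 0 -> sz (kappa c * a) = sz a.
Proof.
move=> nc; have [->|na] := eqVneq a 0; first by rewrite mulr0.
by rewrite (sz_mul dA) ?fmorph_eq0 // dr_sz_const // add1n.
Qed.

Lemma dr_szM_le a b : (sz (a * b)%R <= (sz a + sz b).-1)%N.
Proof.
have [->|na] := eqVneq a 0; first by rewrite mul0r dr_sz0.
have [->|nb] := eqVneq b 0; first by rewrite mulr0 dr_sz0.
by rewrite (sz_mul dA).
Qed.

(* By sz_lead each graded piece is at most a line over F. *)
Lemma dr_bounded_enum n :
  exists s : seq A, (size s <= #|F| ^ n)%N /\ forall a, (sz a <= n)%N -> a \in s.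
Proof.
elim: n => [|n [s [ss Hs]]].
  exists [:: 0]; split => // a; rewrite leqn0 (sz_eq0 dA) => /eqP ->.
  by rewrite inE.
case: (EM (exists b, sz b = n.+1)) => [[b sb]|nb].
  exists [seq kappa c * b + a | c <- enum F, a <- s]; split.
    by rewrite size_allpairs expnS -cardE leq_mul2l ss orbT.
  move=> a; rewrite leq_eqVlt => /orP [/eqP sa|]; last first.
    rewrite ltnS => /Hs sa; apply/allpairsP; exists (0, a) => /=.
    by rewrite mem_enum sa rmorph0 mul0r add0r.
  have na : a != 0 by rewrite -dr_sz_gt0 sa.
  have [|c lt] := sz_lead dA na (b := b); first by rewrite sa.
  apply/allpairsP; exists (c, a - kappa c * b) => /=.
  by split; [rewrite mem_enum | apply: Hs; rewrite -ltnS -sa | rewrite addrC subrK].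
exists s; split; first by rewrite (leq_trans ss) // leq_pexp2l // (cardD1 0).
move=> a; rewrite leq_eqVlt => /orP [/eqP sa|]; last by rewrite ltnS => /Hs.
by case: nb; exists a.
Qed.

End DegreeRingTheory.

(** * Adjoining a root of [X^q = X + z], totally ramified at infinity *)

Section ExtensionStep.
Variables (F : finFieldType) (A : comNzRingType) (kappa : {rmorphism F -> A}).
Variables (sz : A -> nat) (dA : degree_ring kappa sz).
Variables (q d : nat) (z : A).
Hypotheses (q_gt1 : (1 < q)%N) (d_gt0 : (0 < d)%N) (co_dq : coprime d q).
Hypothesis sz_z : sz z = d.+1.

Definition ext_poly : {poly A} := 'X^q - ('X + z%:P).
Notation h := ext_poly.
Notation A' := {poly %/ h}.

Lemma ext_poly_size : size h = q.+1.
Proof. by rewrite size_polyDl size_polyXn // size_polyN size_XaddC ltnS. Qed.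

Lemma ext_poly_monic : h \is monic.
Proof.
by rewrite monicE lead_coefDl ?lead_coefXn // size_polyN size_XaddC size_polyXn ltnS.
Qed.

Lemma mk_monic_ext : mk_monic h = h.
Proof. by rewrite /mk_monic ext_poly_size ltnS ltnW // ext_poly_monic. Qed.

Lemma size_ext (u : A') : (size (u : {poly A}) <= q)%N.
Proof. by rewrite -ltnS; apply: leq_trans (size_mk_monic u) _; rewrite mk_monic_ext ext_poly_size. Qed.

Lemma in_ext_small (u : {poly A}) : (size u <= q)%N -> in_qpoly h u = u :> {poly A}.
Proof. by move=> su; rewrite in_qpoly_small // mk_monic_ext ext_poly_size ltnS. Qed.

Lemma ext_root : in_qpoly h 'X^q = in_qpoly h 'X + in_qpoly h z%:P.
Proof.
apply/eqP; rewrite -rmorphD /= -subr_eq0 -rmorphB /=; apply/eqP/val_inj => /=.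
by rewrite -/ext_poly mk_monic_ext Pdiv.RingMonic.rmodpp // ext_poly_monic.
Qed.

(* The size of a X^i in the extension: degrees in A are multiplied by q, and X has
   degree d. As d is coprime to q, distinct i < q give distinct weights. *)
Definition ext_wt (i s : nat) : nat := if s is s'.+1 then (q * s' + i * d).+1 else 0.

Lemma ext_wt_inj i j s t : (i < q)%N -> (j < q)%N -> (0 < s)%N ->
  ext_wt i s = ext_wt j t -> i = j /\ s = t.
Proof.
case: s => // s iq jq _; case: t => //= t [E].
have Em : (i * d)%N = (j * d)%N %[mod q].
  by rewrite -[LHS](modnMDl s) -[RHS](modnMDl t) ![(_ * q)%N]mulnC E.
have ij : i = j.
  wlog le_ij : i j iq jq {E} Em / (i <= j)%N.
    by move=> H; case: (leqP i j) => [/H|/ltnW /H E']; [apply | apply/esym/E'].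
  move/esym/eqP: Em; rewrite eqn_mod_dvd ?leq_mul2r ?le_ij ?orbT // -mulnBl.
  rewrite Gauss_dvdl 1?coprime_sym // => /dvdn_leq; lia.
by split => //; move/eqP: E; rewrite ij eqn_add2r eqn_pmul2l ?(ltnW q_gt1) // => /eqP ->.
Qed.

Lemma ext_wt_le i s t : (s <= t)%N -> (ext_wt i s <= ext_wt i t)%N.
Proof. by case: s t => // s [|t] //= st; rewrite ltnS leq_add2r leq_mul2l orbC -ltnS st. Qed.

Lemma ext_wt_lt i s t : (s < t)%N -> (ext_wt i s < ext_wt i t)%N.
Proof.
case: s t => [|s] [|t] //= st; rewrite ltnS ltn_add2r ltn_pmul2l //.
exact: ltnW.
Qed.

Definition ext_sz (u : A') : nat := \max_(i < q) ext_wt i (sz (u : {poly A})`_i).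

Lemma ext_sz_coef (u : A') i : (ext_wt i (sz (u : {poly A})`_i) <= ext_sz u)%N.
Proof.
have [iq|qi] := ltnP i q; first exact: (leq_bigmax (Ordinal iq)).
by rewrite nth_default ?(dr_sz0 dA) // (leq_trans (size_ext u)).
Qed.

Lemma ext_szP (u : A') : u != 0 ->
  exists2 i : nat, (i < q)%N & (u : {poly A})`_i != 0
    /\ ext_sz u = ext_wt i (sz (u : {poly A})`_i).
Proof.
move=> nu; have q0 : (0 < #|'I_q|)%N by rewrite card_ord ltnW.
have [i E] := @bigop.eq_bigmax _ (fun i : 'I_q => ext_wt i (sz (u : {poly A})`_i)) q0.
exists i => //; split => //; apply: contra nu => /eqP ui.
apply/eqP/val_inj/polyP => j /=; rewrite coef0.
have := ext_sz_coef u j; rewrite /ext_sz E ui (dr_sz0 dA) leqn0.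
by case: (sz _) (sz_eq0 dA (u : {poly A})`_j) => //= /esym /eqP.
Qed.

Lemma ext_sz_lt (u : A') n : (0 < n)%N ->
  (forall i, (i < q)%N -> (ext_wt i (sz (u : {poly A})`_i) < n)%N) -> (ext_sz u < n)%N.
Proof.
case: n => // n _ H; rewrite ltnS /ext_sz; apply/bigmax_leqP => i _.
by rewrite -ltnS H.
Qed.

Lemma ext_sz_eq0 u : (ext_sz u == 0%N) = (u == 0).
Proof.
apply/eqP/eqP => [E|->]; last first.
  by rewrite /ext_sz big1 // => i _; rewrite coef0 (dr_sz0 dA).
apply/eqP/negP => /negP nu; have [i iq [ui Ei]] := ext_szP nu.
move: ui Ei; rewrite E -(dr_sz_gt0 dA); by case: (sz _).
Qed.

Lemma ext_sz_sub (u v : A') : (ext_sz (u - v)%R <= maxn (ext_sz u) (ext_sz v))%N.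
Proof.
apply/bigmax_leqP => i _; rewrite [X in sz X](_ : _ = (u : {poly A})`_i - (v : {poly A})`_i).
  have := sz_sub dA (u : {poly A})`_i (v : {poly A})`_i.
  rewrite !leq_max => /orP [] /(ext_wt_le i) le.
    by rewrite (leq_trans le) ?ext_sz_coef.
  by rewrite orbC (leq_trans le) ?ext_sz_coef.
by rewrite -coefB.
Qed.

Definition ext_mono (a : A) (i : nat) : A' := in_qpoly h (a *: 'X^i).

Lemma coef_ext_mono a i j : (i < q)%N ->
  (ext_mono a i : {poly A})`_j = if j == i then a else 0.
Proof.
move=> iq; rewrite in_ext_small; last first.
  by apply: leq_trans (size_scale_leq _ _) _; rewrite size_polyXn.
by rewrite coefZ coefXn; case: eqP; rewrite ?mulr1 ?mulr0.
Qed.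

Lemma ext_mono0 i : ext_mono 0 i = 0.
Proof. by rewrite /ext_mono scale0r rmorph0. Qed.

Lemma ext_sz_mono_small a i : (i < q)%N -> ext_sz (ext_mono a i) = ext_wt i (sz a).
Proof.
move=> iq; apply/eqP; rewrite eqn_leq; apply/andP; split.
  apply/bigmax_leqP => j _; rewrite coef_ext_mono //; case: eqP => [->//|_].
  by rewrite (dr_sz0 dA).
by have := ext_sz_coef (ext_mono a i) i; rewrite coef_ext_mono // eqxx.
Qed.

Lemma ext_monoM a b i j : ext_mono a i * ext_mono b j = ext_mono (a * b) (i + j).
Proof. by rewrite /ext_mono -rmorphM /= -scalerAl -scalerAr scalerA exprD. Qed.

Lemma ext_mono_sum (u : A') : u = \sum_(i < q) ext_mono (u : {poly A})`_i i.
Proof.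
apply: val_inj; rewrite /= raddf_sum /=; apply/polyP => j; rewrite coef_sum.
have [jq|qj] := ltnP j q; last first.
  rewrite nth_default ?(leq_trans (size_ext u)) // big1 // => i _.
  rewrite coef_ext_mono //; case: eqP => // ji.
  by move: (ltn_ord i); rewrite -ji ltnNge qj.
rewrite (bigD1 (Ordinal jq)) //= coef_ext_mono // eqxx big1 ?addr0 // => i.
rewrite -val_eqE /= coef_ext_mono // eq_sym; by case: eqP.
Qed.

Lemma ext_mono_reduce a i : (q <= i)%N ->
  ext_mono a i = ext_mono (a * z) (i - q) + ext_mono a (i - q).+1.
Proof.
move=> qi; rewrite -[i in LHS](subnKC qi) -[a in LHS]mul1r -ext_monoM.
rewrite {1}/ext_mono scale1r ext_root mulrDl addrC; congr (_ + _).
  by rewrite -[a * z]mulrC -[(i - q)%N in RHS]add0n -ext_monoM /ext_mono expr0 alg_polyC.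
by rewrite -[a in RHS]mul1r -add1n -ext_monoM /ext_mono scale1r expr1.
Qed.

Lemma ext_sz_sub_lt (u v : A') n : (ext_sz u < n)%N -> (ext_sz v < n)%N -> (ext_sz (u - v)%R < n)%N.
Proof. by move=> un vn; apply: leq_ltn_trans (ext_sz_sub _ _) _; rewrite gtn_max un. Qed.

Lemma ext_szN (v : A') : ext_sz (- v) = ext_sz v.
Proof.
suff le w : (ext_sz (- w)%R <= ext_sz w)%N.
  by apply/eqP; rewrite eqn_leq le -{1}[v]opprK le.
rewrite -[- w]add0r; apply: leq_trans (ext_sz_sub _ _) _.
by rewrite (eqP (_ : ext_sz 0 == 0%N)) ?max0n // ext_sz_eq0.
Qed.

Lemma ext_sz_add_lt (u v : A') n : (ext_sz u < n)%N -> (ext_sz v < n)%N -> (ext_sz (u + v)%R < n)%N.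
Proof. by move=> un vn; rewrite -[v]opprK; apply: ext_sz_sub_lt; rewrite ?ext_szN. Qed.

Lemma ext_sz_addl (u v : A') : (ext_sz v < ext_sz u)%N -> ext_sz (u + v)%R = ext_sz u.
Proof.
move=> lt; apply/eqP; rewrite eqn_leq; apply/andP; split.
  rewrite -[v]opprK; apply: leq_trans (ext_sz_sub _ _) _.
  by rewrite ext_szN geq_max leqnn ltnW.
have := ext_sz_sub (u + v) v; rewrite addrK leq_max => /orP [//|].
by rewrite leqNgt lt.
Qed.

(* Reducing with X^q = X + z keeps the degree, because z has degree d. *)
Lemma ext_sz_mono a i : (i <= (q.-1).*2)%N -> ext_sz (ext_mono a i) = ext_wt i (sz a).
Proof.
move=> iq2; have [iq|qi] := ltnP i q; first exact: ext_sz_mono_small.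
have [->|na] := eqVneq a 0.
  by rewrite ext_mono0 (dr_sz0 dA); apply/eqP; rewrite ext_sz_eq0.
have i1 : (i - q < q)%N by lia.
have i2 : ((i - q).+1 < q)%N by lia.
have nz : z != 0 by rewrite -(dr_sz_gt0 dA) sz_z.
have E1 : ext_sz (ext_mono (a * z) (i - q)) = ext_wt i (sz a).
  rewrite ext_sz_mono_small // (sz_mul dA) // sz_z.
  move: na; rewrite -(dr_sz_gt0 dA); case: (sz a) => // s _ /=.
  rewrite addnS /= mulnDr -addnA -mulnDl subnKC //.
rewrite ext_mono_reduce // ext_sz_addl // E1 ext_sz_mono_small //.
move: na; rewrite -(dr_sz_gt0 dA); case: (sz a) => // s _ /=.
by rewrite ltnS ltn_add2l ltn_pmul2r //; lia.
Qed.

Lemma ext_wtM i j s t : (0 < s)%N -> (0 < t)%N ->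
  ext_wt (i + j) (s + t).-1 = (ext_wt i s + ext_wt j t).-1.
Proof. by case: s => // s _; case: t => // t _; rewrite addSn addnS /=; lia. Qed.

(** Products of monomials have exponent at most [2 (q - 1)], where [ext_sz_mono] still gives the
    weight. Weights being distinct within [u] and within [v], the product of the two dominant
    monomials outweighs all the others. *)
Lemma ext_sz_mul (u v : A') : u != 0 -> v != 0 -> ext_sz (u * v)%R = (ext_sz u + ext_sz v).-1.
Proof.
move=> nu nv; have [i0 iq [ui Ei]] := ext_szP nu; have [j0 jq [vj Ej]] := ext_szP nv.
pose U i := (u : {poly A})`_i; pose V i := (v : {poly A})`_i.
have mono_small i j : (i < q)%N -> (j < q)%N -> (i + j <= (q.-1).*2)%N by lia.
have main : ext_sz (ext_mono (U i0 * V j0) (i0 + j0)) = (ext_sz u + ext_sz v).-1.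
  rewrite ext_sz_mono ?mono_small // (sz_mul dA) // Ei Ej ext_wtM //;
  by rewrite (dr_sz_gt0 dA).
have K0 : (0 < (ext_sz u + ext_sz v).-1)%N.
  by move: nu nv; rewrite -!ext_sz_eq0; lia.
have Dv (i : 'I_q) : ext_mono (U i) i * v = \sum_(j < q) ext_mono (U i * V j) (i + j).
  rewrite {1}(ext_mono_sum v) mulr_sumr; apply: eq_bigr => j _.
  by rewrite ext_monoM.
have Euv : u * v = \sum_(i < q) \sum_(j < q) ext_mono (U i * V j) (i + j).
  rewrite {1}(ext_mono_sum u) mulr_suml; apply: eq_bigr => i _; exact: Dv.
have wU i : (i < q)%N -> (i != i0) -> U i != 0 -> (ext_wt i (sz (U i)) < ext_sz u)%N.
  move=> iq' ni nU; rewrite ltn_neqAle ext_sz_coef andbT; apply/eqP => E.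
  have p : (0 < sz (U i))%N by rewrite (dr_sz_gt0 dA).
  have [ii _] := ext_wt_inj iq' iq p (etrans E Ei).
  by rewrite ii eqxx in ni.
have wV i : (i < q)%N -> (i != j0) -> V i != 0 -> (ext_wt i (sz (V i)) < ext_sz v)%N.
  move=> iq' ni nU; rewrite ltn_neqAle ext_sz_coef andbT; apply/eqP => E.
  have p : (0 < sz (V i))%N by rewrite (dr_sz_gt0 dA).
  have [ii _] := ext_wt_inj iq' jq p (etrans E Ej).
  by rewrite ii eqxx in ni.
have small i j : (i < q)%N -> (j < q)%N -> (i != i0) || (j != j0) ->
    (ext_sz (ext_mono (U i * V j)%R (i + j)%N) < (ext_sz u + ext_sz v).-1)%N.
  move=> iq' jq' nij; rewrite ext_sz_mono ?mono_small //.
  have [E|nU] := eqVneq (U i) 0; first by rewrite E mul0r (dr_sz0 dA).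
  have [E|nV] := eqVneq (V j) 0; first by rewrite E mulr0 (dr_sz0 dA).
  rewrite (sz_mul dA) // ext_wtM ?(dr_sz_gt0 dA) //.
  have le1 := ext_sz_coef u i; have le2 := ext_sz_coef v j.
  have p1 : (0 < ext_wt i (sz (U i)))%N.
    by move: nU; rewrite -(dr_sz_gt0 dA); case: (sz _).
  have p2 : (0 < ext_wt j (sz (V j)))%N.
    by move: nV; rewrite -(dr_sz_gt0 dA); case: (sz _).
  rewrite -/(U i) in le1; rewrite -/(V j) in le2.
  case/orP: nij => n.
    have := wU _ iq' n nU; lia.
  have := wV _ jq' n nV; lia.
have sum_lt (I : finType) (P : pred I) (f : I -> A') :
    (forall i, P i -> (ext_sz (f i) < (ext_sz u + ext_sz v).-1)%N) ->
    (ext_sz (\sum_(i | P i) f i)%R < (ext_sz u + ext_sz v).-1)%N.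
  move=> H; apply: (big_ind (fun x => ext_sz x < _)%N) => //.
    by rewrite (eqP (_ : ext_sz 0 == 0%N)) ?ext_sz_eq0.
  by move=> x y; apply: ext_sz_add_lt.
rewrite Euv (bigD1 (Ordinal iq)) //= (bigD1 (Ordinal jq)) //=.
rewrite -addrA ext_sz_addl main //; apply: ext_sz_add_lt.
  by apply: (sum_lt) => j nj; apply: small; rewrite ?nj ?orbT.
apply: (sum_lt) => i ni; apply: (sum_lt) => j _; apply: small => //.
by rewrite -[i != i0 :> nat]/(i != Ordinal iq) ni.
Qed.

(** Equal sizes force the dominant monomials of [u] and [v] to have the same exponent and
    coefficients of equal size, so the constant that cancels leading terms in [A] also serves
    here. *)
Lemma ext_sz_lead (u v : A') : u != 0 -> ext_sz u = ext_sz v ->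
  exists c : F, (ext_sz (u - qpolyC h (kappa c) * v)%R < ext_sz u)%N.
Proof.
move=> nu E; have nv : v != 0 by rewrite -ext_sz_eq0 -E ext_sz_eq0.
have [i0 iq [ui Ei]] := ext_szP nu; have [j0 jq [vj Ej]] := ext_szP nv.
have p0 : (0 < sz (u : {poly A})`_i0)%N by rewrite (dr_sz_gt0 dA).
have [ij ss] := ext_wt_inj iq jq p0 (etrans (esym Ei) (etrans E Ej)).
subst j0; have [c lt] := sz_lead dA ui ss; exists c.
have coefv i : (qpolyC h (kappa c) * v : {poly A})`_i = kappa c * (v : {poly A})`_i.
  have -> : qpolyC h (kappa c) * v = kappa c *: v.
    by rewrite -[in RHS](mul1r v) scalerAl; congr (_ * _); apply: val_inj; rewrite /= alg_polyC.
  by rewrite coefZ.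
apply: ext_sz_lt => [|i iq']; first by rewrite lt0n ext_sz_eq0.
have -> : ((u - qpolyC h (kappa c) * v)%R : {poly A})`_i
    = (u : {poly A})`_i - kappa c * (v : {poly A})`_i by rewrite -coefv -coefB.
have [->|ni] := eqVneq i i0; first by rewrite Ei ext_wt_lt.
set a := (u : {poly A})`_i; set b := kappa c * _.
have ltx (w : A') j : (w : {poly A})`_j != 0 -> ext_sz w = ext_wt j (sz (w : {poly A})`_j) -> (j < q)%N ->
   (i != j) -> ext_sz w = ext_sz u -> (ext_wt i (sz (w : {poly A})`_i) < ext_sz u)%N.
  move=> nw Ew jq' nij Eu; rewrite -Eu ltn_neqAle ext_sz_coef andbT; apply/eqP => Eij.
  have [wi|wi] := eqVneq (w : {poly A})`_i 0.
    move: Eij nw; rewrite wi (dr_sz0 dA) Ew /= -(dr_sz_gt0 dA); by case: (sz _).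
  have p : (0 < sz (w : {poly A})`_i)%N by rewrite (dr_sz_gt0 dA).
  have [ii _] := ext_wt_inj iq' jq' p (etrans Eij Ew).
  by rewrite ii eqxx in nij.
have lta := ltx u i0 ui Ei iq ni erefl; have ltb := ltx v i0 vj Ej jq ni (esym E).
have : (sz (a - b)%R <= maxn (sz a) (sz (v : {poly A})`_i))%N.
  apply: leq_trans (sz_sub dA _ _) _; rewrite geq_max leq_max leqnn /=.
  by rewrite leq_max dr_sz_scale_le ?orbT.
by rewrite leq_max => /orP [] /(ext_wt_le i) /leq_ltn_trans; apply.
Qed.

Lemma ext_degree_ring : degree_ring (qpolyC h \o kappa) ext_sz.
Proof.
split; [exact: ext_sz_eq0 | exact: ext_sz_sub | exact: ext_sz_mul | exact: ext_sz_lead].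
Qed.

Lemma ext_sz_C a : ext_sz (qpolyC h a) = ext_wt 0 (sz a).
Proof.
rewrite -ext_sz_mono_small ?(ltnW q_gt1) //; congr ext_sz; apply: val_inj => /=.
rewrite -[RHS]/(in_qpoly h _ : {poly A}) in_ext_small expr0 alg_polyC //.
by rewrite (leq_trans (size_polyC_leq1 _)) // ltnW.
Qed.

Lemma ext_sz_X : ext_sz (in_qpoly h 'X) = d.+1.
Proof.
have -> : in_qpoly h 'X = ext_mono 1 1 by rewrite /ext_mono scale1r.
by rewrite ext_sz_mono_small // (dr_sz1 dA) /= muln0 mul1n.
Qed.

Lemma ext_gen (P : A' -> Prop) : (forall u v, P u -> P v -> P (u + v)) ->
  (forall u v, P u -> P v -> P (u * v)) -> (forall a, P (qpolyC h a)) ->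
  P (in_qpoly h 'X) -> forall u, P u.
Proof.
move=> PD PM PC PX u; have P0 : P 0 by rewrite -(qpolyC0 h).
rewrite (ext_mono_sum u); apply: big_ind => // i _.
have -> : ext_mono (u : {poly A})`_i i = qpolyC h (u : {poly A})`_i * in_qpoly h 'X ^+ i.
  rewrite -rmorphXn /=; apply: val_inj; rewrite /= Pdiv.RingMonic.rmodp_mulmr ?monic_mk_monic //.
  by rewrite mul_polyC.
apply: (PM) => //; elim: (nat_of_ord i) => [|n IH]; last by rewrite exprS; apply: PM.
by rewrite expr0 -[1]/(qpolyC h 1).
Qed.

End ExtensionStep.

(* The tower adjoins the coordinates y_1, ..., y_l of a solution of
   Frob(Y) = Y (1 - x t) in 1 + t A[t] / t^(l+1), i.e. the function field of
   the ray class cover of the affine line with group 1 + t F[t] / t^(l+1). *)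
Definition tower_prop (F : finFieldType) (l : nat) (A : comNzRingType)
    (io : {rmorphism {poly F} -> A}) (sz : A -> nat) (y : nat -> A) : Prop :=
  let q := #|F| in
  [/\ degree_ring (io \o polyC) sz,
      forall h, h != 0 -> sz (io h) = (q ^ l * (size h).-1).+1,
      y 0 = 1 /\ (forall j, (j < l)%N -> y j.+1 ^+ q = y j.+1 - io 'X * y j),
      sz (y l) = (\sum_(i < l) q ^ i)%N.+1 /\
        (forall j, (j <= l)%N -> (0 < sz (y j) <= sz (y l))%N)
    & forall P : A -> Prop, (forall a b, P a -> P b -> P (a + b)) ->
        (forall a b, P a -> P b -> P (a * b)) -> (forall h, P (io h)) ->
        (forall j, (j <= l)%N -> P (y j)) -> forall a, P a].

(** By induction on [l]: the new coordinate is a root of [X^q = X - x y_l]. *)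
Lemma tower_exists (F : finFieldType) (l : nat) :
  exists (A : comNzRingType) (io : {rmorphism {poly F} -> A}) (sz : A -> nat)
    (y : nat -> A), tower_prop l io sz y.
Proof.
have q1 : (1 < #|F|)%N := card_finNzRing_gt1 F.
elim: l => [|l [A [io [sz [y [dA szio [y0 yS] [szy szy_le] gen]]]]]].
  exists {poly F}, idfun, (fun h => size (h : {poly F})), (fun=> 1); split.
  - split => /=.
    + by move=> a; rewrite size_poly_eq0.
    + by move=> a b; apply: leq_trans (size_polyD _ _) _; rewrite size_polyN.
    + by move=> a b; apply: size_mul.
    + move=> a b na E; exists (lead_coef a / lead_coef b).
      have nb : b != 0 by rewrite -size_poly_eq0 -E size_poly_eq0.
      have [n sa] : exists n, size a = n.+1.
        by exists (size a).-1; rewrite prednK // size_poly_gt0.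
      have sb : size b = n.+1 by rewrite -E.
      rewrite [X in (_ < X)%N]sa ltnS; apply/leq_sizeP => i.
      rewrite coefB coefCM leq_eqVlt => /orP [/eqP <-|ni].
        have -> : a`_n = lead_coef a by rewrite lead_coefE sa.
        have -> : b`_n = lead_coef b by rewrite lead_coefE sb.
        by rewrite divfK ?lead_coef_eq0 ?subrr.
      by rewrite !nth_default ?sa ?sb // mulr0 subrr.
  - by move=> h nh; rewrite expn0 mul1n prednK // size_poly_gt0.
  - by [].
  - by split => // [|j _]; rewrite ?big_ord0 size_poly1.
  - by move=> P _ _ Ph _ a; apply: Ph.
set q := #|F| in q1 szio szy yS *.
have nx : io 'X != 0 by rewrite -(dr_sz_gt0 dA) szio ?polyX_eq0.
have nyl : y l != 0 by rewrite -(dr_sz_gt0 dA) szy.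
(* [d] will be the degree of [z]. Its first form below is the sum of the degrees of [x] and [y_l];
   the second shows that it is prime to [q]. *)
pose d := (\sum_(i < l.+1) q ^ i)%N.
have dE : d = (q ^ l + \sum_(i < l) q ^ i)%N by rewrite /d big_ord_recr addnC.
have dE' : d = (1 + q * \sum_(i < l) q ^ i)%N.
  rewrite /d big_ord_recl expn0; congr (_ + _)%N.
  by rewrite big_distrr; apply: eq_bigr => i _; rewrite lift0 expnS.
pose z := - (io 'X * y l).
have szz : sz z = d.+1.
  by rewrite (dr_szN dA) (sz_mul dA) // szy szio ?polyX_eq0 // size_polyX muln1 addSn addnS dE.
have d0 : (0 < d)%N by rewrite dE'.
have co : coprime d q.
  by rewrite dE' coprime_sym /coprime addnC mulnC gcdnMDl gcdn1.
have dA' := ext_degree_ring dA q1 d0 co szz.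
pose h := ext_poly q z.
exists {poly %/ h}, (qpolyC h \o io), (@ext_sz _ sz q d z),
  (fun j => if (j <= l)%N then qpolyC h (y j) else in_qpoly h 'X).
have szC a := ext_sz_C dA d z q1 a.
have szX := ext_sz_X dA d z q1.
split.
- by case: dA' => *; split.
- by move=> g ng /=; rewrite szC szio //= mul0n addn0 expnS mulnA.
- split; first by rewrite leq0n y0.
  move=> j jl1 /=; have [->|nj] := eqVneq j l.
    rewrite ltnn leqnn -rmorphXn /=.
    have := ext_root z q1; rewrite -/h => ->; congr (_ + _).
    rewrite -rmorphM -rmorphN; apply: val_inj.
    have sC : (size z%:P <= q)%N by rewrite (leq_trans (size_polyC_leq1 _)) // ltnW.
    exact: (in_ext_small z q1 sC).
  have jl : (j < l)%N by rewrite ltn_neqAle nj -ltnS.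
  by rewrite jl ltnW //= -rmorphXn -rmorphM -rmorphB yS.
- split; first by rewrite ltnn szX.
  move=> j jl; rewrite ltnn szX; case: ifP => [jl'|_]; last by rewrite szX leqnn.
  rewrite szC; have /andP [] := szy_le j jl'; rewrite szy; case: (sz _) => //= s _.
  by rewrite mul0n addn0 !ltnS dE' => s2; rewrite ltnW // add1n ltnS leq_mul2l s2 orbT.
- move=> P PD PM Pio Py; apply: (ext_gen q1) => //; last first.
    by have := Py l.+1 (leqnn _); rewrite ltnn.
  apply: gen => [a b Pa Pb|a b Pa Pb|g|j jl]; rewrite ?rmorphD ?rmorphM; auto.
    exact: Pio.
  by have := Py j (leqW jl); rewrite jl.
Qed.

(** * Monic polynomials and Newton's identities *)

Definition prime_poly (F : finFieldType) (p : {poly F}) : bool :=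
  (p \is monic) && irreducibleb p.

Definition mon (F : finFieldType) d (g : {poly_d F}) : {poly F} := 'X^d + (g : {poly F}).

Section MonicPolynomials.
Variable F : finFieldType.
Implicit Types p h : {poly F}.

Lemma size_mon d (g : {poly_d F}) : size (mon g) = d.+1.
Proof. by rewrite size_polyDl size_polyXn // ltnS size_npoly. Qed.

Lemma mon_monic d (g : {poly_d F}) : mon g \is monic.
Proof. by rewrite monicE lead_coefDl ?lead_coefXn // size_polyXn ltnS size_npoly. Qed.

Lemma size_subXn d h : h \is monic -> size h = d.+1 -> (size (h - 'X^d)%R <= d)%N.
Proof.
move=> mh sh; apply/leq_sizeP => i; rewrite leq_eqVlt => /orP [/eqP <-|di].
  by rewrite coefB coefXn eqxx; move: mh; rewrite monicE lead_coefE sh => /eqP ->; rewrite subrr.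
by rewrite coefB coefXn gtn_eqF // nth_default ?sh ?subrr.
Qed.

Lemma monK d h : h \is monic -> size h = d.+1 -> mon (npolyp d (h - 'X^d)) = h.
Proof. by move=> mh sh; rewrite /mon npolypK ?size_subXn // addrC subrK. Qed.

Lemma mon_inj d : injective (@mon F d).
Proof. by move=> g g' /addrI /val_inj. Qed.

(** Used twice: with [A] a prime power, for the Newton identities of L-functions, and with [A] a
    product of distinct linear factors, for counting roots. *)
Lemma sum_mon_dvd (C : nmodType) (f : {poly F} -> C) (A : {poly F}) i d :
  A \is monic -> size A = i.+1 ->
  \sum_(g : {poly_d F} | A %| mon g) f (mon g) =
  if (i <= d)%N then \sum_(g : {poly_(d - i) F}) f (A * mon g) else 0.
Proof.
move=> mA sA; have nA : A != 0 by rewrite monic_neq0.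
case: leqP => [id|di]; last first.
  rewrite big1 // => g /dvdp_leq; rewrite size_mon sA ltnS leqNgt di.
  by rewrite -size_poly_gt0 size_mon => /(_ isT).
have sM (g : {poly_(d - i) F}) : size (A * mon g) = d.+1.
  by rewrite size_Mmonic ?mon_monic // sA size_mon addSn addnS /= subnKC.
have mM (g : {poly_(d - i) F}) : A * mon g \is monic by rewrite rpredM // mon_monic.
pose to (g : {poly_(d - i) F}) : {poly_d F} := npolyp d (A * mon g - 'X^d).
pose fro (g : {poly_d F}) : {poly_(d - i) F} := npolyp (d - i) (mon g %/ A - 'X^(d - i)).
have toK g : mon (to g) = A * mon g by rewrite /to monK ?mM ?sM.
have froK g : A %| mon g -> mon (fro g) = mon g %/ A.
  move=> dv; have sd : size (mon g %/ A) = (d - i).+1 by rewrite size_divp // size_mon sA subSn.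
  have md : mon g %/ A \is monic.
    by rewrite -(monicMl _ mA) mulrC divpK // mon_monic.
  by rewrite /fro monK ?md ?sd.
rewrite (reindex to) /=; last first.
  exists fro => [g _|g]; last rewrite inE => dv; apply: mon_inj.
    by rewrite froK toK ?dvdp_mulr // mulKp.
  by rewrite toK froK // mulrC divpK.
apply: eq_big => [g|g _]; last by rewrite toK.
by rewrite toK dvdp_mulr.
Qed.

Lemma prime_polyW p : prime_poly p -> monic_irreducible_poly p.
Proof. by case/andP => mp /irreducibleP ip; split. Qed.

Lemma prime_poly_size p : prime_poly p -> (1 < size p)%N.
Proof. by move=> /prime_polyW [[]]. Qed.

Lemma prime_poly_gauss p g h : prime_poly p -> ~~ (p %| g) ->
  forall e, (p ^+ e %| g * h) = (p ^+ e %| h).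
Proof.
move=> pp ng e; rewrite Gauss_dvdpr //; apply: coprimep_expl.
by rewrite irreducible_poly_coprime //; have [] := prime_polyW pp.
Qed.

Lemma prime_poly_neq p g : prime_poly p -> prime_poly g -> p != g -> ~~ (p %| g).
Proof.
move=> pp pg; apply: contra => dv; have [[sp _] mp] := prime_polyW pp.
have [[sg ig] mg] := prime_polyW pg.
have /ig /(_ dv) : size p != 1%N by rewrite gtn_eqF.
by rewrite eqp_monic // => /eqP ->.
Qed.

Lemma exists_prime_factor h : h \is monic -> (1 < size h)%N ->
  exists2 p, prime_poly p & p %| h.
Proof.
have [n] := ubnP (size h); elim: n h => // n IH h hn mh sh.
have [ih|/irreducibleP] := boolP (irreducibleb h).
  by exists h => //; rewrite /prime_poly mh.
case: (EM (exists g, [/\ g \is monic, g %| h, size g != 1%N & (size g < size h)%N])) =>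
  [[g [mg dg s1 sg]] _|no []].
  have [||p pp pg] := IH g _ mg; first exact: leq_trans sg _.
    by rewrite ltn_neqAle eq_sym s1 size_poly_gt0 monic_neq0.
  by exists p => //; apply: dvdp_trans dg.
split => // g s1 dg; have nh := monic_neq0 mh.
have ng : g != 0 by apply: contraNneq nh => g0; move: dg; rewrite g0 dvd0p.
have nl : (lead_coef g)^-1 != 0 by rewrite invr_eq0 lead_coef_eq0.
rewrite -dvdp_size_eqp //; apply/negP => /negP ns; apply: no.
exists ((lead_coef g)^-1 *: g); split.
- by rewrite monicE lead_coefZ mulVf // lead_coef_eq0.
- by rewrite dvdpZl.
- by rewrite size_scale.
- by rewrite size_scale // ltn_neqAle ns dvdp_leq.
Qed.

(** Each prime contributes its degree times its multiplicity in [h]. Splitting off a prime factor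
    [p0] shifts the exponents of [p0] by one and leaves those of the other primes alone. *)
Lemma prime_power_sum B h : h \is monic -> (size h <= B.+1)%N ->
  (\sum_(p : {poly_(B.+1) F} | prime_poly p)
     \sum_(1 <= e < B.+1) ((p : {poly F}) ^+ e %| h)%R * (size p).-1 = (size h).-1)%N.
Proof.
have [n] := ubnP (size h); elim: n h => // n IH h hn mh hB.
have [sh|sh] := leqP (size h) 1.
  have -> : h = 1.
    by have hE := size1_polyC sh; move: mh; rewrite hE => /monicP; rewrite lead_coefC => ->.
  rewrite size_poly1 big1 // => p pp; rewrite big_nat_cond big1 // => e /andP [/andP [e1 _] _].
  rewrite dvdp1; case: eqP => // E; have := size_exp (p : {poly F}) e; rewrite E /=.
  by move/esym/eqP; rewrite muln_eq0 => /orP [/eqP ->|]; rewrite ?muln0 //; lia.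
have [p0 pp0 dv0] := exists_prime_factor mh sh.
have [[s0 _] m0] := prime_polyW pp0.
pose h' : {poly F} := h %/ p0; have hE : h = p0 * h' by rewrite mulrC divpK.
have mh' : h' \is monic by rewrite -(monicMl _ m0) -hE.
have nh' : (0 < size h')%N by rewrite size_poly_gt0 monic_neq0.
have sE : (size h).-1 = ((size p0).-1 + (size h').-1)%N.
  rewrite hE size_Mmonic ?monic_neq0 //.
  by move: (size p0) (size h') s0 nh' => a b; lia.
have sB : (size p0 <= B.+1)%N by apply: leq_trans hB; apply: dvdp_leq => //; rewrite monic_neq0.
have shh : (size h' < size h)%N.
  by move: (size p0) (size h') (size h) s0 nh' sh sE => a b c; lia.
rewrite sE -(IH h') //; [|exact: leq_trans shh _|exact: leq_trans (ltnW shh) hB].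
pose P0 : {poly_(B.+1) F} := npolyp _ p0.
have P0E : P0 = p0 :> {poly F} by rewrite /P0 npolypK.
rewrite (bigD1 P0) ?P0E //= [in RHS](bigD1 P0) ?P0E //= addnA; congr (_ + _)%N; last first.
  apply: eq_bigr => p /andP [pp np]; apply: eq_bigr => e _.
  rewrite hE prime_poly_gauss // prime_poly_neq //.
  by apply: contra np => /eqP pE; apply/eqP/val_inj; rewrite /= P0E pE.
have B0 : (0 < B)%N by move: (size p0) s0 sB => a; lia.
(* The exponent [B] does not occur for [h'], whose degree is less than [B], so the shifted range of
   exponents loses nothing. *)
have e0 : (p0 ^+ B %| h')%R = false.
  apply/negP => /dvdp_leq; rewrite -size_poly_gt0 => /(_ nh').
  rewrite leqNgt => /negP; apply.
  have sp := size_exp p0 B; have : (B <= (size p0).-1 * B)%N.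
    by rewrite leq_pmull //; move: (size p0) s0 => a; lia.
  rewrite -sp; move: (size (p0 ^+ B)) (size h') (size h) shh hB => a b c; lia.
rewrite big_ltn // -[X in (\sum_(2 <= e < X.+1) _)%N](prednK B0) big_add1 /=.
rewrite expr1 hE dvdp_mulr // mul1n; congr (_ + _)%N.
rewrite -[X in _ = (\sum_(1 <= e < X.+1) _)%N](prednK B0) [RHS]big_nat_recr //= prednK // e0 mul0n addn0.
by apply: eq_bigr => e _; rewrite exprS dvdp_mul2l ?monic_neq0.
Qed.

End MonicPolynomials.

(** * Euler products and the Newton identities of L-functions *)

Section PrimeSums.
Variables (F : finFieldType) (C : comNzRingType) (X : {poly F} -> C).
Hypothesis X1 : X 1 = 1.
Hypothesis XM : forall g h, g \is monic -> h \is monic -> X (g * h) = X g * X h.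

(** The coefficient of [z^d] in the L-function of [X]. *)
Definition monic_sum d : C := \sum_(g : {poly_d F}) X (mon g).

(** The coefficient of [z^n] in [z L'(z) / L(z)], read off from the Euler product. Primes and
    exponents are cut off at [B], which is harmless for [n <= B]. *)
Definition prime_sum B n : C :=
  \sum_(p : {poly_(B.+1) F} | prime_poly p) \sum_(1 <= e < B.+1)
    (if (e * (size p).-1 == n)%N then X p ^+ e *+ (size p).-1 else 0).

Lemma mult_monicX g e : g \is monic -> X (g ^+ e) = X g ^+ e.
Proof.
by move=> mg; elim: e => [|e IH]; rewrite ?expr0 // !exprS XM ?IH // rpredX.
Qed.

Lemma monic_sum0 : monic_sum 0 = 1.
Proof.
rewrite /monic_sum (eq_bigr (fun=> 1)) => [|g _].
  by rewrite sumr_const card_npoly.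
by rewrite /mon expr0 (_ : (g : {poly F}) = 0) ?addr0 //; apply/eqP; rewrite -size_poly_leq0 size_npoly.
Qed.

(** Weighting a polynomial by its degree [d] means summing [deg p] over the prime powers [p^e]
    dividing it; writing it as [p^e] times a cofactor and exchanging sums gives the right-hand
    side. *)
Lemma monic_sum_newton B d : (d <= B)%N ->
  monic_sum d *+ d = \sum_(1 <= i < d.+1) prime_sum B i * monic_sum (d - i).
Proof.
move=> dB.
have -> : monic_sum d *+ d = \sum_(g : {poly_d F}) \sum_(p : {poly_(B.+1) F} | prime_poly p)
    \sum_(1 <= e < B.+1) (if (p : {poly F}) ^+ e %| mon g then X (mon g) *+ (size p).-1 else 0).
  rewrite -sumrMnl; apply: eq_bigr => g _.
  have := prime_power_sum (mon_monic g) (B := B); rewrite size_mon ltnS => /(_ dB) /= E.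
  transitivity (X (mon g) *+ (\sum_(p : {poly_(B.+1) F} | prime_poly p)
     \sum_(1 <= e < B.+1) ((p : {poly F}) ^+ e %| mon g)%R * (size p).-1)%N).
    by rewrite E.
  rewrite -sumrMnr; apply: eq_bigr => p _; rewrite -sumrMnr; apply: eq_bigr => e _.
  by case: (_ %| _); rewrite ?mul1n ?mul0n.
transitivity (\sum_(p : {poly_(B.+1) F} | prime_poly p) \sum_(1 <= e < B.+1)
   (if (e * (size p).-1 <= d)%N then X p ^+ e * monic_sum (d - e * (size p).-1) *+ (size p).-1 else 0)).
  rewrite exchange_big; apply: eq_bigr => p pp; rewrite exchange_big; apply: eq_bigr => e _.
  have mp : (p : {poly F}) \is monic by case/andP: pp.
  have mpe : (p : {poly F}) ^+ e \is monic by rewrite rpredX.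
  have spe : size ((p : {poly F}) ^+ e) = (e * (size p).-1).+1.
    by rewrite mulnC -size_exp prednK // size_poly_gt0 monic_neq0.
  rewrite -big_mkcond /= (sum_mon_dvd (fun h => X h *+ (size p).-1) d mpe spe).
  case: leqP => // _; rewrite /monic_sum mulr_sumr -sumrMnl; apply: eq_bigr => g _.
  by rewrite XM ?mon_monic // mult_monicX.
under [RHS]eq_bigr => i _ do rewrite /prime_sum mulr_suml.
rewrite [RHS]exchange_big /=; apply: eq_bigr => p pp.
under [RHS]eq_bigr => i _ do rewrite mulr_suml.
rewrite [RHS]exchange_big_nat /=; rewrite big_nat_cond [RHS]big_nat_cond; apply: eq_bigr => e.
case/andP => /andP [e1 _] _.
case: leqP => [le|gt]; last first.
  rewrite big_nat_cond big1 // => i /andP [/andP [_ id] _].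
  case: eqP => [E|]; last by rewrite mul0r.
  by move: gt; rewrite E ltnNge -ltnS id.
have sp := prime_poly_size pp.
have n0 : (0 < e * (size p).-1)%N by rewrite muln_gt0 e1; move: sp; case: (size p) => [|[]].
rewrite (big_cat_nat (n := e * (size p).-1)) //=; last exact: ltnW.
rewrite big_nat_cond big1 ?add0r; last first.
  move=> i /andP [/andP [_ id] _]; case: eqP => [E|]; last by rewrite mul0r.
  by move: id; rewrite E ltnn.
rewrite big_ltn // eqxx big_nat_cond big1 ?addr0; first by rewrite mulrnAl.
move=> i /andP [/andP [id _] _]; case: eqP => [E|]; last by rewrite mul0r.
by move: id; rewrite E ltnn.
Qed.

End PrimeSums.

(* With L_0 = 1 the relations n L_n = sum_i S_i L_(n-i) determine S. *)
Lemma newton_unique (C : pzRingType) (L S S' : nat -> C) B : L 0%N = 1 ->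
  (forall d, (d <= B)%N -> \sum_(1 <= i < d.+1) S i * L (d - i)%N
    = \sum_(1 <= i < d.+1) S' i * L (d - i)%N) ->
  forall d, (0 < d <= B)%N -> S d = S' d.
Proof.
move=> L0 H d; have [n] := ubnP d; elim: n d => // n IH d dn /andP [d0 dB].
have := H d dB; rewrite !big_nat_recr //= subnn L0 !mulr1.
rewrite big_nat_cond [X in _ = X + _ -> _]big_nat_cond (eq_bigr (fun i => S' i * L (d - i)%N)); first exact: addrI.
move=> i /andP [/andP [i0 id] _]; rewrite IH ?i0 /=; [by []|exact: leq_trans id _ |exact: ltnW (leq_trans id dB)].
Qed.

(** There are [q^d] monic polynomials of degree [d], and [d q^d] is the sum of [q^i q^(d-i)] over
    [1 <= i <= d]; so [q^i] solves the Newton identities, whose solution is unique. *)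
Lemma prime_sum1 (F : finFieldType) (C : comNzRingType) B n : (0 < n <= B)%N ->
  @prime_sum F C (fun=> 1) B n = (#|F| ^ n)%:R.
Proof.
have L d : @monic_sum F C (fun=> 1) d = (#|F| ^ d)%:R.
  by rewrite /monic_sum sumr_const card_npoly.
apply: (newton_unique (L := fun d => (#|F| ^ d)%:R) (S' := fun d => (#|F| ^ d)%:R)).
  by rewrite expn0.
move=> d dB; have := @monic_sum_newton F C (fun=> 1) erefl (fun _ _ _ _ => esym (mulr1 1)) B d dB.
rewrite L; under eq_bigr => i _ do rewrite L.
move=> <-; rewrite (eq_big_nat _ _ (F2 := fun=> (#|F| ^ d)%:R)).
  by rewrite sumr_const_nat subSS subn0.
by move=> i /andP [_ id]; rewrite -natrM -expnD subnKC.
Qed.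

(** Induction on [s]: a new factor [1 - b z] adds the powers [b^i] to the power sums, and their
    contribution telescopes. *)
Lemma newton_prod (C : comNzRingType) (s : seq C) d :
  (\prod_(a <- s) (1 - a *: 'X))`_d *+ d
    = - \sum_(1 <= i < d.+1) (\sum_(a <- s) a ^+ i) * (\prod_(a <- s) (1 - a *: 'X))`_(d - i).
Proof.
elim: s d => [|b s IH] d.
  rewrite big_nil coef1; under eq_bigr => i _ do rewrite big_nil mul0r.
  by rewrite big1 // oppr0; case: d => [|d]; rewrite ?mulr0n ?mul0rn.
rewrite big_cons; set A := \prod_(a <- s) _ in IH *.
(* The coefficient at [n - i], set to 0 where truncated subtraction would return the constant
   coefficient. *)
pose A' n i := if (i <= n)%N then A`_(n - i) else 0.
have cA n : ((1 - b *: 'X) * A)`_n = A`_n - b * A' n 1%N.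
  rewrite mulrBl mul1r coefB -scalerAl coefZ coefXM /A' subn1.
  by case: n => [|n].
have cA' i : (i <= d)%N -> ((1 - b *: 'X) * A)`_(d - i) = A' d i - b * A' d i.+1.
  move=> id; rewrite cA /A' id; congr (_ - b * _).
  by rewrite subn_gt0 -subnDA addn1.
have tel : \sum_(1 <= i < d.+1) b ^+ i * ((1 - b *: 'X) * A)`_(d - i) = b * A' d 1%N.
  rewrite (eq_big_nat _ _ (F2 := fun i => - (b ^+ i.+1 * A' d i.+1 - b ^+ i * A' d i))).
    rewrite big_nat_cond -big_nat_cond sumrN telescope_sumr //.
    by rewrite {1}/A' ltnn mulr0 sub0r opprK expr1.
  by move=> i /andP [_ id]; rewrite cA' // mulrBr opprB mulrA -exprSr.
under eq_bigr => i _ do rewrite big_cons mulrDl.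
rewrite big_split /= tel opprD cA mulrnBl IH.
have -> : \sum_(1 <= i < d.+1) (\sum_(a <- s) a ^+ i) * ((1 - b *: 'X) * A)`_(d - i) =
   \sum_(1 <= i < d.+1) (\sum_(a <- s) a ^+ i) * A`_(d - i)
    - b * \sum_(1 <= i < d.+1) (\sum_(a <- s) a ^+ i) * A' d i.+1.
  rewrite mulr_sumr -sumrB; apply: eq_big_nat => i /andP [_ id].
  by rewrite cA' // {1}/A' -ltnS id mulrBr mulrCA.
have -> : \sum_(1 <= i < d.+1) (\sum_(a <- s) a ^+ i) * A' d i.+1 = - (A' d 1%N *+ d.-1).
  case: (d) => [|n]; first by rewrite big_geq // mulr0n oppr0.
  rewrite big_nat_recr //= {2}/A' ltnn mulr0 addr0 /A' subSS subn0 /= IH opprK.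
  by apply: eq_big_nat => i /andP [_ id]; rewrite id subSS.
have T0 : b * A' d 1%N *+ d = b * A' d 1%N *+ d.-1 + b * A' d 1%N.
  by case: (d) => [|n]; rewrite ?mulr0n /A' /= ?mulr0 ?add0r // mulrSr.
rewrite T0 mulrN mulrnAr opprK opprD. ring.
Qed.

(** The constant coefficient 1 makes all roots nonzero and determines the leading coefficient, so
    [p] factors through its inverse roots. *)
Lemma coef0_1_split (p : {poly algC}) : p`_0 = 1 ->
  exists2 s : seq algC, (size s < size p)%N & p = \prod_(a <- s) (1 - a *: 'X).
Proof.
move=> p0; have np : p != 0 by apply: contra_eq_neq p0 => ->; rewrite coef0 eq_sym oner_neq0.
have [r pr] := closed_field_poly_normal p; have nl : lead_coef p != 0 by rewrite lead_coef_eq0.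
exists [seq z^-1 | z <- r].
  rewrite size_map; have := congr1 (fun p : {poly _} => size p) pr.
  by rewrite size_scale // size_prod_XsubC => ->.
have nz z : z \in r -> z != 0.
  move=> zr; apply: contra_eq_neq p0 => z0; rewrite pr coefZ -horner_coef0 horner_prod.
  by rewrite (big_rem z) //= z0 hornerXsubC subrr mul0r mulr0 eq_sym oner_neq0.
have E0 : 1 = lead_coef p * \prod_(z <- r) (- z).
  rewrite -{1}p0 {1}pr coefZ -horner_coef0 horner_prod; congr (_ * _).
  by apply: eq_bigr => z _; rewrite hornerXsubC sub0r.
rewrite big_map {1}pr -[in RHS](@scale1r _ _ (\prod_(z <- r) _)) [in RHS]E0 -scalerA; congr (_ *: _).
rewrite -scaler_prod big_seq [RHS]big_seq; apply: eq_bigr => z zr.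
by rewrite scalerBr scalerA mulNr mulfV ?nz // scaleN1r opprK addrC scaleNr alg_polyC.
Qed.

(** If [x > 1], Bernoulli's inequality makes the powers of [x] exceed any [K]. *)
Lemma expr_bounded_le1 (x K : algC) m1 : 0 <= x ->
  (forall m, (m1 <= m)%N -> x ^+ m <= K) -> x <= 1.
Proof.
move=> x0 H; have xr : x \is Num.real by rewrite ger0_real.
rewrite real_leNgt ?rpred1 //; apply/negP => x1.
have bern n : 1 + (x - 1) *+ n <= x ^+ n.
  elim: n => [|n IH]; first by rewrite mulr0n addr0 expr0.
  rewrite exprS; apply: (le_trans _ (ler_wpM2l x0 IH)).
  rewrite -subr_ge0 mulrS.
  have -> : x * (1 + (x - 1) *+ n) - (1 + (x - 1 + (x - 1) *+ n)) = (x - 1) ^+ 2 *+ n.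
    by ring.
  by rewrite mulrn_wge0 // exprn_ge0 // subr_ge0 ltW.
have K0 : 0 <= K by apply: le_trans (H m1 (leqnn _)); rewrite exprn_ge0.
have x10 : 0 < x - 1 by rewrite subr_gt0.
pose n := (m1 + Num.bound (K / (x - 1)))%N.
have b : K / (x - 1) < n%:R.
  apply: lt_le_trans (archi_boundP (divr_ge0 K0 (ltW x10))) _.
  by rewrite ler_nat leq_addl.
rewrite ltr_pdivrMr // in b.
have := lt_le_trans b (le_trans _ (le_trans (bern n) (H n (leq_addr _ _)))).
by rewrite mulr_natl lerDr ler01 ltxx => /(_ isT).
Qed.

(* Pairing with the polynomial g vanishing at every other element of s isolates
   the powers of a, which then grow at most like Q^m. *)
Lemma power_sum_growth (s : seq algC) (Q : nat) (K : algC) m1 : (0 < Q)%N ->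
  (forall m, (m1 <= m)%N -> `|\sum_(a <- s) a ^+ m| <= K * Q%:R ^+ m) ->
  forall a, a \in s -> `|a| <= Q%:R.
Proof.
move=> Q0 H a sa; have Qgt0 : 0 < Q%:R :> algC by rewrite ltr0n.
pose g : {poly algC} := \prod_(b <- rem a (undup s)) ('X - b%:P).
have ga : g.[a] != 0.
  rewrite -[_ == 0]/(root g a) root_prod_XsubC mem_rem_uniq ?undup_uniq //.
  by rewrite inE eqxx.
have gb b : b \in s -> b != a -> g.[b] = 0.
  move=> sb nb; apply/eqP; rewrite -[_ == 0]/(root g b) root_prod_XsubC.
  by rewrite mem_rem_uniq ?undup_uniq // inE nb mem_undup.
have E m : \sum_(k < size g) g`_k * (\sum_(b <- s) b ^+ (m + k)) = (a ^+ m * g.[a]) *+ count_mem a s.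
  under eq_bigr => k _ do rewrite mulr_sumr.
  rewrite exchange_big /= -[RHS]addr0 -iter_addr -big_const_seq [RHS]big_mkcond /=.
  apply: eq_big_seq => b sb; transitivity (b ^+ m * g.[b]).
    rewrite horner_coef mulr_sumr; apply: eq_bigr => k _.
    by rewrite exprD mulrCA.
  by case: eqP => [->//|/eqP nb]; rewrite gb // mulr0.
pose K' := (\sum_(k < size g) `|g`_k| * (K * Q%:R ^+ k)) / `|g.[a]|.
have ng : 0 < `|g.[a]| by rewrite normr_gt0.
suff: `|a| / Q%:R <= 1 by rewrite ler_pdivrMr // mul1r.
apply: (@expr_bounded_le1 _ K' m1) => [|m mm]; first by rewrite divr_ge0 // ltW.
rewrite expr_div_n ler_pdivrMr ?exprn_gt0 // /K' mulrAC ler_pdivlMr //.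
apply: (@le_trans _ _ `|(a ^+ m * g.[a]) *+ count_mem a s|).
  rewrite normrMn normrM normrX -[X in X <= _]mulr1n ler_wpMn2l ?mulr_ge0 ?exprn_ge0 //.
  by rewrite -has_count has_pred1.
rewrite -E; apply: le_trans (ler_norm_sum _ _ _) _; rewrite mulr_suml; apply: ler_sum => k _.
rewrite normrM -mulrA ler_wpM2l // -mulrA -exprD addnC; apply: H.
exact: leq_trans mm (leq_addl _ _).
Qed.

(** * Frobenius at a prime polynomial and Stepanov's bound *)

(* t^d h(1/t), for h of degree at most d. *)
Definition revp (K : nzSemiRingType) d (h : {poly K}) : {poly K} :=
  \poly_(i < d.+1) h`_(d - i).

Lemma coef_revp (K : nzSemiRingType) d (h : {poly K}) i :
  (revp d h)`_i = if (i <= d)%N then h`_(d - i) else 0.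
Proof. by rewrite coef_poly ltnS. Qed.

Lemma revpK (K : nzSemiRingType) d (h : {poly K}) : (size h <= d.+1)%N -> revp d (revp d h) = h.
Proof.
move=> sh; apply/polyP => i; rewrite !coef_revp; case: leqP => [id|di].
  by rewrite leq_subr subKn.
by rewrite nth_default // (leq_trans sh).
Qed.

Lemma size_revp (K : nzSemiRingType) d (h : {poly K}) : (size (revp d h) <= d.+1)%N.
Proof. exact: size_poly. Qed.

Lemma revp_coef0 (K : nzSemiRingType) d (h : {poly K}) :
  h \is monic -> size h = d.+1 -> (revp d h)`_0 = 1.
Proof. by move=> /monicP mh sh; rewrite coef_revp subn0 -mh lead_coefE sh. Qed.

Lemma revpM (K : comNzRingType) d e (g h : {poly K}) :
  (size g <= d.+1)%N -> (size h <= e.+1)%N ->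
  revp (d + e) (g * h) = revp d g * revp e h.
Proof.
move=> sg sh.
have revpE (f : nat -> K) (p : nat -> {poly K}) m n :
    revp m (\sum_(i < n) f i *: p i) = \sum_(i < n) f i *: revp m (p i).
  apply/polyP => j; rewrite coef_revp !coef_sum; case: ifP => jm.
    by apply: eq_bigr => i _; rewrite !coefZ coef_revp jm.
  by rewrite big1 // => i _; rewrite coefZ coef_revp jm mulr0.
have gE : g = \sum_(i < d.+1) g`_i *: 'X^i.
  rewrite -poly_def; apply/polyP => i; rewrite coef_poly; case: ltnP => // di.
  by rewrite nth_default // (leq_trans sg).
have sE : g * h = \sum_(i < d.+1) g`_i *: ('X^i * h).
  by rewrite {1}gE mulr_suml; apply: eq_bigr => i _; rewrite scalerAl.
have rE : revp d g = \sum_(i < d.+1) g`_i *: 'X^(d - i).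
  rewrite /revp poly_def (reindex_inj rev_ord_inj) /=; apply: eq_bigr => i _.
  by rewrite subSS subKn // -ltnS.
rewrite sE (revpE _ (fun i => 'X^i * h)) rE mulr_suml; apply: eq_bigr => i _.
rewrite -scalerAl; congr (_ *: _); apply/polyP => n.
have id : (i <= d)%N by rewrite -ltnS.
rewrite coef_revp !coefXnM coef_revp.
case: (leqP n (d + e)) => nde; case: (ltnP n (d - i)) => ndi.
- by case: ltnP => // _; rewrite nth_default // (leq_trans sh) //; lia.
- case: ltnP => ?; case: leqP => ? //; [exfalso; lia|congr (h`_ _); lia|exfalso; lia].
- by [].
- by case: leqP => // ?; exfalso; lia.
Qed.

Lemma map_revp (K K' : nzRingType) (f : {rmorphism K -> K'}) d (h : {poly K}) :
  map_poly f (revp d h) = revp d (map_poly f h).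
Proof.
apply/polyP => i; rewrite coef_map !coef_revp coef_map /=.
by case: ifP; rewrite ?rmorph0.
Qed.

Lemma frobD (F : finFieldType) (B : comNzRingType) (io : {rmorphism F -> B}) n (x y : B) :
  (x + y) ^+ (#|F| ^ n) = x ^+ (#|F| ^ n) + y ^+ (#|F| ^ n).
Proof.
have [p pr_p pF] := finPcharP F; have pB := rmorph_pchar io pF.
have nF : p.-nat #|F|.
  by rewrite -cardsT; have /abelem_pgroup := fin_ring_pchar_abelem pF.
by rewrite exprDn_pchar // (eq_pnat _ (pcharf_eq pB)) pnatX nF.
Qed.

Lemma frob_const (F : finFieldType) (B : comNzRingType) (io : {rmorphism F -> B}) n c :
  io c ^+ (#|F| ^ n) = io c.
Proof.
rewrite -rmorphXn; congr (io _); elim: n => [|n IH]; first by rewrite expr1.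
by rewrite expnS exprM expf_card.
Qed.

(** * Frobenius conjugates modulo a prime polynomial *)

Section PrimeFrobenius.
Variables (F : finFieldType) (p : {poly F}) (pp : prime_poly p).
Let hI := prime_polyW pp.
Local Notation K := {poly %/ p with hI}.
Let q := #|F|.
Let d := (size p).-1.
Let x : K := in_qpoly p 'X.
Let emb : {rmorphism F -> K} := qpolyC p.

Let q_gt1 : (1 < q)%N := card_finNzRing_gt1 F.

Let d_gt0 : (0 < d)%N.
Proof. by rewrite /d; have := prime_poly_size pp; case: (size p) => [|[]]. Qed.

Let size_p : size p = d.+1.
Proof. by rewrite prednK // ltnW // prime_poly_size. Qed.

Let in_qpolyE (g : {poly F}) : in_qpoly p g = (map_poly emb g).[x].
Proof. by have := in_qpoly_comp_horner p g 'X; rewrite comp_polyXr. Qed.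

Lemma in_qpoly_eq0 (g : {poly F}) : (in_qpoly p g == 0) = (p %| g).
Proof.
have mp : p \is monic by case: hI.
apply/eqP/modp_eq0P => [/(congr1 val) /=|E].
  by rewrite (mk_monicE hI) -Pdiv.IdomainMonic.modpE.
by apply: val_inj; rewrite /= (mk_monicE hI) -Pdiv.IdomainMonic.modpE.
Qed.

Let emb_root (g : {poly F}) n y :
  (map_poly emb g).[y] ^+ (q ^ n) = (map_poly emb g).[y ^+ (q ^ n)].
Proof.
rewrite !horner_coef size_map_poly.
pose f (z : K) := z ^+ (q ^ n).
have f0 : f 0 = 0 by rewrite /f expr0n expn_eq0 -[q]prednK ?(ltnW q_gt1).
rewrite -[LHS]/(f _) (big_morph f (frobD emb n) f0); apply: eq_bigr => i _.
by rewrite /f exprMn coef_map frob_const exprAC.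
Qed.

Let x_frob_d : x ^+ (q ^ d) = x.
Proof.
have := expf_card (x : K); rewrite -[X in x ^+ X = _ -> _](_ : (q ^ d)%N = _) //.
by rewrite card_qfpoly.
Qed.

(** As [x] generates the field, raising to the power [q^e] would otherwise fix all its [q^d]
    elements, which would be roots of a nonzero polynomial of degree [q^e]. *)
Let x_frob_neq e : (0 < e < d)%N -> x ^+ (q ^ e) != x.
Proof.
case/andP => e0 ed; apply/eqP => xe.
have all_fix (y : K) : y ^+ (q ^ e) = y.
  have -> : y = in_qpoly p (val y).
    by apply: val_inj; apply/esym/(in_qpoly_small (size_mk_monic y)).
  by rewrite in_qpolyE emb_root xe.
pose P : {poly K} := 'X^(q ^ e) - 'X.
have qe1 : (1 < q ^ e)%N by rewrite -(expn0 q) ltn_exp2l.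
have sP : size P = (q ^ e).+1 by rewrite size_polyDl ?size_polyXn // size_polyN size_polyX ltnS.
have nP : P != 0 by rewrite -size_poly_eq0 sP.
have := max_poly_roots nP (rs := enum K) _ (enum_uniq _).
rewrite sP -cardE card_qfpoly -/d -/q ltnS leq_exp2l // leqNgt ed => H.
suff: false by []. apply: H; apply/allP => y _.
by rewrite rootE !hornerE all_fix subrr.
Qed.

(** The [d] conjugates of [x] are roots of [p], distinct by [x_frob_neq]. *)
Let p_split : map_poly emb p = \prod_(i < d) ('X - (x ^+ (q ^ i))%:P).
Proof.
pose rs := [seq x ^+ (q ^ i) | i <- index_iota 0 d].
have prE : \prod_(i < d) ('X - (x ^+ (q ^ i))%:P) = \prod_(z <- rs) ('X - z%:P).
  by rewrite big_map big_mkord.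
have inj_frob n (y z : K) : y ^+ (q ^ n) = z ^+ (q ^ n) -> y = z.
  move=> E; apply/eqP; rewrite -subr_eq0; have := frobD emb n (y - z) z.
  rewrite subrK E => /eqP; rewrite eq_sym -subr_eq0 addrK expf_eq0 => /andP [_].
  by [].
rewrite prE; apply/eqP; rewrite -eqp_monic; last 2 first.
- by apply: monic_map; case: hI.
- exact: monic_prod_XsubC.
rewrite eqp_sym -dvdp_size_eqp.
  by rewrite size_prod_XsubC size_map size_iota subn0 size_map_poly size_p.
apply: uniq_roots_dvdp.
  apply/allP => _ /mapP [i _ ->]; rewrite rootE -emb_root -in_qpolyE.
  by rewrite (eqP (_ : in_qpoly p p == 0)) ?in_qpoly_eq0 ?dvdpp // expr0n expn_eq0 -[q]prednK ?(ltnW q_gt1).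
rewrite uniq_rootsE map_inj_in_uniq ?iota_uniq // => i j.
wlog ij : i j / (i <= j)%N.
  by move=> H i1 j1 E; case: (leqP i j) => [/H|/ltnW /H E']; [apply | apply/esym/E'].
rewrite !mem_index_iota => id jd; have -> : x ^+ (q ^ j) = (x ^+ (q ^ (j - i))) ^+ (q ^ i) by rewrite -exprM -expnD subnK.
move=> /inj_frob E.
apply/eqP; rewrite eqn_leq ij leqNgt; apply/negP => lt.
have : x ^+ (q ^ (j - i)) != x by apply: x_frob_neq; lia.
by rewrite -E eqxx.
Qed.

Let frob_prodK n : {poly K} := \prod_(i < n) (1 - x ^+ (q ^ i) *: 'X).

Let frob_prodK_d : frob_prodK d = map_poly emb (revp d p).
Proof.
rewrite map_revp p_split /frob_prodK; elim: d => [|n IH].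
  rewrite !big_ord0; apply/polyP => i; rewrite coef_revp !coef1.
  by case: i.
rewrite !big_ord_recr /= -addn1 revpM -?IH ?size_XsubC //; last first.
  by rewrite size_prod_XsubC /index_enum -enumT size_enum_ord.
congr (_ * _); apply/polyP => i; rewrite coef_revp coefB coef1 coefZ coefX.
by case: i => [|[|i]]; rewrite /= ?coefB ?coefX ?coefC /= ?mulr0 ?mulr1 ?subr0 ?sub0r.
Qed.

Let x_frob_de e i : x ^+ (q ^ (d * e + i)) = x ^+ (q ^ i).
Proof.
elim: e => [|e IH]; first by rewrite muln0.
by rewrite mulnS -addnA expnD exprM x_frob_d.
Qed.

Let frob_prodK_de e : frob_prodK (d * e) = map_poly emb (revp d p) ^+ e.
Proof.
rewrite -frob_prodK_d; elim: e => [|e IH]; first by rewrite muln0 /frob_prodK big_ord0.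
rewrite exprSr -IH mulnSr /frob_prodK big_split_ord /=; congr (_ * _).
by apply: eq_bigr => i _; rewrite x_frob_de.
Qed.

(** The coefficient variable is [x], the outer one [t]. Iterating [Frob(Y) = Y (1 - x t)], one sees
    that the [n]-th iterate of Frobenius multiplies [Y] by this product. *)
Definition frob_prod n : {poly {poly F}} := \prod_(i < n) (1 - 'X^(#|F| ^ i) *: 'X).

(** Modulo [p] the factors run [e] times through the conjugates of [x], and each run multiplies to
    [t^d p(1/t)]. *)
Lemma frob_prod_mod e j : p %| (frob_prod (d * e))`_j - ((revp d p ^+ e)`_j)%:P.
Proof.
rewrite -in_qpoly_eq0 rmorphB subr_eq0.
pose rho : {rmorphism {poly F} -> K} := in_qpoly p.
have : map_poly rho (frob_prod (d * e)) = frob_prodK (d * e).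
  rewrite rmorph_prod; apply: eq_bigr => i _.
  rewrite rmorphB rmorph1 -mul_polyC rmorphM /= map_polyC map_polyX mul_polyC.
  by congr (_ - _ *: _); apply: (rmorphXn rho).
rewrite frob_prodK_de -rmorphXn => /(congr1 (fun f : {poly K} => f`_j)).
rewrite !coef_map /= => ->; apply/eqP.
apply: val_inj; rewrite [RHS]in_qpoly_small // (mk_monicE hI).
by rewrite (leq_ltn_trans (size_polyC_leq1 _)) // prime_poly_size.
Qed.

Lemma frob_X_mod e : p %| 'X^(#|F| ^ (d * e)) - 'X.
Proof.
rewrite -in_qpoly_eq0 rmorphB rmorphXn subr_eq0.
by have := x_frob_de e 0; rewrite addn0 expn0 expr1 => /eqP.
Qed.

End PrimeFrobenius.

Definition congr_mod (B : comNzRingType) (I a b : B) : Prop := exists c, a - b = I * c.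

Section Congruence.
Variables (B : comNzRingType) (I : B).
Local Notation "a === b" := (congr_mod I a b) (at level 70).

Lemma congr_mod_refl a : a === a.
Proof. by exists 0; rewrite subrr mulr0. Qed.

Lemma congr_mod_sym a b : a === b -> b === a.
Proof. by case=> c E; exists (- c); rewrite mulrN -E opprB. Qed.

Lemma congr_mod_trans a b c : a === b -> b === c -> a === c.
Proof. by case=> u Eu [v Ev]; exists (u + v); rewrite mulrDr -Eu -Ev addrA subrK. Qed.

Lemma congr_modD a b c d : a === b -> c === d -> a + c === b + d.
Proof. by case=> u Eu [v Ev]; exists (u + v); rewrite mulrDr -Eu -Ev; ring. Qed.

Lemma congr_modM a b c d : a === b -> c === d -> a * c === b * d.
Proof.
case=> u Eu [v Ev]; exists (u * c + b * v).
by rewrite mulrDr mulrA -Eu [I * _]mulrCA -Ev; ring.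
Qed.

Lemma congr_modX a b n : a === b -> a ^+ n === b ^+ n.
Proof.
move=> ab; elim: n => [|n IH]; first exact: congr_mod_refl.
by rewrite !exprS; apply: congr_modM.
Qed.

Lemma congr_mod_sum (J : Type) (r : seq J) (P : pred J) (f g : J -> B) :
  (forall i, P i -> f i === g i) -> \sum_(i <- r | P i) f i === \sum_(i <- r | P i) g i.
Proof.
move=> H; apply: (big_ind2 (fun a b => a === b)) => //; first exact: congr_mod_refl.
by move=> *; apply: congr_modD.
Qed.

End Congruence.

(** The Chinese remainder theorem gives a multiple of [b] below [a b], hence at most [s], that is
    congruent to [s] modulo [a]. *)
Lemma coprime_semigroup a b s : coprime a b -> (0 < a)%N -> (0 < b)%N -> (a * b <= s)%N ->
  exists ij : nat * nat, s = (a * ij.1 + b * ij.2)%N.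
Proof.
move=> co a0 b0 abs; pose x := (chinese a b s 0 %% (a * b))%N.
have xab : (x < a * b)%N by rewrite ltn_mod muln_gt0 a0.
have xa : x = s %[mod a] by rewrite modn_dvdm ?dvdn_mulr // chinese_modl.
have xb : (b %| x)%N by rewrite /dvdn modn_dvdm ?dvdn_mull // chinese_modr // mod0n.
have xs : (x <= s)%N by apply: ltnW (leq_trans xab abs).
exists ((s - x) %/ a, x %/ b)%N => /=; rewrite ![(_ * (_ %/ _))%N]mulnC !divnK ?subnK //.
by rewrite -eqn_mod_dvd //; apply/eqP.
Qed.

(** Among elements of pairwise distinct degrees, the largest one with a nonzero coefficient cannot
    be cancelled. *)
Lemma dr_free_neq0 (F : finFieldType) (A : comNzRingType) (kappa : {rmorphism F -> A})
    (sz : A -> nat) (I : finType) (c : I -> F) (e : I -> A) :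
  degree_ring kappa sz -> (forall i, e i != 0) -> injective (fun i => sz (e i)) ->
  (exists i, c i != 0) -> \sum_i kappa (c i) * e i != 0.
Proof.
move=> dA ne inj [i0 ci0].
have [i ci maxi] := arg_maxnP (P := fun i => c i != 0) (fun i => sz (e i)) ci0.
have lt : (sz (\sum_(j | j != i) kappa (c j) * e j)%R < sz (kappa (c i) * e i)%R)%N.
  rewrite dr_sz_scale //; apply: (dr_sz_sum_lt dA) => [|j ji]; first by rewrite (dr_sz_gt0 dA).
  have [->|cj] := eqVneq (c j) 0; first by rewrite rmorph0 mul0r (dr_sz0 dA) (dr_sz_gt0 dA).
  rewrite (dr_sz_scale dA) // ltn_neqAle; apply/andP; split; last exact: maxi.
  by apply: contra ji => /eqP /inj ->.
by rewrite (bigD1 i) //= -(dr_sz_gt0 dA) (dr_szDl dA) // dr_sz_scale // (dr_sz_gt0 dA).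
Qed.

Lemma pigeonhole_seq (T : finType) (A : eqType) (f : T -> A) (s : seq A) :
  (forall t, f t \in s) -> (size s < #|T|)%N -> exists t u, t != u /\ f t = f u.
Proof.
move=> fs lt; have [/injectiveP inj|/injectivePn [t [u tu E]]] := boolP (injectiveb f).
  have := uniq_leq_size (s1 := [seq f t | t <- enum T]) (s2 := s).
  rewrite map_inj_uniq ?enum_uniq // size_map -cardE => /(_ isT) H.
  by move: lt; rewrite ltnNge H // => _ /mapP [t _ ->].
by exists t, u.
Qed.

(** * The action of Frobenius on the tower *)

Section TowerArithmetic.
Variables (F : finFieldType) (l : nat) (A : comNzRingType).
Variables (io : {rmorphism {poly F} -> A}) (sz : A -> nat) (y : nat -> A).
Hypothesis tw : tower_prop l io sz y.
Let q := #|F|.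
Let x := io 'X.
Let kappa : {rmorphism F -> A} := io \o polyC.

Let dA : degree_ring kappa sz. Proof. by case: tw. Qed.
Let y0 : y 0 = 1. Proof. by case: tw => _ _ []. Qed.
Let yS j : (j < l)%N -> y j.+1 ^+ q = y j.+1 - x * y j.
Proof. by case: tw => _ _ [_ H] _ _; apply: H. Qed.

Lemma tower_frob n j : (j <= l)%N ->
  y j ^+ (q ^ n) = \sum_(i < j.+1) io (frob_prod F n)`_i * y (j - i)%N.
Proof.
elim: n j => [|n IH] j jl.
  rewrite expn0 expr1 /frob_prod big_ord0 big_ord_recl subn0 coef1 rmorph1 mul1r.
  by rewrite big1 ?addr0 // => i _; rewrite coef1 rmorph0 mul0r.
have W i : (frob_prod F n.+1)`_i = (frob_prod F n)`_i
    - (if i is i'.+1 then 'X^(q ^ n) * (frob_prod F n)`_i' else 0).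
  rewrite /frob_prod big_ord_recr /= mulrBr mulr1 coefB -scalerAr coefZ coefMX.
  by case: i => [|i] //=; rewrite mulr0.
case: j jl => [|j] jl.
  have := IH 0%N jl; rewrite y0 !expr1n !big_ord_recl !big_ord0 !addr0 /= ?subn0 ?y0.
  by rewrite W subr0.
have nX (a b : A) : (a - b) ^+ (q ^ n) = a ^+ (q ^ n) - b ^+ (q ^ n).
  by apply/eqP; rewrite eq_sym subr_eq -(frobD kappa) subrK.
rewrite expnS exprM yS // nX exprMn IH // (IH j (ltnW jl)) [RHS]big_ord_recl W subr0.
rewrite [X in X - _ = _]big_ord_recl -addrA; congr (_ + _).
rewrite mulr_sumr -sumrB; apply: eq_bigr => i _; rewrite !lift0 W subSS.
by rewrite rmorphB mulrBl rmorphM rmorphXn mulrA.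
Qed.

Section Congruences.
Variables (p : {poly F}) (pp : prime_poly p).
Let d := (size p).-1.
Local Notation "a === b" := (congr_mod (io p) a b) (at level 70).

Lemma congr_mod_dvd (g h : {poly F}) : p %| g - h -> io g === io h.
Proof. by case/dvdpP => c E; exists (io c); rewrite -rmorphB E mulrC rmorphM. Qed.

(** Modulo [p] this power of Frobenius multiplies [Y] by [(t^d p(1/t))^e]. It thus depends only on
    the class of [p^e] in the 1-units, which is how the cover sees the classes of primes. *)
Lemma tower_frob_prime e j : (j <= l)%N ->
  y j ^+ (q ^ (d * e)) === \sum_(i < j.+1) kappa (revp d p ^+ e)`_i * y (j - i)%N.
Proof.
move=> jl; rewrite tower_frob //; apply: congr_mod_sum => i _.
apply: congr_modM; last exact: congr_mod_refl.
by apply: congr_mod_dvd; apply: frob_prod_mod.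
Qed.

Lemma tower_frobX e : x ^+ (q ^ (d * e)) === x.
Proof. by rewrite /x -rmorphXn; apply: congr_mod_dvd; apply: frob_X_mod. Qed.

(* Some power of Frobenius is the identity modulo p, so A / pA is reduced. *)
Lemma tower_reduced n e a : (0 < d * e)%N ->
  (forall j, (j <= l)%N -> (revp d p ^+ e)`_j = (j == 0%N)%:R) ->
  a ^+ n === 0 -> a === 0.
Proof.
move=> de0 He an.
have fix_all b : b ^+ (q ^ (d * e)) === b.
  have [_ _ _ _ gen] := tw; move: b; apply: gen => [b c Pb Pc|b c Pb Pc|h|j jl].
  - by rewrite (frobD kappa); apply: congr_modD.
  - by rewrite exprMn; apply: congr_modM.
  - rewrite -[h]coefK poly_def rmorph_sum.
    apply: (big_ind (fun b => b ^+ (q ^ (d * e)) === b)).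
    + by rewrite expr0n expn_eq0 -[q]prednK ?(ltnW (card_finNzRing_gt1 F)) //; apply: congr_mod_refl.
    + by move=> b c Pb Pc; rewrite (frobD kappa); apply: congr_modD.
    + move=> i _; rewrite -mul_polyC rmorphM rmorphXn exprMn -/x; apply: congr_modM.
        by rewrite -[io _%:P]/(kappa _) frob_const; apply: congr_mod_refl.
      by rewrite exprAC; apply/congr_modX/tower_frobX.
  - apply: congr_mod_trans (tower_frob_prime e jl) _.
    rewrite big_ord_recl He // rmorph1 mul1r subn0 big1 ?addr0; first exact: congr_mod_refl.
    by move=> i _; rewrite He ?rmorph0 ?mul0r // lift0 (leq_trans _ jl).
have iter k b : b ^+ (q ^ (d * e * k)) === b.
  elim: k b => [|k IH] b; first by rewrite muln0 expr1; apply: congr_mod_refl.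
  rewrite mulnS expnD exprM.
  by apply: congr_mod_trans (IH _) (fix_all _).
apply: congr_mod_trans (congr_mod_sym (iter n a)) _.
have nle : (n <= q ^ (d * e * n))%N.
  apply: leq_trans (ltnW (ltn_expl n (card_finNzRing_gt1 F))) _.
  by rewrite leq_pexp2l ?leq_pmull // ltnW // card_finNzRing_gt1.
rewrite -(subnK nle) exprD -[0](mulr0 (a ^+ (q ^ (d * e * n) - n))).
by apply: congr_modM an; apply: congr_mod_refl.
Qed.

End Congruences.

(** Unique factorization in [A] is avoided: a Bezout relation in [F[x]] between [p] and the product
    of the other primes joins the two divisibilities. *)
Lemma tower_dvd_prod (S : seq {poly F}) u : uniq S -> all (@prime_poly F) S ->
  (forall p, p \in S -> congr_mod (io p) u 0) -> congr_mod (io (\prod_(p <- S) p)) u 0.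
Proof.
elim: S => [|p S IH] /=.
  by move=> _ _ _; exists u; rewrite big_nil rmorph1 subr0 mul1r.
case/andP => pS uS /andP [pp prS] H; rewrite big_cons.
have [c] := IH uS prS (fun g gS => H g (@mem_behead _ (p :: S) g gS)); rewrite subr0 => Ec.
have [e] := H p (mem_head _ _); rewrite subr0 => Ee.
have : coprimep p (\prod_(g <- S) g).
  rewrite irreducible_poly_coprime; last by case: (prime_polyW pp).
  rewrite big_seq; elim/big_rec: _ => [|g h gS nh].
    by rewrite dvdp1 gtn_eqF // prime_poly_size.
  have ng : ~~ (p %| g).
    by apply: prime_poly_neq => //; [exact: (allP prS) | apply: contraNneq pS => ->].
  by have := prime_poly_gauss h pp ng 1; rewrite !expr1 => ->.
case/Bezout_eq1_coprimepP => -[a b] /= E.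
exists (io a * c + io b * e); rewrite subr0.
have -> : u = io a * (io p * u) + io b * (io (\prod_(g <- S) g) * u).
  by rewrite !mulrA -!rmorphM -mulrDl -rmorphD E rmorph1 mul1r.
by rewrite {1}Ec {1}Ee !rmorphM; ring.
Qed.

End TowerArithmetic.

(* Stepanov's method in Bombieri's form: u = sum c b_s b_s'^P has small degree
   but is divisible by every prime counted, because u^P is congruent to
   v = sum c b_s^P b'_s', which vanishes for a suitable choice of c. *)
Lemma stepanov_bound (F : finFieldType) (l m N : nat) (w : {poly F}) (S : seq {poly F})
    (q := #|F|) (P := (q ^ m)%N) (g := (q ^ l * \sum_(i < l) q ^ i)%N) :
  (0 < l)%N -> (0 < N)%N -> (0 < m)%N ->
  (g * g + 3 * g + 1 < P)%N -> uniq S -> all (@prime_poly F) S ->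
  (forall p, p \in S -> exists e, [/\ ((size p).-1 * e = m.*2)%N,
     forall j, (j <= l)%N -> (revp (size p).-1 p ^+ e)`_j = w`_j &
     forall j, (j <= l)%N -> (revp (size p).-1 p ^+ (e * N))`_j = (j == 0%N)%:R]) ->
  (q ^ l * \sum_(p <- S) (size p).-1 <= P * P + (2 * g + 1) * P)%N.
Proof.
move=> l0 N0 m0 Pbig uS prS HS.
have q1 : (1 < q)%N := card_finNzRing_gt1 F.
have PE : P = (q ^ m)%N by [].
have gE : g = (q ^ l * \sum_(i < l) q ^ i)%N by [].
clearbody P g.
have [A [io [sz [y tw]]]] := tower_exists F l.
have [dA szio [y0 yS] [szy szy_le] gen] := tw.
pose kappa : {rmorphism F -> A} := io \o polyC.
have frobDP (a b : A) : (a + b) ^+ P = a ^+ P + b ^+ P by rewrite PE (frobD kappa).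
pose v := (\sum_(i < l) q ^ i)%N.
have v1 : v = (1 + q * \sum_(i < l.-1) q ^ i)%N.
  rewrite /v -(prednK l0) big_ord_recl expn0; congr (_ + _)%N.
  by rewrite big_distrr; apply: eq_bigr => i _; rewrite lift0 expnS.
have v0 : (0 < v)%N by rewrite v1.
have co : coprime (q ^ l) v.
  by rewrite coprimeXl // v1 /coprime addnC mulnC gcdnMDl gcdn1.
pose x := io 'X.
have szx : sz x = (q ^ l).+1 by rewrite szio ?polyX_eq0 // size_polyX muln1.
have nx : x != 0 by rewrite -(dr_sz_gt0 dA) szx.
have nyl : y l != 0 by rewrite -(dr_sz_gt0 dA) szy.
have szyl : sz (y l) = v.+1 by rewrite szy.
(* Modulo every prime of [S] the [P^2]-th power of [y_l] is [y'], because all these primes have the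
   same Frobenius class [w]. *)
pose y' := \sum_(i < l.+1) kappa w`_i * y (l - i)%N.
have szy' : (sz y' <= v.+1)%N.
  apply: (dr_sz_sum_le dA) => i _; apply: leq_trans (dr_sz_scale_le dA _ _) _.
  by have /andP [_] := szy_le (l - i)%N (leq_subr _ _); rewrite szyl.
have szX_le (a : A) s n : (sz a <= s.+1)%N -> (sz (a ^+ n) <= (s * n).+1)%N.
  move=> sa; have [->|na] := eqVneq a 0.
    by case: n => [|n]; rewrite ?expr0 ?(dr_sz1 dA) // expr0n (dr_sz0 dA).
  by rewrite (dr_szX dA) // ltnS leq_mul2r; apply/orP; right; lia.
have szM_le (a b : A) s t : (sz a <= s.+1)%N -> (sz b <= t.+1)%N -> (sz (a * b)%R <= (s + t).+1)%N.
  move=> sa sb; apply: leq_trans (dr_szM_le dA _ _) _; lia.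
(* Every [s >= g] is a combination of the degrees of [x] and [y_l], so a monomial [b s] in these two
   has degree exactly [s]. Below [g] the exponents are arbitrary. *)
have ex s : exists ij : nat * nat, (g <= s)%N ==> (s == q ^ l * ij.1 + v * ij.2)%N.
  case: (leqP g s) => [gs|]; last by exists (0, 0)%N.
  rewrite gE in gs; have [|ij E] := coprime_semigroup co _ v0 gs; first by rewrite expn_gt0 (ltnW q1).
  by exists ij; rewrite -E eqxx.
pose ix s := xchoose (ex s).
pose b s := x ^+ (ix s).1 * y l ^+ (ix s).2.
pose b' s := x ^+ (ix s).1 * y' ^+ (ix s).2.
have ixE s : (g <= s)%N -> s = (q ^ l * (ix s).1 + v * (ix s).2)%N.
  by move=> gs; have /implyP /(_ gs) /eqP := xchooseP (ex s).
have nb s : b s != 0 by rewrite (dr_mulf_eq0 dA) negb_or !(dr_expf_neq0 dA).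
have szb s : (g <= s)%N -> sz (b s) = s.+1.
  move=> gs; rewrite (sz_mul dA) ?(dr_expf_neq0 dA) // !(dr_szX dA) // szx szyl /=.
  by rewrite [in RHS](ixE s gs) addnS.
have szbb s s' : (g <= s)%N -> (g <= s')%N -> sz (b s * b s' ^+ P) = (s + s' * P).+1.
  move=> gs gs'; have E := dr_szX dA P (nb s'); rewrite szb // in E.
  by rewrite (sz_mul dA (nb s) (dr_expf_neq0 dA P (nb s'))) E szb // addnS.
have szb' s : (g <= s)%N -> (sz (b' s) <= s.+1)%N.
  by move=> gs; rewrite [X in (_ <= X.+1)%N](ixE s gs); apply: szM_le; apply: szX_le; rewrite ?szx.
(* The indices run over [g <= s < P] and [g <= s' <= P + 2 g]. The first range keeps the degrees
   [s + s' P] distinct. The number of coefficients, [P^2 + P - g^2 - g], exceeds the bound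
   [P^2 + 2 g + 1] for [sz (vel c)] exactly when [P > g^2 + 3 g + 1]. *)
pose U := (P - g)%N; pose V := (P + g + 1)%N.
have gP : (g < P)%N by apply: leq_trans Pbig; lia.
have ltU (k : 'I_U) : (g + k < P)%N by rewrite -ltn_subRL ltn_ord.
have ltV (k : 'I_V) : (g + k <= P + 2 * g)%N by have : (k < P + g + 1)%N := ltn_ord k; lia.
pose uel (c : {ffun 'I_U * 'I_V -> F}) :=
  \sum_(i : 'I_U * 'I_V) kappa (c i) * (b (g + i.1)%N * b (g + i.2)%N ^+ P).
pose vel (c : {ffun 'I_U * 'I_V -> F}) :=
  \sum_(i : 'I_U * 'I_V) kappa (c i) * (b (g + i.1)%N ^+ P * b' (g + i.2)%N).
have velB c c' : vel (c - c') = vel c - vel c'.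
  by rewrite /vel -sumrB; apply: eq_bigr => i _; rewrite !ffunE rmorphB mulrBl.
have sz_vel c : (sz (vel c) <= P * P + 2 * g + 1)%N.
  apply: (dr_sz_sum_le dA) => i _; apply: leq_trans (dr_sz_scale_le dA _ _) _.
  have i1 := ltU i.1; have i2 := ltV i.2.
  have H1 : (sz (b (g + i.1)%N ^+ P) <= ((g + i.1) * P).+1)%N.
    by apply: szX_le; rewrite szb ?leq_addr.
  apply: leq_trans (szM_le _ _ _ _ H1 (szb' _ (leq_addr _ _))) _.
  have : ((g + i.1) * P <= P.-1 * P)%N by rewrite leq_mul2r; apply/orP; right; lia.
  have : (P.-1 * P + P = P * P)%N by rewrite addnC -mulSn prednK // (leq_ltn_trans _ gP).
  by move: i2; move: ((g + i.1) * P)%N (P.-1 * P)%N (P * P)%N (g + i.2)%N => *; lia.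
have [T [sT HT]] := dr_bounded_enum dA (P * P + 2 * g + 1).
(* There are more choices of [c] than values of [vel c]; two colliding choices differ by a nonzero
   [c] with [vel c = 0]. *)
have [|c1 [c2 [nc Ec]]] := @pigeonhole_seq _ _ vel T (fun c => HT _ (sz_vel c)).
  apply: leq_ltn_trans sT _; rewrite card_ffun card_prod !card_ord ltn_exp2l //.
  rewrite /U /V; nia.
pose c := c1 - c2.
have vc0 : vel c = 0 by rewrite velB Ec subrr.
have nc0 : exists i, c i != 0.
  apply: contrapT => H; case/negP: nc; apply/eqP/ffunP => i; apply/eqP; rewrite -subr_eq0.
  by apply/negP => /negP ni; apply: H; exists i; rewrite !ffunE.
have nu : uel c != 0.
  apply: (dr_free_neq0 (kappa := kappa) dA) => // [i|[i j] [i' j'] /=].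
    by rewrite (dr_mulf_eq0 dA) negb_or nb (dr_expf_neq0 dA).
  rewrite !szbb ?leq_addr // => /succn_inj E.
  have ii : (g + i = g + i')%N.
    by have /= := congr1 (modn^~ P) E; rewrite ![((g + _) + _)%N]addnC !modnMDl !modn_small ?ltU.
  have jj : (g + j = g + j')%N.
    by move: E; rewrite ii => /addnI /eqP; rewrite eqn_pmul2r ?(leq_ltn_trans _ gP) // => /eqP.
  by congr (_, _); apply: val_inj; [move: ii | move: jj] => /addnI.
have szu : (sz (uel c) <= P * P + (2 * g + 1) * P)%N.
  apply: (dr_sz_sum_le dA) => i _; apply: leq_trans (dr_sz_scale_le dA _ _) _.
  have i1 := ltU i.1; have i2 := ltV i.2.
  rewrite szbb ?leq_addr //.
  have : ((g + i.2) * P <= (P + 2 * g) * P)%N by rewrite leq_mul2r i2 orbT.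
  rewrite (mulnDl P (2 * g)) (mulnDl (2 * g) 1) mul1n; move: i1.
  by move: ((g + i.2) * P)%N (2 * g * P)%N (P * P)%N (g + i.1)%N => *; lia.
(* Term by term, the [P]-th power of [uel c] reduces to [vel c] modulo [p]; reducedness of [A / pA]
   then removes the exponent [P]. *)
have udvd p : p \in S -> congr_mod (io p) (uel c) 0.
  move=> pS; have pp := allP prS p pS; have [e [Ee wE NE]] := HS p pS.
  have QE : (q ^ ((size p).-1 * e))%N = (P * P)%N by rewrite Ee -addnn expnD PE.
  have y'E : congr_mod (io p) (y l ^+ (P * P)) y'.
    rewrite -QE; have := tower_frob_prime tw pp e (leqnn l).
    by rewrite (eq_bigr (fun i : 'I_l.+1 => kappa w`_i * y (l - i)%N)) // => i _; rewrite wE // -ltnS.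
  have xE : congr_mod (io p) (x ^+ (P * P)) x by rewrite -QE; apply: tower_frobX.
  have bE s : congr_mod (io p) (b s ^+ (P * P)) (b' s).
    rewrite exprMn; apply: congr_modM; rewrite exprAC; exact: congr_modX.
  have n0 : (0 < (size p).-1 * (e * N))%N by rewrite mulnA Ee muln_gt0 N0 double_gt0 m0.
  apply: (tower_reduced tw pp n0 NE (n := P)).
  have P0 : (0 < P)%N by rewrite PE expn_gt0 (ltnW q1).
  rewrite -vc0 /uel (big_morph (fun a : A => a ^+ P) (frobDP) (_ : 0 ^+ P = 0)); last first.
    by rewrite expr0n gtn_eqF.
  apply: congr_mod_sum => i _; rewrite exprMn {1}PE frob_const.
  apply: congr_modM; first exact: congr_mod_refl.
  rewrite exprMn -exprM; apply: congr_modM; first exact: congr_mod_refl.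
  exact: bE.
(* The product of the primes divides the nonzero [uel c]; comparing degrees gives the bound. *)
have [c' ] := tower_dvd_prod uS prS udvd; rewrite subr0 => uE.
have nprod : \prod_(p <- S) p != 0.
  by rewrite prodf_seq_neq0; apply/allP => p pS /=; have /andP [mp _] := allP prS p pS; apply: monic_neq0.
have nc' : c' != 0 by apply: contraNneq nu => c0; rewrite uE c0 mulr0.
have sprod : (size (\prod_(p <- S) p)%R).-1 = (\sum_(p <- S) (size p).-1)%N.
  elim: S prS {uS HS udvd uE nprod} => [|p S IH] /=; first by rewrite !big_nil size_poly1.
  case/andP => /andP [mp _] prS; rewrite !big_cons -IH //.
  have nS : \prod_(p <- S) p != 0.
    rewrite prodf_seq_neq0; apply/allP => p' pS /=; have /andP [mp' _] := allP prS p' pS.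
    exact: monic_neq0.
  rewrite size_monicM //; have := monic_neq0 mp; rewrite -size_poly_gt0.
  move: nS; rewrite -size_poly_gt0; move: (size p) (size _) => a b'' ; lia.
have nio : io (\prod_(p <- S) p) != 0 by rewrite -(dr_sz_gt0 dA) szio.
move: szu; rewrite uE (sz_mul dA) // szio // sprod addSn /= -/q.
by move: nc'; rewrite -(dr_sz_gt0 dA); lia.
Qed.

(** * Characters of the 1-units and the Weil bound *)

Section OneUnits.
Variables (F : finFieldType) (l : nat).
Local Notation U := {poly %/ ('X^(l.+1) : {poly F})}.
Implicit Types (g h : {poly F}) (u : {unit U}).

Lemma coef_trunc h i : (in_qpoly 'X^(l.+1) h : {poly F})`_i = if (i < l.+1)%N then h`_i else 0.
Proof. by rewrite /= mk_monic_Xn -Pdiv.RingMonic.take_poly_rmodp coef_take_poly. Qed.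

Lemma trunc_eq g h : (forall i, (i <= l)%N -> g`_i = h`_i) ->
  in_qpoly 'X^(l.+1) g = in_qpoly 'X^(l.+1) h.
Proof.
move=> H; apply: val_inj; apply/polyP => i.
by rewrite !coef_trunc; case: ifP => // il; apply: H.
Qed.

Lemma trunc_unit h : h`_0 = 1 -> in_qpoly 'X^(l.+1) h \is a GRing.unit.
Proof.
move=> h0; have co : coprimep (mk_monic 'X^(l.+1)) (in_qpoly 'X^(l.+1) h : {poly F}).
  suff H (v : {poly F}) : v`_0 = 1 -> coprimep (mk_monic 'X^(l.+1)) v.
    by apply: H; rewrite coef_trunc h0.
  move=> v0; rewrite mk_monic_Xn coprimep_expl // coprimep_sym coprimepX rootE.
  by rewrite horner_coef0 v0 oner_neq0.
by apply/unitrPr; exists (qpoly_inv (in_qpoly 'X^(l.+1) h)); rewrite mulrC; apply: qpoly_mulVz.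
Qed.

(* The class of t^(deg h) h(1/t) modulo t^(l+1); it encodes the l coefficients
   of h below the leading one. *)
Definition top_class h : {unit U} := insubd (1%g : {unit U}) (in_qpoly 'X^(l.+1) (revp (size h).-1 h)).

Lemma val_top_class h : h \is monic ->
  val (top_class h) = in_qpoly 'X^(l.+1) (revp (size h).-1 h).
Proof.
move=> mh; rewrite val_insubd trunc_unit // revp_coef0 // prednK //.
by rewrite size_poly_gt0 monic_neq0.
Qed.

Lemma top_class1 : top_class 1 = 1%g.
Proof.
apply: val_inj; rewrite val_top_class ?monic1 // size_poly1 FinRing.val_unit1 -[RHS](in_qpoly1 'X^(l.+1)).
by apply: trunc_eq => i _; rewrite coef_revp !coef1; case: i.
Qed.

Lemma top_classM g h : g \is monic -> h \is monic ->
  top_class (g * h) = (top_class g * top_class h)%g.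
Proof.
move=> mg mh; apply: val_inj; rewrite FinRing.val_unitM !val_top_class ?rpredM //.
rewrite -rmorphM -revpM ?leqSpred // size_Mmonic ?monic_neq0 //.
have := monic_neq0 mg; have := monic_neq0 mh; rewrite -!size_poly_gt0 => a b.
by congr (in_qpoly _ (revp _ _)); move: (size g) (size h) a b => s t; lia.
Qed.

Lemma top_class_coefX g e i : g \is monic -> (i <= l)%N ->
  ((val (top_class g ^+ e)%g : U) : {poly F})`_i = (revp (size g).-1 g ^+ e)`_i.
Proof.
move=> mg il; rewrite FinRing.val_unitX val_top_class // -rmorphXn coef_trunc.
by rewrite ltnS il.
Qed.

Lemma top_class_eq g h d : g \is monic -> h \is monic -> size g = d.+1 -> size h = d.+1 ->
  (l <= d)%N -> (top_class g == top_class h) = (size (g - h)%R <= d - l)%N.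
Proof.
move=> mg mh sg sh ld; apply/eqP/idP => [E|sgh].
  apply/leq_sizeP => i; rewrite leq_subLR => dli; rewrite coefB.
  have [id|di] := leqP i d; last by rewrite !nth_default ?subrr ?sg ?sh.
  have il : (d - i <= l)%N by rewrite leq_subLR addnC.
  have := congr1 (fun u : {unit U} => ((val u : U) : {poly F})`_(d - i)) E.
  by rewrite !val_top_class // !coef_trunc ltnS il !coef_revp sg sh /= leq_subr subKn // => ->; rewrite subrr.
apply: val_inj; rewrite !val_top_class //; apply: trunc_eq => i il.
rewrite !coef_revp sg sh /=; case: ifP => // id; apply/eqP; rewrite -subr_eq0 -coefB.
by rewrite nth_default // (leq_trans sgh) // leq_sub2l.
Qed.

Definition one_units_set : {set {unit U}} := [set u : {unit U} | ((val u : U) : {poly F})`_0 == 1].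

Lemma one_units_group : group_set one_units_set.
Proof.
apply/group_setP; split=> [|u v]; first by rewrite inE /= coef1.
rewrite !inE => /eqP u0 /eqP v0; rewrite FinRing.val_unitM.
rewrite [_ * _](_ : _ = in_qpoly 'X^(l.+1) (((val u : U) : {poly F}) * ((val v : U) : {poly F}))); last by [].
by rewrite coef_trunc coef0M u0 v0 mulr1.
Qed.

Definition one_units : {group {unit U}} := Group one_units_group.

Lemma top_class_in h : h \is monic -> top_class h \in one_units.
Proof.
move=> mh; rewrite inE val_top_class // coef_trunc /= revp_coef0 // prednK //.
by rewrite size_poly_gt0 monic_neq0.
Qed.

(** Reversing coefficients exchanges monic polynomials of degree [l] with polynomials of degree at
    most [l] and constant coefficient 1, and the latter represent the 1-units. *)
Lemma top_class_mon_bij :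
  {on one_units, bijective (fun g : {poly_l F} => top_class (mon g))}.
Proof.
pose inv u : {poly_l F} := npolyp l (revp l ((val u : U) : {poly F}) - 'X^l).
have su u : (size ((val u : U) : {poly F}) <= l.+1)%N.
  by apply: leq_trans (size_npoly _) _; rewrite mk_monic_Xn size_polyXn.
have invK u : u \in one_units -> mon (inv u) = revp l ((val u : U) : {poly F}).
  rewrite inE => /eqP u0; have sr : size (revp l ((val u : U) : {poly F})) = l.+1.
    apply/eqP; rewrite eqn_leq size_revp ltnNge; apply/negP => /leq_sizeP /(_ l (leqnn _)).
    by rewrite coef_revp leqnn subnn u0 => /eqP; rewrite oner_eq0.
  by apply: monK => //; rewrite monicE lead_coefE sr coef_revp leqnn subnn u0.
exists inv => [g Hg|u uG]; last first.
  apply: val_inj; rewrite val_top_class ?mon_monic // size_mon invK // revpK //.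
  by apply: val_inj; apply: in_qpoly_small; apply: size_mk_monic.
apply: mon_inj; rewrite invK // val_top_class ?mon_monic // size_mon /=.
have sr : (size (revp l (mon g)) <= l.+1)%N by apply: size_revp.
rewrite -[RHS](@revpK _ l) ?size_mon //; congr revp.
by apply: (@in_qpoly_small F 'X^(l.+1)); rewrite mk_monic_Xn size_polyXn.
Qed.

Lemma card_one_units : #|one_units| = (#|F| ^ l)%N.
Proof.
rewrite -card_npoly -sum1_card (reindex _ top_class_mon_bij) /= -sum1_card.
by apply: eq_bigl => g; apply: (top_class_in (mon_monic g)).
Qed.

Lemma sum_one_units (C : nmodType) (f : {unit U} -> C) :
  \sum_(u in one_units) f u = \sum_(g : {poly_l F}) f (top_class (mon g)).
Proof.
rewrite (reindex _ top_class_mon_bij); apply: eq_bigl => g.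
exact: (top_class_in (mon_monic g)).
Qed.

(* Monic polynomials of degree d >= l are equidistributed among the classes. *)
Lemma sum_top_class_eq0 (C : pzRingType) (f : {unit U} -> C) d : (l <= d)%N ->
  \sum_(u in one_units) f u = 0 -> \sum_(g : {poly_d F}) f (top_class (mon g)) = 0.
Proof.
move=> ld; rewrite sum_one_units => f0.
pose top (g : {poly_d F}) : {poly_l F} := npolyp l (drop_poly (d - l) g).
have coef_top (g : {poly_d F}) i : (top g : {poly F})`_i = if (i < l)%N then (g : {poly F})`_(i + (d - l)) else 0.
  by rewrite coef_npolyp coef_drop_poly.
have topE (g : {poly_d F}) : top_class (mon g) = top_class (mon (top g)).
  apply: val_inj; rewrite !val_top_class ?mon_monic // !size_mon; apply: trunc_eq => i il.
  rewrite !coef_revp il (leq_trans il ld) !coefD !coefXn coef_top.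
  case: i il => [|i] il; last first.
    have -> : (d - i.+1 == d)%N = false by lia.
    have -> : (l - i.+1 == l)%N = false by lia.
    have -> : (l - i.+1 < l)%N by lia.
    by congr (_ + _`_ _); lia.
  by rewrite !subn0 !eqxx ltnn nth_default ?size_npoly.
have topD (g g' : {poly_d F}) : top (g + g') = top g + top g'.
  apply/npolyP => i; rewrite coef_top !coefD !coef_top.
  by case: ifP; rewrite ?addr0.
pose lift (A : {poly_l F}) : {poly_d F} := npolyp d ((A : {poly F}) * 'X^(d - l)).
have liftK A : top (lift A) = A.
  apply/npolyP => i; rewrite coef_top coef_npolyp coefMXn.
  have [il|li] := ltnP i l; last by rewrite nth_default // (leq_trans (size_npoly _)).
  have -> : (i + (d - l) < d)%N by lia.
  by rewrite ltnNge leq_addl /= addnK.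
(* All fibres of [top] have the same size: translation by [lift A] carries the fibre of 0 to that of
   [A]. *)
have fib A : (\sum_(g : {poly_d F} | top g == A) 1 = \sum_(g : {poly_d F} | top g == 0%R) 1)%N.
  rewrite (reindex_inj (addIr (lift A))) /=; apply: eq_bigl => g.
  by rewrite topD liftK eq_sym -subr_eq subrr eq_sym.
rewrite (eq_bigr (fun g : {poly_d F} => f (top_class (mon (top g))))); last by move=> g _; rewrite topE.
rewrite (partition_big top predT) //=.
rewrite (eq_bigr (fun A : {poly_l F} => f (top_class (mon A)) *+ (\sum_(g : {poly_d F} | top g == 0%R) 1)%N)).
  by rewrite sumrMnl f0 mul0rn.
move=> A _; rewrite -(fib A) -sumrMnr; apply: eq_big => // g /eqP ->; by rewrite mulr1n.
Qed.

End OneUnits.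

Lemma sum_lin_char_eq0 (gT : finGroupType) (G : {group gT}) (xi : 'CF(G)) :
  xi \is a linear_char -> xi != 1 -> \sum_(u in G) xi u = 0.
Proof.
move=> lx nx; have [u uG nu] : exists2 u, u \in G & xi u != 1.
  apply: contrapT => H; case/negP: nx; apply/eqP/cfun_inP => u uG; rewrite cfun1E uG.
  by apply/eqP/negP => /negP nu; apply: H; exists u.
have E : \sum_(v in G) xi v = xi u * \sum_(v in G) xi v.
  rewrite {1}(reindex_inj (mulgI u)) mulr_sumr; apply: eq_big => v; rewrite groupMl //.
  by move=> vG; rewrite lin_charM.
apply/eqP; have : (1 - xi u) * (\sum_(v in G) xi v) == 0 by rewrite mulrBl mul1r -E subrr.
by rewrite mulf_eq0 subr_eq0 eq_sym (negbTE nu).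
Qed.

(** Termwise [|f_i| <= 2 M - f_i], and the [f_i] cancel in the sum. This turns upper bounds alone
    into a bound for absolute values. *)
Lemma norm_sum_bounded_above (I : finType) (P : {pred I}) (f : I -> algC) (M : algC) :
  0 <= M -> (forall i, i \in P -> f i \is Num.real) -> (forall i, i \in P -> f i <= M) ->
  \sum_(i in P) f i = 0 -> \sum_(i in P) `|f i| <= M *+ 2 *+ #|P|.
Proof.
move=> M0 fr fM f0.
have -> : M *+ 2 *+ #|P| = \sum_(i in P) (M *+ 2 - f i) by rewrite sumrB f0 subr0 sumr_const.
apply: ler_sum => i Pi; rewrite real_ler_norml ?fr //.
have := fM i Pi; rewrite mulr2n => fiM; apply/andP; split.
  by rewrite opprB lerBlDr -{1}[f i]addr0 lerD2l addr_ge0.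
by rewrite lerBrDr lerD.
Qed.

Lemma sum_nat_mul_eq (C : nmodType) (f : nat -> C) d n B : (0 < d)%N -> (0 < n <= B)%N ->
  \sum_(1 <= e < B.+1) (if (e * d == n)%N then f e else 0) =
  if (d %| n)%N then f (n %/ d)%N else 0.
Proof.
move=> d0 /andP [n0 nB]; case: ifP => [dn|ndn].
  have qd : (n %/ d * d == n)%N by rewrite divnK.
  have mem : (n %/ d)%N \in index_iota 1 B.+1.
    by rewrite mem_index_iota divn_gt0 // (dvdn_leq n0 dn) ltnS (leq_trans (leq_div _ _)).
  rewrite (bigD1_seq _ mem (iota_uniq _ _)) /= qd big1 ?addr0 // => e ne.
  by case: eqP => // E; move: ne; rewrite -E mulnK // eqxx.
rewrite big1 // => e _; case: eqP => // E.
by move: ndn; rewrite -E dvdn_mull.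
Qed.

(** * Counting primes with a given Frobenius class *)

Section WeilBound.
Variables (F : finFieldType) (l : nat).
Local Notation q := #|F|.
Local Notation G := (one_units F l).
Local Notation cls := (top_class l).

(* The prime p stands for its power p^(n / deg p), of degree n. *)
Definition class_primes n (u : {unit {poly %/ ('X^(l.+1) : {poly F})}}) (p : {poly_(n.+1) F}) :=
  [&& prime_poly p, ((size p).-1 %| n)%N & (cls p ^+ (n %/ (size p).-1))%g == u].

Definition class_count n u : nat := \sum_(p | class_primes (n := n) u p) (size p).-1.

Lemma deg_prime_gt0 (p : {poly F}) : prime_poly p -> (0 < (size p).-1)%N.
Proof. by move=> /prime_poly_size; case: (size p) => [|[]]. Qed.

Lemma top_classX_in h e : h \is monic -> (cls h ^+ e)%g \in G.
Proof. by move=> mh; rewrite groupX // top_class_in. Qed.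

Lemma prime_sum_class (C : comNzRingType) (X : {poly F} -> C) f n : (0 < n)%N ->
  (forall p e, prime_poly p -> f (cls p ^+ e)%g = X p ^+ e) ->
  prime_sum X n n = \sum_(u in G) f u *+ class_count n u.
Proof.
move=> n0 fX; rewrite /prime_sum.
transitivity (\sum_(p : {poly_(n.+1) F} | prime_poly p && ((size p).-1 %| n)%N)
    f (cls p ^+ (n %/ (size p).-1))%g *+ (size p).-1).
  rewrite [RHS]big_mkcondr; apply: eq_bigr => p pp.
  rewrite (sum_nat_mul_eq (fun e => X p ^+ e *+ (size p).-1)) ?deg_prime_gt0 ?n0 ?leqnn //.
  by case: ifP => // _; rewrite fX.
rewrite (partition_big (fun p : {poly_(n.+1) F} => (cls p ^+ (n %/ (size p).-1))%g) (mem G)); last first.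
  by move=> p /andP [/andP [mp _] _]; apply: (top_classX_in _ mp).
apply: eq_bigr => u uG; rewrite -sumrMnr; apply: eq_big => p; first by rewrite /class_primes andbA.
by case/andP => _ /eqP ->.
Qed.

(** This is the case of the trivial character, where [prime_sum1] gives the total. *)
Lemma sum_class_count n : (0 < n)%N -> (\sum_(u in G) class_count n u = q ^ n)%N.
Proof.
move=> n0; have := @prime_sum_class algC (fun=> 1) (fun=> 1) n n0 (fun _ _ _ => esym (expr1n _ _)).
rewrite prime_sum1 ?n0 ?leqnn //.
rewrite (eq_bigr (fun u => (class_count n u)%:R)) // -natr_sum => /eqP.
by rewrite eqr_nat => /eqP.
Qed.

(** The degree is [2 m] so that Stepanov's bound applies with [P = q^m]. The exponent [#|G|]
    trivializes every class, and [m >= m1] ensures [q^m > g^2 + 3 g + 1]. *)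
Lemma class_count_bound : (0 < l)%N -> exists K m1 : nat, forall m u, (m1 <= m)%N ->
  (q ^ l * class_count m.*2 u <= q ^ m.*2 + K * q ^ m)%N.
Proof.
move=> l0; pose g := (q ^ l * \sum_(i < l) q ^ i)%N.
exists (2 * g + 1)%N, (g * g + 3 * g + 2)%N => m u m1.
have q1 : (1 < q)%N := card_finNzRing_gt1 F.
have m0 : (0 < m)%N by apply: leq_trans m1; rewrite addn2.
pose S := [seq val p | p <- enum {poly_(m.*2.+1) F} & class_primes u p].
have -> : class_count m.*2 u = (\sum_(p <- S) (size p).-1)%N.
  by rewrite big_map big_filter big_enum_cond.
rewrite -addnn expnD.
apply: (@stepanov_bound F l m #|G| (val (val u)) S) => //.
- by apply: leq_ltn_trans (ltn_expl m q1); apply: leq_trans m1; rewrite leq_add2l.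
- rewrite map_inj_uniq; last exact: val_inj.
  by rewrite filter_uniq // enum_uniq.
- by apply/allP => p /mapP [p' ]; rewrite mem_filter => /andP [/and3P [pp _ _] _] ->.
- move=> p /mapP [p' ]; rewrite mem_filter => /andP [/and3P [pp dp /eqP cu] _] ->.
  have mp : (p' : {poly F}) \is monic by case/andP: pp.
  exists (m.*2 %/ (size p').-1)%N; split => [|j jl|j jl].
  + by rewrite mulnC divnK.
  + by rewrite -(top_class_coefX _ mp jl) cu.
  + rewrite -(top_class_coefX _ mp jl) expgM cu.
    by rewrite (@expg_cardG _ G) -?cu ?top_classX_in //= coef1.
Qed.

End WeilBound.

(** * L-functions of nontrivial characters *)

Section WeilCharacter.
Variables (F : finFieldType) (l : nat) (l_gt0 : (0 < l)%N).
Local Notation q := #|F|.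
Local Notation G := (one_units F l).
Local Notation cls := (top_class l).
Variable xi : 'CF(G).
Hypotheses (lin_xi : xi \is a linear_char) (xi_neq1 : xi != 1).
Let X (h : {poly F}) : algC := xi (cls h).

Lemma char_class1 : X 1 = 1.
Proof. by rewrite /X top_class1 lin_char1. Qed.

Lemma char_classM g h : g \is monic -> h \is monic -> X (g * h) = X g * X h.
Proof. by move=> mg mh; rewrite /X top_classM // lin_charM // top_class_in. Qed.

Lemma char_monic_sum_eq0 d : (l <= d)%N -> monic_sum X d = 0.
Proof. by move=> ld; apply: (sum_top_class_eq0 ld); apply: sum_lin_char_eq0. Qed.

Lemma prime_sum_linear : prime_sum X 1 1 = \sum_(a : F) X ('X - a%:P).
Proof.
have := monic_sum_newton char_class1 char_classM (leqnn 1).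
rewrite big_nat1 subnn monic_sum0 ?char_class1 // mulr1 mulr1n => <-.
rewrite /monic_sum (reindex (fun a : F => npolyp 1 (- a%:P))) /=.
  apply: eq_bigr => a _; rewrite /mon npolypK ?expr1 // size_polyN.
  exact: size_polyC_leq1.
exists (fun g : {poly_1 F} => - (g : {poly F})`_0) => [a _|g _].
  by rewrite coef_npolyp /= coefN coefC opprK.
apply/npolyP => i; rewrite coef_npolyp coefN coefC.
by case: i => [|i] //=; rewrite ?oppr0 ?opprK // nth_default // (leq_trans (size_npoly _)).
Qed.

Lemma weil_bound : `|\sum_(a : F) X ('X - a%:P)| <= l.-1%:R * sqrtC q%:R.
Proof.
have q0 : (0 < q)%N by apply: ltnW (card_finNzRing_gt1 F).
pose Lp := \poly_(d < l) monic_sum X d.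
have LpE d : Lp`_d = monic_sum X d.
  by rewrite coef_poly; case: ltnP => // ld; rewrite char_monic_sum_eq0.
have [|s ss sE] := @coef0_1_split Lp; first by rewrite LpE monic_sum0 ?char_class1.
have ls : (size s <= l.-1)%N by rewrite -ltnS prednK // (leq_trans ss) // size_poly.
have powE B d : (0 < d <= B)%N -> prime_sum X B d = - \sum_(a <- s) a ^+ d.
  apply: (newton_unique (L := monic_sum X) (S' := fun d => - \sum_(a <- s) a ^+ d)).
    by rewrite monic_sum0 ?char_class1.
  move=> e eB; rewrite -(monic_sum_newton char_class1 char_classM eB) -LpE sE newton_prod.
  rewrite -sumrN; apply: eq_bigr => i _; rewrite mulNr; congr (- (_ * _)).
  by rewrite -sE LpE.
have [K [m1 HK]] := class_count_bound F l_gt0.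
(* Class counts are bounded in even degrees only, so the growth argument is applied to the squares
   of the inverse roots, with [q] in place of its square root. *)
have growth m : (m1 + 1 <= m)%N ->
    `|\sum_(b <- [seq a ^+ 2 | a <- s]) b ^+ m| <= (K * 2 * #|G|)%:R * q%:R ^+ m.
  move=> mm; have m0 : (0 < m.*2)%N by rewrite double_gt0; apply: leq_trans mm; rewrite addn1.
  have -> : \sum_(b <- [seq a ^+ 2 | a <- s]) b ^+ m = - prime_sum X m.*2 m.*2.
    rewrite powE ?m0 ?leqnn // opprK big_map; apply: eq_bigr => a _.
    by rewrite -exprM mul2n.
  rewrite normrN (prime_sum_class (f := xi) m0); last first.
    move=> p e /andP [mp _]; by rewrite lin_charX // top_class_in.
  set T := class_count _.
  have ql1 : 1 <= (q ^ l)%:R :> algC by rewrite ler1n expn_gt0 q0.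
  (* Subtracting a constant does not change the character sum. The deviations [f u] add up to 0 and
     are at most [K q^m], so the sum of their absolute values is controlled too. *)
  pose f u : algC := (q ^ l * T u)%:R - (q ^ m.*2)%:R.
  have fE : (q ^ l)%:R * (\sum_(u in G) xi u *+ T u) = \sum_(u in G) xi u * f u.
    rewrite mulr_sumr /f; under [RHS]eq_bigr => u _ do rewrite mulrBr.
    rewrite sumrB -mulr_suml sum_lin_char_eq0 // mul0r subr0; apply: eq_bigr => u _.
    by rewrite natrM mulrCA mulr_natr.
  apply: (@le_trans _ _ `|(q ^ l)%:R * (\sum_(u in G) xi u *+ T u)|).
    rewrite normrM normr_nat -[X in X <= _]mul1r ler_wpM2r //.
  rewrite fE; apply: le_trans (ler_norm_sum _ _ _) _.
  rewrite (eq_bigr (fun u => `|f u|)) => [|u uG]; last first.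
    by rewrite normrM normC_lin_char // mul1r.
  have -> : (K * 2 * #|G|)%:R * q%:R ^+ m = (K * q ^ m)%:R *+ 2 *+ #|G| :> algC.
    rewrite -[RHS]mulr_natr -[X in _ = X * _]mulr_natr !natrM natrX.
    by ring.
  apply: norm_sum_bounded_above.
  - exact: ler0n.
  - by move=> u _; rewrite realB ?realn.
  - move=> u _; rewrite lerBlDl -natrD ler_nat; apply: HK.
    by apply: leq_trans mm; rewrite leq_addr.
  - rewrite sumrB -natr_sum -big_distrr /= sum_class_count // sumr_const card_one_units.
    by rewrite natrM mulr_natl subrr.
have small a : a \in s -> `|a| <= sqrtC q%:R.
  move=> sa; rewrite -(@ler_pXn2r _ 2) ?nnegrE ?sqrtC_ge0 ?ler0n ?normr_ge0 //.
  rewrite sqrtCK -normrX; apply: (power_sum_growth q0 growth).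
  exact: map_f.
rewrite -prime_sum_linear powE // normrN; apply: le_trans (ler_norm_sum _ _ _) _.
apply: (@le_trans _ _ (\sum_(a <- s) sqrtC q%:R)).
  by rewrite big_seq [X in _ <= X]big_seq; apply: ler_sum => a sa; rewrite expr1 small.
rewrite big_const_seq count_predT iter_addr_0 -[X in X <= _]mulr_natl ler_wpM2r ?sqrtC_ge0 ?ler0n //.
by rewrite ler_nat.
Qed.

End WeilCharacter.

(** * The counting formula *)

(* The coefficients of A(z) / (1 - z^p), where A(z) = sum_j a_j z^j. *)
Definition gsum (p : nat) (a : nat -> nat) (j : nat) : nat :=
  \sum_(0 <= i < j.+1) (p %| i) * a (j - i).

(* The coefficients of (1 - z)^(-D) (1 - z^p)^(-s). *)
Definition majorant (D p s : nat) : nat -> nat :=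
  iter s (gsum p) (iter D (gsum 1) (fun j => (j == 0)%N)).

(* For the generating functions, z A'(z) = A(z) B(z), with b_0 ignored. *)
Definition newton_pair (a b : nat -> nat) : Prop :=
  forall j, (j * a j = \sum_(1 <= i < j.+1) b i * a (j - i))%N.

(** This is [G = A + z^p G] for [G = A / (1 - z^p)]. *)
Lemma gsum_rec p a j : (0 < p)%N ->
  gsum p a j = (a j + (if (p <= j)%N then gsum p a (j - p) else 0))%N.
Proof.
move=> p0; rewrite /gsum big_ltn // subn0 dvdn0 mul1n; congr (_ + _)%N.
have small m n : (0 < m)%N -> (n <= p)%N -> (\sum_(m <= i < n) (p %| i) * a (j - i) = 0)%N.
  move=> m0 np; rewrite big_nat_cond big1 // => i /andP [/andP [mi i_n] _].
  case: dvdnP => // -[[|t] E]; first by move: mi; rewrite E mul0n leqNgt m0.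
  by move: i_n; rewrite E mulSn ltnNge (leq_trans np) // leq_addr.
case: leqP => [pj|jp]; last by rewrite small.
rewrite (big_cat_nat (n := p)) //=; last exact: leqW.
rewrite small // add0n -{1}(add0n p) big_addn subSn //; apply: eq_big_nat => i _.
by rewrite dvdn_addl // (addnC i) subnDA.
Qed.

(** Dividing [A] by [1 - z^p] adds [p z^p / (1 - z^p)] to [z A' / A], that is, [p] at each positive
    multiple of [p]. *)
Lemma gsum_newton p a b : (0 < p)%N -> newton_pair a b ->
  newton_pair (gsum p a) (fun i => b i + p * (p %| i))%N.
Proof.
move=> p0 H j; have [n] := ubnP j; elim: n j => // n IH j jn.
pose G := gsum p a; pose G' m i := if (p <= m - i)%N then G (m - i - p)%N else 0%N.
have GE i : G (j - i)%N = (a (j - i) + G' j i)%N by rewrite /G gsum_rec.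
transitivity ((\sum_(1 <= i < j.+1) b i * a (j - i) + \sum_(1 <= i < j.+1) p * ((p %| i) * a (j - i)))
   + \sum_(1 <= i < j.+1) (b i + p * (p %| i)) * G' j i)%N; last first.
  rewrite -!big_split; apply: eq_bigr => i _; rewrite -/G GE /=; lia.
rewrite -H -big_distrr /=.
have -> : (\sum_(1 <= i < j.+1) (p %| i) * a (j - i) = if (p <= j)%N then G (j - p) else 0)%N.
  have := gsum_rec a j p0; rewrite {1}/gsum big_ltn // subn0 dvdn0 mul1n.
  by move=> /addnI.
have -> : (\sum_(1 <= i < j.+1) (b i + p * (p %| i)) * G' j i = if (p <= j)%N then (j - p) * G (j - p) else 0)%N.
  case: leqP => [pj|jp]; last first.
    by rewrite big1 // => i _; rewrite /G' leqNgt (leq_ltn_trans (leq_subr _ _) jp) muln0.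
  rewrite IH; last by lia.
  rewrite (big_cat_nat (n := (j - p).+1)) //=; last by lia.
  rewrite [X in (_ + X)%N]big_nat_cond [X in (_ + X)%N]big1 ?addn0; last first.
    move=> i /andP [/andP [i1 i2] _]; rewrite /G' ifF ?muln0 //; lia.
  apply: eq_big_nat => i /andP [i1 i2]; rewrite /G' ifT; last by lia.
  by rewrite subnAC.
rewrite -/G -(subn0 j) GE /G' subn0; case: leqP => pj; last by rewrite muln0 !addn0.
by nia.
Qed.

Lemma majorant_newton D p s : (0 < p)%N ->
  newton_pair (majorant D p s) (fun i => D + (s * p) * (p %| i))%N.
Proof.
move=> p0; elim: s => [|s IH] /=.
  rewrite /majorant /=; elim: D => [|D IH] /=.
    move=> j; rewrite big1 => [|i _]; first by case: j => //= j; rewrite muln0.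
    by rewrite mul0n.
  have := gsum_newton (ltn0Sn 0) IH => H j; rewrite H; apply: eq_bigr => i _.
  by rewrite dvd1n /= !mul0n; lia.
have := gsum_newton p0 IH => H j; rewrite H; apply: eq_bigr => i _.
by congr (_ * _)%N; rewrite mulSn mulnDl; lia.
Qed.

Lemma majorant0 D p s : majorant D p s 0 = 1%N.
Proof.
rewrite /majorant; elim: s => [|s IH] /=; last by rewrite /gsum big_nat1 dvdn0 mul1n subn0 IH.
by elim: D => [|D IH] //=; rewrite /gsum big_nat1 dvdn0 mul1n subn0 IH.
Qed.

(** By induction, Newton's identities bound [j |e_j|] by the sum of the [b_i a_(j-i)], which is
    [j a_j]. *)
Lemma newton_pair_bound (e : nat -> algC) (S : nat -> algC) a b :
  `|e 0%N| <= (a 0%N)%:R -> newton_pair a b ->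
  (forall j, e j *+ j = \sum_(1 <= i < j.+1) S i * e (j - i)%N) ->
  (forall i, (0 < i)%N -> `|S i| <= (b i)%:R) -> forall j, `|e j| <= (a j)%:R.
Proof.
move=> e0 Hab He HS j; have [n] := ubnP j; elim: n j => // n IH [|j] jn //.
rewrite -(ler_pMn2r (ltn0Sn j)) -normrMn He -mulrnA mulnC Hab natr_sum.
apply: le_trans (ler_norm_sum _ _ _) _; apply: ler_sum_nat => i /andP [i1 i2]; rewrite normrM natrM.
by apply: ler_pM => //; [exact: HS | apply: IH; lia].
Qed.

Lemma bin_trinomial n j r : (r <= j)%N -> ('C(n, j) * 'C(j, r) = 'C(n, r) * 'C(n - r, j - r))%N.
Proof.
move=> rj; have [jn|nj] := leqP j n; last first.
  rewrite bin_small // mul0n; have [rn|nr] := leqP r n; last by rewrite bin_small.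
  by rewrite (@bin_small (n - r)) ?muln0 // ltn_sub2r // (leq_ltn_trans rn).
have rn : (r <= n)%N := leq_trans rj jn.
have H1 := bin_fact jn; have H2 := bin_fact rj; have H3 := bin_fact rn.
have jrn : (j - r <= n - r)%N by lia.
have H4 := bin_fact jrn; have E : (n - r - (j - r) = n - j)%N by lia.
rewrite E in H4.
apply/eqP; rewrite -(eqn_pmul2r (_ : 0 < r`! * (j - r)`! * (n - j)`!)%N); last by rewrite !muln_gt0 !fact_gt0.
apply/eqP; transitivity ('C(n, j) * ('C(j, r) * (r`! * (j - r)`!) * (n - j)`!))%N; first by ring.
rewrite H2 H1 -H3 -H4; ring.
Qed.

Lemma sum_sign_bin (C : comNzRingType) n :
  \sum_(0 <= i < n.+1) (-1) ^+ i * 'C(n, i)%:R = (n == 0%N)%:R :> C.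
Proof.
have := exprBn (1 : C) 1 n; rewrite subrr expr0n big_mkord => ->; apply: eq_bigr => i _.
by rewrite !expr1n !mulr1 mulr_natr.
Qed.

(** Binomial inversion: [C(Z, j) C(j, r) = C(Z, r) C(Z - r, j - r)], and the alternating sum of the
    last factor over [j] vanishes unless [Z = r]. *)
Lemma exact_count (C : comNzRingType) Z m r : (Z <= m)%N ->
  (Z == r)%:R = \sum_(r <= j < m.+1) (-1) ^+ (j - r) * 'C(j, r)%:R * 'C(Z, j)%:R :> C.
Proof.
move=> Zm; have [rZ|Zr] := leqP r Z; last first.
  rewrite ltn_eqF // big_nat_cond big1 // => j /andP [/andP [rj _] _].
  by rewrite (@bin_small Z) ?mulr0 // (leq_trans Zr).
rewrite (big_cat_nat (n := Z.+1)) //=; last by rewrite leqW.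
rewrite [X in _ = _ + X]big_nat_cond [X in _ = _ + X]big1 ?addr0; last first.
  by move=> j /andP [/andP [rj _] _]; rewrite (@bin_small Z) ?mulr0.
rewrite -[X in _ = \sum_(X <= _ < _) _](add0n r) big_addn subSn //.
rewrite (eq_big_nat _ _ (F2 := fun i => 'C(Z, r)%:R * ((-1) ^+ i * 'C(Z - r, i)%:R))).
  rewrite -mulr_sumr sum_sign_bin subn_eq0 eqn_leq rZ andbT.
  by case: leqP => Zr; rewrite ?mulr0 // (anti_leq (_ : Z <= r <= Z)%N) ?binn ?mulr1 // Zr.
move=> i _; have := bin_trinomial Z (leq_addl i r); rewrite addnK => E.
by rewrite -mulrA -natrM [('C(i + r, r) * _)%N]mulnC E natrM mulrCA.
Qed.

(** * Monic polynomials with exactly r roots in F *)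

Section RootCount.
Variables (F : finFieldType) (C : comNzRingType) (X : {poly F} -> C).
Hypothesis X1 : X 1 = 1.
Hypothesis XM : forall g h, g \is monic -> h \is monic -> X (g * h) = X g * X h.

Definition nroots (h : {poly F}) : nat := #|[set a | root h a]|.

Definition linear_esym (j : nat) : C := (\prod_(a : F) (1 + X ('X - a%:P) *: 'X))`_j.

Definition set_poly (W : {set F}) : {poly F} := \prod_(a in W) ('X - a%:P).

Lemma set_poly_monic W : set_poly W \is monic.
Proof. by apply: monic_prod => a _; apply: monicXsubC. Qed.

Lemma size_set_poly W : size (set_poly W) = #|W|.+1.
Proof. by rewrite /set_poly -big_enum size_prod_XsubC -cardE. Qed.

Lemma set_poly_dvd W h : (set_poly W %| h) = (W \subset [set a | root h a]).
Proof.
rewrite /set_poly -big_enum /=; apply/idP/fintype.subsetP => [dv a aW|sub].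
  rewrite inE -dvdp_XsubCl; apply: dvdp_trans dv.
  by rewrite (bigD1_seq a) ?mem_enum ?enum_uniq //= dvdp_mulr.
apply: uniq_roots_dvdp; last by rewrite uniq_rootsE enum_uniq.
by apply/allP => a; rewrite mem_enum => /sub; rewrite inE.
Qed.

Lemma mult_set_poly W : X (set_poly W) = \prod_(a in W) X ('X - a%:P).
Proof.
have [_ ->] : set_poly W \is monic /\ X (set_poly W) = \prod_(a in W) X ('X - a%:P).
  rewrite /set_poly; apply: (big_ind2 (fun g y => g \is monic /\ X g = y)).
  - by rewrite monic1.
  - by move=> g y h z [mg <-] [mh <-]; rewrite rpredM // XM.
  - by move=> a _; rewrite monicXsubC.
by [].
Qed.

Lemma linear_esymE j : linear_esym j = \sum_(W : {set F} | #|W| == j) X (set_poly W).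
Proof.
rewrite /linear_esym; under eq_bigr => a _ do rewrite addrC.
rewrite bigA_distr coef_sum [RHS]big_mkcond; apply: eq_bigr => W _.
rewrite -big_mkcond /= scaler_prod prodr_const coefZ coefXn mult_set_poly eq_sym.
by case: eqP; rewrite ?mulr1 ?mulr0.
Qed.

Lemma linear_esym_big j : (#|F| < j)%N -> linear_esym j = 0.
Proof.
move=> qj; rewrite linear_esymE big1 // => W /eqP Wj.
by move: qj; rewrite ltnNge -Wj max_card.
Qed.

(** [exact_count] replaces the condition on the number of roots by binomials, which count the
    [j]-sets of roots. A polynomial vanishing on such a set is the product of [set_poly W] and a
    monic cofactor. *)
Lemma sum_exact_roots m r :
  \sum_(g : {poly_m F}) X (mon g) * (nroots (mon g) == r)%:R =
  \sum_(r <= j < m.+1) (-1) ^+ (j - r) * 'C(j, r)%:R * (linear_esym j * monic_sum X (m - j)).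
Proof.
have Zm (g : {poly_m F}) : (nroots (mon g) <= m)%N.
  rewrite -ltnS -(size_mon g) /nroots cardE.
  apply: max_poly_roots; rewrite ?enum_uniq ?monic_neq0 ?mon_monic //.
  by apply/allP => a; rewrite mem_enum inE.
transitivity (\sum_(g : {poly_m F}) \sum_(r <= j < m.+1)
    (-1) ^+ (j - r) * 'C(j, r)%:R * (X (mon g) *+ 'C(nroots (mon g), j))).
  apply: eq_bigr => g _; rewrite (exact_count _ r (Zm g)) mulr_sumr; apply: eq_bigr => j _.
  by rewrite mulrCA -[X (mon g) *+ _]mulr_natr.
rewrite exchange_big; apply: eq_big_nat => j /andP [_ jm] /=; rewrite -mulr_sumr; congr (_ * _).
rewrite linear_esymE mulr_suml.
transitivity (\sum_(g : {poly_m F}) \sum_(W : {set F} | #|W| == j)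
   (if set_poly W %| mon g then X (mon g) else 0)).
  apply: eq_bigr => g _; rewrite -cards_draws -sumr_const big_mkcond [RHS]big_mkcond.
  apply: eq_bigr => W _; rewrite !inE set_poly_dvd andbC.
  by case: (#|W| == j).
rewrite exchange_big; apply: eq_bigr => W /eqP Wj; rewrite -big_mkcond /=.
rewrite (@sum_mon_dvd F C X _ j) ?set_poly_monic ?size_set_poly ?Wj // -ltnS jm.
by rewrite mulr_sumr; apply: eq_bigr => g _; rewrite XM ?set_poly_monic ?mon_monic.
Qed.

End RootCount.

(** An exponent [i] prime to [p] is invertible modulo the order of [G], so [xi] can be recovered
    from [xi ^+ i]. *)
Lemma lin_char_exp_neq1 (gT : finGroupType) (G : {group gT}) (xi : 'CF(G)) p M i :
  #|G| = (p ^ M)%N -> prime p -> ~~ (p %| i)%N -> xi \is a linear_char -> xi != 1 ->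
  xi ^+ i != 1.
Proof.
move=> cG pp ni lx; apply: contra => /eqP xi1; apply/eqP/cfun_inP => u uG.
rewrite cfun1E uG.
have e1 : xi u ^+ i = 1 by rewrite -exp_cfunE // xi1 cfun1E uG.
have e2 : xi u ^+ (p ^ M) = 1 by rewrite -lin_charX // -cG expg_cardG // lin_char1.
have co : coprime i (p ^ M) by rewrite coprime_sym coprimeXl // prime_coprime.
have i0 : (0 < i)%N by rewrite lt0n; apply: contraNneq ni => ->; rewrite dvdn0.
case: (egcdnP (p ^ M) i0) => km kn E _; rewrite (eqP co) in E.
have := congr1 (fun n => xi u ^+ n) E.
by rewrite exprD expr1 (mulnC km) (mulnC kn) !exprM e1 e2 !expr1n mul1r => <-.
Qed.

(** * Trivial and nontrivial characters in the root count *)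

Section CharacterEstimates.
Variables (F : finFieldType) (l p e D : nat).
Hypotheses (l_gt0 : (0 < l)%N) (p_prime : prime p) (e_gt0 : (0 < e)%N).
Hypothesis card_F : #|F| = (p ^ e)%N.
Hypothesis D_ge : (l.-1 ^ 2 * #|F| <= D ^ 2)%N.
Local Notation q := #|F|.
Local Notation G := (one_units F l).
Local Notation cls := (top_class l).
Local Notation X := (fun xi : 'CF(G) => fun h : {poly F} => xi (cls h) : algC).

Lemma weil_bound_nat (xi : 'CF(G)) : xi \is a linear_char -> xi != 1 ->
  `|\sum_(a : F) xi (cls ('X - a%:P))| <= D%:R.
Proof.
move=> lx nx; apply: le_trans (weil_bound l_gt0 lx nx) _.
rewrite -(@ler_pXn2r _ 2) ?nnegrE ?mulr_ge0 ?sqrtC_ge0 ?ler0n //.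
by rewrite exprMn sqrtCK -!natrX -natrM ler_nat.
Qed.

(** The [i]-th power sum is at most [D] by the Weil bound for [xi ^+ i] if [p] does not divide [i],
    and at most [q = p * p^(e-1)] trivially otherwise; these bounds are the Newton partner of
    [majorant]. *)
Lemma linear_esym_bound (xi : 'CF(G)) j : xi \is a linear_char -> xi != 1 ->
  `|linear_esym (X xi) j| <= (majorant D p (p ^ e.-1) j)%:R.
Proof.
move=> lx nx; pose s := [seq - xi (cls ('X - a%:P)) | a <- enum F].
have sE : \prod_(a : F) (1 + xi (cls ('X - a%:P)) *: 'X) = \prod_(b <- s) (1 - b *: 'X).
  by rewrite big_map big_enum; apply: eq_bigr => a _; rewrite scaleNr opprK.
have p0 := prime_gt0 p_prime; have q0 : (0 < q)%N by rewrite card_F expn_gt0 p0.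
have unitc a : `|xi (cls ('X - a%:P))| = 1.
  by rewrite normC_lin_char // top_class_in // monicXsubC.
apply: (newton_pair_bound (e := linear_esym (X xi)) (S := fun i => - \sum_(b <- s) b ^+ i) _ (majorant_newton D (p ^ e.-1) p0)).
- rewrite majorant0 /linear_esym (big_morph (fun g : {poly algC} => g`_0) (@coef0M _) (coef1 _ 0)).
  by rewrite big1 ?normr1 // => a _; rewrite coefD coef1 coefZ coefX mulr0 addr0.
- move=> i; rewrite /linear_esym sE newton_prod -sumrN; apply: eq_bigr => n _.
  by rewrite mulNr.
- move=> i i0; rewrite normrN -expnSr prednK // -card_F.
  have -> : `|\sum_(b <- s) b ^+ i| = `|\sum_(a : F) xi (cls ('X - a%:P)) ^+ i|.
    rewrite big_map big_enum /=; under eq_bigr => a _ do rewrite exprNn.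
    by rewrite -mulr_sumr normrM normrX normrN1 expr1n mul1r.
  have [pi|npi] := boolP (p %| i)%N.
    rewrite muln1; apply: le_trans (ler_norm_sum _ _ _) _.
    rewrite (eq_bigr (fun=> 1)) => [|a _]; last by rewrite normrX unitc expr1n.
    by rewrite sumr_const ler_nat leq_addl.
  rewrite muln0 addn0.
  have nxi : xi ^+ i != 1.
    apply: (lin_char_exp_neq1 _ p_prime npi lx nx (M := (e * l)%N)).
    by rewrite card_one_units card_F expnM.
  have := weil_bound_nat (rpredX i lx) nxi; congr (`|_| <= _).
  by apply: eq_bigr => a _; rewrite exp_cfunE // top_class_in // monicXsubC.
Qed.

Lemma monic_sum_bound (xi : 'CF(G)) d : xi \is a linear_char ->
  `|monic_sum (X xi) d| <= (q ^ d)%:R.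
Proof.
move=> lx; apply: le_trans (ler_norm_sum _ _ _) _.
rewrite (eq_bigr (fun=> 1)) => [|g _]; first by rewrite sumr_const card_npoly.
by rewrite normC_lin_char // top_class_in // mon_monic.
Qed.

Lemma one_units_abelian : abelian G.
Proof.
apply/centsP => u _ v _; apply: val_inj; rewrite !FinRing.val_unitM.
exact: mulrC.
Qed.

Lemma irr_one_units_lin i : 'chi[G]_i \is a linear_char.
Proof. exact/char_abelianP/one_units_abelian. Qed.

Lemma one_units_orthogonality u v : u \in G -> v \in G ->
  \sum_i 'chi[G]_i u * ('chi_i v)^* = (q ^ l)%:R *+ (u == v).
Proof.
move=> uG vG; rewrite second_orthogonality_relation //.
have cent w : w \in G -> 'C_G[w]%g = G.
  by move=> wG; apply/finset.setIidPl; rewrite sub_cent1 (fintype.subsetP one_units_abelian).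
rewrite cent // card_one_units; congr (_ *+ nat_of_bool _).
have /cent_classP -> : v \in 'C(G)%g by apply: (fintype.subsetP one_units_abelian).
by rewrite inE.
Qed.

Definition class_root_count m (f : {poly F}) r : nat :=
  #|[set g : {poly_m F} | (cls (mon g) == cls f) && (nroots (mon g) == r)]|.

(** The share of the trivial character in [q ^ l * class_root_count]: for it the symmetric functions
    are binomials and the monic sums powers of [q]. *)
Definition count_main m r : int :=
  \sum_(r <= j < m.+1) (-1) ^+ (j - r) * 'C(j, r)%:R * ('C(q, j) * q ^ (m - j))%:R.

(* Only the degrees j with m - l < j <= q contribute: L_(m-j) vanishes for
   m - j >= l and E_j vanishes for j > q. *)
Definition count_error_bound m r : nat :=
  \sum_(r <= j < m.+1 | (m - l < j <= q)%N) 'C(j, r) * majorant D p (p ^ e.-1) j * q ^ (m - j).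

(** Orthogonality of the characters detects the class of [f], and each nontrivial character, of
    which there are fewer than [q^l], contributes at most [count_error_bound]. The inequality is put
    in integers in order to pass from [algC] to [R]. *)
Lemma count_error m f r : f \is monic -> (l <= m)%N ->
  `|(q ^ l * class_root_count m f r)%:Z - count_main m r| <= (q ^ l * count_error_bound m r)%:Z.
Proof.
move=> mf lm.
pose T (xi : 'CF(G)) : algC := \sum_(r <= j < m.+1) (-1) ^+ (j - r) * 'C(j, r)%:R
  * (linear_esym (X xi) j * monic_sum (X xi) (m - j)).
have fG := top_class_in l mf.
have char_sum : (q ^ l * class_root_count m f r)%:R =
    \sum_i ('chi[G]_i (cls f))^* * T 'chi_i.
  transitivity (\sum_i \sum_(g : {poly_m F}) ('chi[G]_i (cls f))^* * ('chi_i (cls (mon g)) * (nroots (mon g) == r)%:R)).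
    rewrite exchange_big /= natrM /class_root_count -sum1_card natr_sum mulr_sumr big_mkcond /=.
    apply: eq_bigr => g _.
    rewrite inE; under [RHS]eq_bigr => i _ do rewrite mulrA [_ * 'chi_i _]mulrC.
    rewrite -mulr_suml one_units_orthogonality ?top_class_in ?mon_monic //.
    by case: eqP => _; case: eqP => _; rewrite ?mulr1 ?mulr0 ?mul0r.
  apply: eq_bigr => i _; rewrite -mulr_sumr /T.
  rewrite -(sum_exact_roots (X := X 'chi_i)) //.
  - exact: char_class1 (irr_one_units_lin i).
  - exact: char_classM (irr_one_units_lin i).
have X1 h : h \is monic -> (1 : 'CF(G)) (cls h) = 1.
  by move=> mh; rewrite cfun1E top_class_in.
have T1 : T 1 = (count_main m r)%:~R.
  rewrite /T /count_main rmorph_sum; apply: eq_bigr => j _.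
  rewrite (linear_esymE (char_class1 (cfun1_lin_char _)) (char_classM (cfun1_lin_char _))).
  rewrite (eq_bigr (fun=> 1)) => [|W _]; last by rewrite X1 // set_poly_monic.
  rewrite sumr_const -card_draws -cardsE /monic_sum (eq_bigr (fun=> 1)) => [|g _]; last first.
    by rewrite X1 // mon_monic.
  rewrite sumr_const card_npoly !rmorphM rmorph_sign !rmorph_nat.
  by congr (_ * (_%:R * _)); apply: eq_card => W; rewrite !inE.
have main0 : (('chi[G]_0 (cls f))^* * T 'chi_0) = (count_main m r)%:~R.
  by rewrite irr0 cfun1E fG conjC1 mul1r T1.
have bound i : i != 0 -> `|('chi[G]_i (cls f))^* * T 'chi_i| <= (count_error_bound m r)%:R.
  move=> ni; have lx := irr_one_units_lin i.
  have nx : 'chi[G]_i != 1 by rewrite irr_eq1.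
  rewrite normrM norm_conjC normC_lin_char // mul1r /T.
  apply: le_trans (ler_norm_sum _ _ _) _; rewrite /count_error_bound natr_sum [X in _ <= X]big_mkcond.
  apply: ler_sum => j _ /=; rewrite !normrM normrX normrN1 expr1n mul1r normr_nat.
  case: leqP => [jm|mj].
    by rewrite (char_monic_sum_eq0 lx nx) ?normr0 ?mulr0 //; lia.
  case: leqP => [jq|qj]; last first.
    rewrite linear_esym_big ?normr0 ?mul0r ?mulr0 //.
    - exact: char_class1 lx.
    - exact: char_classM lx.
  rewrite !natrM -mulrA ler_wpM2l // ler_pM //; first exact: linear_esym_bound.
  exact: monic_sum_bound.
rewrite -(ler_int algC) intr_norm rmorphB /= -pmulrn char_sum.
rewrite (bigD1 0) //= main0 addrAC subrr add0r.
apply: le_trans (ler_norm_sum _ _ _) _.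
apply: (@le_trans _ _ (\sum_(i : Iirr G) (count_error_bound m r)%:R)).
  rewrite [X in _ <= X](bigD1 0) //= -[X in X <= _]add0r lerD ?ler0n //.
  exact: ler_sum.
rewrite sumr_const card_ord NirrE (eqP (_ : #|classes G| == #|G|)); last first.
  by rewrite -card_classes_abelian one_units_abelian.
by rewrite card_one_units -mulrnA -pmulrn mulnC.
Qed.

End CharacterEstimates.

(** * From codewords to polynomials in a class *)

Section CodewordCount.
Variables (F : finFieldType) (l k r : nat) (f : {poly F}).
Hypotheses (k_le_q : (k <= #|F|)%N) (monic_f : f \is monic) (size_f : size f = (k + l).+1).

Lemma word_of_inj : injective (fun g : {poly_k F} => word_of (val g)).
Proof.
move=> g h E; apply/val_inj/eqP; rewrite -subr_eq0; apply/negP => /negP nz.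
have := max_poly_roots nz (rs := enum F) _ (enum_uniq _).
rewrite -cardE ltnNge (leq_trans _ k_le_q) //.
  move=> H; have /H // : all (root (val g - val h)) (enum F).
  apply/allP => x _; rewrite rootE hornerD hornerN subr_eq0; apply/eqP.
  by have := congr1 (fun u : {ffun F -> F} => u x) E; rewrite !ffunE.
by apply: leq_trans (size_polyD _ _) _; rewrite size_polyN geq_max !size_npoly.
Qed.

Lemma hamming_dist_roots (g : {poly F}) :
  (hamming_dist (word_of g) (word_of f) + nroots (f - g) = #|F|)%N.
Proof.
rewrite /hamming_dist /nroots -(cardC [set a | root (f - g) a]) addnC; congr (_ + _)%N.
apply: eq_card => x; rewrite !inE !ffunE rootE hornerD hornerN subr_eq0.
by rewrite eq_sym.
Qed.

Lemma codewords_at_class : codewords_at k f r = class_root_count l (k + l) f r.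
Proof.
have msub (g : {poly_k F}) : f - (g : {poly F}) \is monic /\ size (f - (g : {poly F})) = (k + l).+1.
  have lt : (size (- (g : {poly F})) < size f)%N.
    by rewrite size_polyN size_f ltnS (leq_trans (size_npoly _)) // leq_addr.
  by split; [rewrite monicE lead_coefDl // -monicE | rewrite size_polyDl].
pose A := [set g : {poly_k F} | nroots (f - (g : {poly F})) == r].
have -> : codewords_at k f r = #|A|.
  rewrite -(card_imset _ word_of_inj); apply: eq_card => u.
  rewrite inE; apply/andP/imsetP => [[/imsetP [g _ ->] H]|[g]].
    exists g => //; rewrite inE; move: H; rewrite -(hamming_dist_roots (val g)) eqn_add2l.
    by rewrite eq_sym.
  rewrite inE => /eqP rg ->; split; first by apply/imsetP; exists g.
  by rewrite -rg hamming_dist_roots.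
pose phi (g : {poly_k F}) : {poly_(k + l) F} := npolyp (k + l) (f - (g : {poly F}) - 'X^(k + l)).
have phiE g : mon (phi g) = f - (g : {poly F}) by have [mg sg] := msub g; rewrite monK.
have phi_inj : injective phi.
  move=> g h /(congr1 (@mon F _)); rewrite !phiE => /addrI /oppr_inj; exact: val_inj.
rewrite /class_root_count -(card_imset _ phi_inj); apply: eq_card => h; rewrite [RHS]inE.
apply/imsetP/andP => [[g]|[ch rh]].
  rewrite inE => rg ->; have [mg sg] := msub g; rewrite phiE (top_class_eq _ _ sg size_f) ?leq_addl //.
  by rewrite addrAC subrr sub0r size_polyN addnK size_npoly.
move: ch; rewrite (top_class_eq (mon_monic h) monic_f (size_mon h) size_f) ?leq_addl // addnK => sh.
have gE : npolyp k (f - mon h) = f - mon h :> {poly F} by rewrite npolypK // -size_polyN opprB.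
have hE : h = phi (npolyp k (f - mon h)).
  by apply: mon_inj; rewrite phiE gE opprB addrC subrK.
exists (npolyp k (f - mon h)) => //; rewrite inE gE opprB addrC subrK //.
Qed.

End CodewordCount.

(** * Asymptotic estimates *)

Section MainTerm.
Variable R : realType.

Lemma alternating_sum_bounds (t : nat -> R) n : (forall i, 0 <= t i) ->
  (forall i, t i.+1 <= t i) ->
  0 <= \sum_(i < n) (-1) ^+ i * t i <= t 0%N.
Proof.
elim: n t => [|n IH] t t0 td; first by rewrite big_ord0 lexx t0.
have := IH (fun i => t i.+1) (fun i => t0 i.+1) (fun i => td i.+1).
rewrite big_ord_recl expr0 mul1r.
have -> : \sum_(i < n) (-1) ^+ (lift ord0 i) * t (lift ord0 i) = - \sum_(i < n) (-1) ^+ i * t i.+1.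
  by rewrite -sumrN; apply: eq_bigr => i _; rewrite lift0 exprS mulN1r mulNr.
by move=> /andP [a b]; have := td 0%N; move=> c; apply/andP; split; lra.
Qed.

(** The terms [t_i] decrease and alternate in sign. For [r > 0] the first two leave
    [1 - (q - r) / q = r / q]. For [r = 0] they cancel, and the next two, present as [m >= 3], leave
    [t_2 - t_3 >= (2/3) t_2 >= 1/6], whence [q >= 6]. *)
Lemma mu_lower (q m r : nat) : (6 <= q)%N -> (3 <= m)%N -> (r <= q)%N -> (r <= m)%N ->
  q%:R^-1 <= mu R q (m - r) r.
Proof.
move=> q6 m3 rq rm; have q0 : 0 < q%:R :> R by rewrite ltr0n; lia.
pose n := (q - r)%N; pose t i : R := 'C(n, i)%:R * q%:R ^- i.
have muE : mu R q (m - r) r = \sum_(i < (m - r).+1) (-1) ^+ i * t i.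
  by apply: eq_bigr => i _; rewrite mulrA.
have t_ge0 i : 0 <= t i by rewrite mulr_ge0 ?ler0n // invr_ge0 exprn_ge0 // ltW.
have t_rec i : i.+1%:R * q%:R * t i.+1 = (n - i)%:R * t i.
  rewrite /t exprS invfM; have := mul_bin_left n i => /(congr1 (fun x => x%:R : R)).
  rewrite !natrM => E; transitivity ((i.+1%:R * 'C(n, i.+1)%:R) * (q%:R / q%:R) * q%:R ^- i : R); first by ring.
  by rewrite E divff ?gt_eqF // mulr1 mulrA.
have t_dec i : t i.+1 <= t i.
  have c0 : 0 < i.+1%:R * q%:R :> R by rewrite mulr_gt0 // ltr0n.
  rewrite -(ler_pM2l c0) t_rec ler_wpM2r // -natrM ler_nat; rewrite /n; nia.
have t0 : t 0%N = 1 by rewrite /t bin0 expr0 invr1 mulr1.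
have t1 : t 1%N = n%:R / q%:R by rewrite /t bin1 expr1.
rewrite muE; case Em : (m - r)%N => [|M].
  by rewrite big_ord_recl big_ord0 expr0 mul1r addr0 t0 invf_le1 // ler1n; lia.
have split2 j (u : nat -> R) : \sum_(i < j.+2) (-1) ^+ i * u i = u 0%N - u 1%N + \sum_(i < j) (-1) ^+ i * u i.+2.
  rewrite !big_ord_recl expr0 mul1r -addrA; congr (_ + _); rewrite lift0 expr1 mulN1r; congr (_ + _).
  by apply: eq_bigr => i _; rewrite !lift0 !exprS mulN1r mulN1r opprK.
have [r0|r1] := posnP r; last first.
  rewrite split2 t0 t1 -subr_ge0.
  have /andP [S0 _] := alternating_sum_bounds M (fun i => t_ge0 i.+2) (fun i => t_dec i.+2).
  have : q%:R^-1 <= 1 - n%:R / q%:R :> R.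
    rewrite -[X in _ <= X - _](@divff _ (q%:R : R)) ?gt_eqF // -mulrBl /n natrB // opprB addrC subrK.
    by rewrite -[X in X <= _]mul1r; apply: ler_wpM2r; rewrite ?invr_ge0 ?ler1n // ltW.
  lra.
have [M' EM] : exists M', M = M'.+2 by exists (M - 2)%N; lia.
rewrite EM (split2 M'.+1.+1.-1.+1 t) (split2 M' (fun i => t i.+2)) t0 t1.
have /andP [S0 _] := alternating_sum_bounds M' (fun i => t_ge0 i.+4) (fun i => t_dec i.+4).
have nq : n = q by rewrite /n r0 subn0.
rewrite nq divff ?gt_eqF // subrr add0r.
have e1 := t_rec 1%N; have e2 := t_rec 2%N.
rewrite t1 nq divff ?gt_eqF // mulr1 natrB in e1; last by lia.
rewrite nq natrB in e2; last by lia.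
have q6' : 6 <= q%:R :> R by rewrite (ler_nat R 6).
have h2 : 1 / 4 <= t 2%N by nra.
have h3 : t 3%N <= t 2%N / 3 by nra.
have h : q%:R^-1 <= 1 / 6 :> R by rewrite -[1 / 6]/(1 * 6^-1) mul1r lef_pV2 // posrE.
lra.
Qed.

(** With [j = i + r], the identity [C(q, j) C(j, r) = C(q, r) C(q - r, i)] isolates the terms of
    [mu]. *)
Lemma count_main_term (F : finFieldType) (l k r : nat) (q := #|F|) : (r <= k + l)%N ->
  (count_main F (k + l) r)%:~R = (q ^ l)%:R * main_term R q l k r.
Proof.
move=> rm; have q0 : q%:R != 0 :> R by rewrite pnatr_eq0 -lt0n ltnW // card_finNzRing_gt1.
rewrite /count_main /main_term rmorph_sum /= -[X in (\sum_(X <= _ < _) _)](add0n r) big_addn subSn //.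
rewrite big_mkord /mu !mulr_suml mulr_sumr; apply: eq_bigr => i _.
rewrite addnK !rmorphM rmorph_sign !rmorph_nat /= -/q.
have E := bin_trinomial q (leq_addl i r); rewrite addnK in E.
have irm : (i + r <= k + l)%N by have := ltn_ord i; lia.
have pw : (q ^ (k + l - (i + r)))%:R = (q ^ l)%:R / q%:R ^+ i * q%:R ^ (k%:Z - r%:Z) :> R.
  rewrite !natrX exprnN (exprnP _ l) (exprnP _ (k + l - (i + r))) -!expfzDr //; congr (_ ^ _).
  by rewrite -subzn // !PoszD; ring.
have Er : 'C(q, i + r)%:R * 'C(i + r, r)%:R = 'C(q, r)%:R * 'C(q - r, i)%:R :> R.
  by rewrite -!natrM E.
rewrite pw; set a := (q ^ l)%:R; set b := _ ^- i; set z := _ ^ _.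
transitivity ((-1) ^+ i * ('C(q, i + r)%:R * 'C(i + r, r)%:R) * (a * b * z)); first by ring.
by rewrite Er; ring.
Qed.

End MainTerm.

(** In the expansion of [(k + (q - k))^q] the largest of the [q + 1] terms is the one at
    [i = q - k], since the ratio of consecutive terms is [(q - i) (q - k) / ((i + 1) k)]. *)
Lemma binomial_max_term q k : (0 < k < q)%N ->
  (q ^ q <= q.+1 * ('C(q, k) * (k ^ k * (q - k) ^ (q - k))))%N.
Proof.
case/andP => k0 kq.
pose T i := ('C(q, i) * (k ^ (q - i) * (q - k) ^ i))%N.
have rec i : (i < q)%N -> (T i.+1 * (i.+1 * k) = T i * ((q - i) * (q - k)))%N.
  move=> iq; have E := mul_bin_left q i.
  have kE : (k ^ (q - i) = k * k ^ (q - i.+1))%N by rewrite -expnS subnSK.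
  rewrite /T kE expnS.
  by transitivity ((i.+1 * 'C(q, i.+1)) * (k * k ^ (q - i.+1)) * ((q - k) * (q - k) ^ i))%N; [ring | rewrite E; ring].
have up i : (i < q - k)%N -> (T i <= T i.+1)%N.
  move=> iqk; have c0 : (0 < i.+1 * k)%N by rewrite muln_gt0.
  rewrite -(leq_pmul2r c0) rec; last by lia.
  rewrite leq_mul2l; apply/orP; right; rewrite mulnC; apply: leq_mul; lia.
have down i : (q - k <= i < q)%N -> (T i.+1 <= T i)%N.
  case/andP => i1 i2; have c0 : (0 < i.+1 * k)%N by rewrite muln_gt0.
  rewrite -(leq_pmul2r c0) rec // leq_mul2l; apply/orP; right.
  rewrite [(i.+1 * k)%N]mulnC; apply: leq_mul; lia.
have maxT i : (i <= q)%N -> (T i <= T (q - k))%N.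
  move=> iq; have [ik|ki] := leqP i (q - k).
    rewrite -(subKn ik); elim: (q - k - i)%N (leq_subr i (q - k)) => [|n IH] le; first by rewrite subn0.
    apply: leq_trans (IH (ltnW le)); rewrite -(subnSK le); apply: up; lia.
  rewrite -(subnKC (ltnW ki)); have : (q - k + (i - (q - k)) <= q)%N by lia.
  elim: (i - (q - k))%N => [|n IH] le; first by rewrite addn0.
  apply: leq_trans (IH _); last by lia.
  by rewrite addnS; apply: down; lia.
rewrite -{1}(subnK (ltnW kq)) addnC expnDn.
apply: (@leq_trans (\sum_(i < q.+1) T (q - k)%N)).
  by apply: leq_sum => i _; rewrite -/(T i); apply: maxT; rewrite -ltnS.
by rewrite sum_nat_const card_ord /T subKn ?(ltnW kq) // bin_sub // ltnW.
Qed.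

Lemma count_interval_le r k m q :
  (\sum_(r <= j < m.+1 | k < j <= q) 1 <= m - k)%N.
Proof.
rewrite sum1_count -size_filter -[X in (_ <= X)%N](size_iota k.+1) .
apply: uniq_leq_size; first by rewrite filter_uniq ?iota_uniq.
move=> j; rewrite mem_filter mem_index_iota mem_iota => /andP [/andP [a _] /andP [_ b]].
by lia.
Qed.

(** * Growth of the majorant and ratios of binomials *)

Section ErrorEstimates.
Variable R : realType.

(** The recursion for [gsum] bounds a partial sum [T] by [M + rho^p T]. Working with partial sums
    avoids any question of convergence. *)
Lemma gsum_series_bound p (a : nat -> nat) (rho M : R) : (0 < p)%N -> 0 < rho < 1 ->
  (forall J, \sum_(j < J) (a j)%:R * rho ^+ j <= M) ->
  forall J, \sum_(j < J) (gsum p a j)%:R * rho ^+ j <= M / (1 - rho ^+ p).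
Proof.
move=> p0 /andP [r0 r1] H J.
have rp : rho ^+ p < 1 by rewrite exprn_ilt1 ?ltW // -lt0n.
rewrite ler_pdivlMr ?subr_gt0 // mulrBr mulr1 lerBlDr.
pose T n := \sum_(j < n) (gsum p a j)%:R * rho ^+ j.
have Tmono n : T n <= T n.+1.
  by rewrite /T big_ord_recr /= lerDl mulr_ge0 ?ler0n // exprn_ge0 // ltW.
have Tle n n' : (n <= n')%N -> T n <= T n'.
  by move/subnKC <-; elim: (n' - n)%N => [|u IH]; rewrite ?addn0 // addnS (le_trans IH).
have TE : T J = \sum_(j < J) (a j)%:R * rho ^+ j + T (J - p)%N * rho ^+ p.
  rewrite {1}/T (eq_bigr (fun j : 'I_J => (a j)%:R * rho ^+ j +
     (if (p <= j)%N then (gsum p a (j - p))%:R * rho ^+ j else 0))); last first.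
    move=> j _; rewrite {1}(gsum_rec a j p0) natrD mulrDl; congr (_ + _).
    by case: ifP => _; rewrite ?mul0r.
  rewrite big_split /=; congr (_ + _); rewrite -big_mkcond /=.
  rewrite -(big_mkord (fun j => p <= j)%N (fun j => (gsum p a (j - p))%:R * rho ^+ j)).
  have [pJ|Jp] := leqP p J; last first.
    rewrite (_ : (J - p = 0)%N); last by lia.
    rewrite /T big_ord0 mul0r big_nat_cond big1 // => j /andP [/andP [_ jJ] pj]; lia.
  rewrite (big_cat_nat (n := p)) //= big_nat_cond big1 ?add0r; last first.
    by move=> j /andP [/andP [_ jp] pj]; lia.
  rewrite -{1}(add0n p) big_addn /T mulr_suml -(big_mkord predT (fun i => (gsum p a i)%:R * rho ^+ i * rho ^+ p)).
  by apply: eq_big => [i|i _]; rewrite ?leq_addl // addnK exprD mulrA.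
rewrite -/(T J) {1}TE; apply: lerD; first exact: H.
apply: ler_wpM2r; first by rewrite exprn_ge0 // ltW.
exact: (Tle _ _ (leq_subr p J)).
Qed.

Lemma majorant_bound D p s j (rho : R) : (0 < p)%N -> 0 < rho < 1 ->
  (majorant D p s j)%:R * rho ^+ j <= (1 - rho) ^- D * (1 - rho ^+ p) ^- s.
Proof.
move=> p0 r01; have /andP [r0 r1] := r01.
have series : forall J, \sum_(i < J) (majorant D p s i)%:R * rho ^+ i <= (1 - rho) ^- D * (1 - rho ^+ p) ^- s.
  rewrite /majorant; elim: s => [|s IH] /=; last first.
    by move=> J; rewrite exprS invfM mulrCA mulrC; apply: gsum_series_bound.
  rewrite expr0 invr1 mulr1; elim: D => [|D IH] /= J; last first.
    rewrite exprS invfM mulrC -[X in 1 - X](expr1 rho); exact: gsum_series_bound.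
  rewrite expr0 invr1; case: J => [|J]; first by rewrite big_ord0.
  by rewrite big_ord_recl mul1r expr0 big1 ?addr0 // => i _; rewrite lift0 mul0r.
apply: le_trans (series j.+1); rewrite big_ord_recr /= lerDr sumr_ge0 // => i _.
by rewrite mulr_ge0 ?ler0n // exprn_ge0 // ltW.
Qed.

(** Combines [C(q, k) <= C(q, j) q^(j-k)] with [C(q, j) C(j, r) <= C(q, r) q^(j-r)]; the resulting
    exponent of [q] is [l + j - r]. A loss of powers [q^O(l)] is affordable. *)
Lemma bin_ratio_bound q l k r j : (r <= j)%N -> (k < j <= q)%N -> (j <= k + l)%N ->
  ('C(j, r) * q ^ (k + l - j) * 'C(q, k) <= 'C(q, r) * q ^ (k + 2 * l - r))%N.
Proof.
move=> rj /andP [kj jq] jm; have q0 : (0 < q)%N by lia.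
have bin_exp n i : (n <= q)%N -> ('C(n, i) <= q ^ i)%N.
  move=> nq; elim: i => [|i IH]; first by rewrite bin0.
  have E := mul_bin_left n i; rewrite expnSr.
  have : ('C(n, i.+1) <= i.+1 * 'C(n, i.+1))%N by rewrite leq_pmull.
  rewrite E mulnC => /leq_trans; apply; apply: leq_mul => //; exact: leq_trans (leq_subr _ _) nq.
have up i : (i < q)%N -> ('C(q, i) <= 'C(q, i.+1) * q)%N.
  move=> iq; have E := mul_bin_left q i.
  have : ('C(q, i) <= (q - i) * 'C(q, i))%N by rewrite leq_pmull // subn_gt0.
  rewrite -E mulnC => /leq_trans; apply; rewrite leq_mul2l; apply/orP; right; exact: leq_trans iq _.
have ups n : (k + n <= q)%N -> ('C(q, k) <= 'C(q, k + n) * q ^ n)%N.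
  elim: n => [|n IH] le; first by rewrite addn0 muln1.
  apply: leq_trans (IH _) _; first by lia.
  rewrite addnS expnS mulnA leq_mul2r; apply/orP; right; apply: up; lia.
have H1 := ups (j - k)%N; rewrite subnKC ?(ltnW kj) // in H1; have {}H1 := H1 jq.
have H2 : ('C(q, j) * 'C(j, r) <= 'C(q, r) * q ^ (j - r))%N.
  rewrite bin_trinomial // leq_mul2l; apply/orP; right; exact: bin_exp (leq_subr _ _).
apply: (@leq_trans ('C(j, r) * q ^ (k + l - j) * ('C(q, j) * q ^ (j - k)))); first by rewrite leq_mul2l H1 orbT.
apply: (@leq_trans ('C(q, r) * q ^ (j - r) * (q ^ (k + l - j) * q ^ (j - k)))).
  have -> : ('C(j, r) * q ^ (k + l - j) * ('C(q, j) * q ^ (j - k)) = 'C(q, j) * 'C(j, r) * (q ^ (k + l - j) * q ^ (j - k)))%N by ring.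
  by rewrite leq_mul2r H2 orbT.
rewrite -mulnA -!expnD leq_mul2l; apply/orP; right; rewrite leq_pexp2l //; lia.
Qed.

End ErrorEstimates.

(** * Relative error and entropy *)

Section RelativeError.
Variable R : realType.

(** The error bound is divided by the lower bound for the main term from [mu_lower], which costs the
    leading factor [q]. *)
Lemma relative_error (F : finFieldType) (l k r p e D : nat) (f : {poly F}) (A : R)
    (q := #|F|) :
  prime p -> (0 < e)%N -> q = (p ^ e)%N -> (0 < l)%N -> (l.-1 ^ 2 * q <= D ^ 2)%N ->
  (0 < k < q)%N -> (6 <= q)%N -> (3 <= k + l)%N -> (r <= k + l)%N ->
  f \is monic -> size f = (k + l).+1 ->
  (forall j, (k < j <= k + l)%N -> (majorant D p (p ^ e.-1) j)%:R <= A) ->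
  exists theta : R,
    `|theta| <= q%:R * (l%:R * (q ^ (2 * l))%:R * A / 'C(q, k)%:R) /\
    (codewords_at k f r)%:R = (1 + theta) * main_term R q l k r.
Proof.
move=> pp e0 cF l0 Dge /andP [k0 kq] q6 m3 rm mf sf HA.
have A0 : 0 <= A by apply: le_trans (HA k.+1 _); rewrite ?ler0n //; lia.
have q0 : 0 < q%:R :> R by rewrite ltr0n; lia.
have ql0 : 0 < (q ^ l)%:R :> R by rewrite natrX exprn_gt0.
set main := main_term R q l k r.
have err : `|(codewords_at k f r)%:R - main| <= (count_error_bound F l p e D (k + l) r)%:R.
  have := count_error l0 pp e0 cF Dge r mf (leq_addl k l).
  rewrite -(ler_int R) intr_norm rmorphB /= -!pmulrn count_main_term // -/q -/main.
  rewrite (codewords_at_class r (ltnW kq) mf sf) // !natrM -mulrBr normrM gtr0_norm //.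
  by rewrite ler_pM2l.
(* For [r > q] both the main term and the error bound vanish, so [theta = 0] works. *)
have [rq|qr] := leqP r q; last first.
  have m0 : main = 0 by rewrite /main /main_term bin_small // mulr0 mul0r.
  exists 0; split; first by rewrite normr0 !mulr_ge0 ?invr_ge0 ?ler0n.
  rewrite m0 mulr0; move: err; rewrite m0 subr0 /count_error_bound big_nat_cond big1; last first.
    by move=> j /andP [/andP [rj _] /andP [_ jq]]; lia.
  by rewrite normr_le0 => /eqP.
set z : R := q%:R ^ (k%:Z - r%:Z).
have z0 : 0 < z by rewrite exprz_gt0.
have Cr0 : 0 < 'C(q, r)%:R :> R by rewrite ltr0n bin_gt0.
have Ck0 : 0 < 'C(q, k)%:R :> R by rewrite ltr0n bin_gt0 ltnW.
have main_ge : q%:R^-1 * ('C(q, r)%:R * z) <= main.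
  rewrite /main /main_term -/z -mulrA; apply: ler_wpM2r; last exact: mu_lower.
  by rewrite mulr_ge0 ?ler0n // ltW.
have main_gt0 : 0 < main by apply: lt_le_trans main_ge; rewrite !mulr_gt0 // invr_gt0.
pose c : R := 'C(q, r)%:R * z * ((q ^ (2 * l))%:R * A / 'C(q, k)%:R).
have Bc : (count_error_bound F l p e D (k + l) r)%:R <= l%:R * c.
  have c0 : 0 <= c by rewrite !mulr_ge0 ?invr_ge0 ?ler0n // ltW.
  apply: (@le_trans _ _ ((\sum_(r <= j < (k + l).+1 | (k < j <= q)%N) 1)%N%:R * c)); last first.
    rewrite ler_wpM2r // ler_nat; apply: leq_trans (count_interval_le r k (k + l) q) _.
    by rewrite addKn.
  rewrite /count_error_bound addnK !natr_sum mulr_suml.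
  rewrite big_nat_cond [X in _ <= X]big_nat_cond; apply: ler_sum => j /andP [/andP [rj jm] kjq].
  have pz : (q ^ (k + 2 * l - r))%:R = z * (q ^ (2 * l))%:R :> R.
    rewrite !natrX (exprnP _ (2 * l)) (exprnP _ (k + 2 * l - r)) -expfzDr ?gt_eqF //.
    by rewrite -(subzn (leq_trans rm _)) ?PoszD 1?addrAC // leq_add2l leq_pmull.
  have := bin_ratio_bound rj kjq (_ : (j <= k + l)%N); rewrite -ltnS => /(_ jm).
  rewrite -(ler_nat R) !natrM pz -/q => H.
  have maj := HA j; have {}maj := maj (_ : (k < j <= k + l)%N).
  rewrite mul1r. apply: (@le_trans _ _ (('C(j, r)%:R * (q ^ (k + l - j))%:R) * A)).
    rewrite mulrAC.
    by apply: ler_wpM2l; [rewrite mulr_ge0 ?ler0n | apply: maj; case/andP: kjq => -> _; rewrite -ltnS].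
  rewrite -(ler_pM2r Ck0); apply: (le_trans (y := ('C(q, r)%:R * (z * (q ^ (2 * l))%:R)) * A)).
    by rewrite mulrAC; apply: ler_wpM2r.
  rewrite /c le_eqVlt; apply/orP; left; apply/eqP.
  transitivity ('C(q, r)%:R * (z * (q ^ (2 * l))%:R) * A * ('C(q, k)%:R / 'C(q, k)%:R)); last by ring.
  by rewrite divff ?gt_eqF // mulr1.
exists (((codewords_at k f r)%:R - main) / main); split; last first.
  by rewrite mulrDl mul1r divfK ?gt_eqF // addrC subrK.
rewrite normrM normfV (gtr0_norm main_gt0) ler_pdivrMr //.
apply: le_trans err (le_trans Bc _).
have -> : l%:R * c = q%:R * (l%:R * (q ^ (2 * l))%:R * A / 'C(q, k)%:R) * (q%:R^-1 * ('C(q, r)%:R * z)).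
  rewrite /c; transitivity (q%:R * q%:R^-1 * (l%:R * ('C(q, r)%:R * z * ((q ^ (2 * l))%:R * A / 'C(q, k)%:R)))); last by ring.
  by rewrite divff ?gt_eqF // mul1r.
by apply: ler_wpM2l => //; rewrite !mulr_ge0 ?invr_ge0 ?ler0n.
Qed.

Definition entropy (c : R) : R := c * ln c^-1 + (1 - c) * ln (1 - c)^-1.

Lemma ln_inv_le (x : R) : 0 < x -> x * ln x^-1 <= 1 - x.
Proof.
move=> x0; have := @le_ln1Dx R (x^-1 - 1); rewrite ltrBrDl subrr addrC subrK invr_gt0 => /(_ x0) H.
have := ler_wpM2l (ltW x0) H; rewrite mulrBr mulr1 mulfV ?gt_eqF //.
Qed.

Lemma entropy_le1 (c : R) : 0 < c < 1 -> entropy c <= 1.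
Proof.
case/andP => c0 c1; have := ln_inv_le c0; have c1' : 0 < 1 - c by rewrite subr_gt0.
have := ln_inv_le c1'; rewrite /entropy; lra.
Qed.

(** [exp(-q entropy(c))] equals [c^k (1-c)^(q-k)], so this is [binomial_max_term] divided by
    [q^q]. *)
Lemma bin_inv_entropy q k : (0 < k < q)%N ->
  ('C(q, k)%:R)^-1 <= q.+1%:R * expR (- (q%:R * entropy (rate R q k))).
Proof.
move=> /andP [k0 kq]; have := @binomial_max_term q k; rewrite k0 kq => /(_ isT).
rewrite -(ler_nat R) !natrM !natrX => H.
have q0 : 0 < q%:R :> R by rewrite ltr0n; lia.
have k0' : 0 < k%:R :> R by rewrite ltr0n.
have qk0 : 0 < (q - k)%:R :> R by rewrite ltr0n subn_gt0.
have Ck0 : 0 < 'C(q, k)%:R :> R by rewrite ltr0n bin_gt0 ltnW.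
set c := rate R q k.
have c0 : 0 < c by rewrite divr_gt0.
have c1E : 1 - c = (q - k)%:R / q%:R.
  by rewrite natrB ?(ltnW kq) // mulrBl divff ?gt_eqF.
have c1 : 0 < 1 - c by rewrite c1E divr_gt0.
have -> : expR (- (q%:R * entropy c)) = c ^+ k * (1 - c) ^+ (q - k).
  have powE (x : R) n : 0 < x -> x ^+ n = expR (n%:R * ln x).
    by move=> x0; rewrite expRM_natl lnK.
  rewrite !powE // -expRD.
  congr expR; rewrite /entropy !lnV ?posrE //.
  have -> : k%:R = q%:R * c by rewrite mulrC divfK ?gt_eqF.
  have -> : (q - k)%:R = q%:R * (1 - c) by rewrite c1E mulrC divfK ?gt_eqF.
  by ring.
have -> : c ^+ k * (1 - c) ^+ (q - k) = k%:R ^+ k * (q - k)%:R ^+ (q - k) / q%:R ^+ q.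
  have qE : q%:R ^+ q = q%:R ^+ k * q%:R ^+ (q - k) :> R by rewrite -exprD subnKC // ltnW.
  by rewrite c1E /c /rate !expr_div_n qE invfM mulrACA.
rewrite mulrA ler_pdivlMr ?exprn_gt0 // mulrC ler_pdivrMr //.
by rewrite [X in _ <= X]mulrAC -mulrA.
Qed.

End RelativeError.

Lemma ln_2p_ge1 (R : realType) p : (1 < p)%N -> 1 <= ln (2 * p%:R : R).
Proof.
move=> p_gt1.
have p2 : 2 <= p%:R :> R by rewrite (ler_nat R 2).
have l4 : 1 <= ln (2 * 2 : R).
  have h2 : 0 < 2 :> R by rewrite ltr0n.
  have := ln_inv_le h2; rewrite lnV ?posrE // => H.
  rewrite lnM ?posrE //; lra.
by apply: le_trans l4 _; rewrite ler_ln ?posrE ?mulr_gt0 ?ltr0n //; [rewrite ler_pM2l | lia].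
Qed.

(** * The weight rho under each condition *)

Section Conditions.
Variable R : realType.
Variables (delta : R) (p q l k D s : nat).
Hypotheses (p_gt1 : (1 < p)%N) (k_gt0 : (0 < k)%N) (ps : (p * s = q)%N).
Let c := rate R q k.
Let g := excess R q l.
Hypothesis D_le : D%:R <= g * q%:R + 1.

(** The left side of the condition is at most the entropy, hence at most 1, while
    [ln (2 p) >= 1]. *)
Lemma condA_excess_le1 : 0 <= delta -> condA delta p q l k -> g <= 1.
Proof.
move=> d0; rewrite /condA -/c -/g => -[/andP [c0 c1] H].
have p0 : 0 < p%:R :> R by rewrite ltr0n ltnW.
have := entropy_le1 (c := c); rewrite c0 c1 /entropy => /(_ isT) E.
have a0 : 0 <= c * ln c^-1 by apply: mulr_ge0; [exact: ltW | rewrite lnV ?posrE // oppr_ge0 ln_le0 // ltW].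
have u0 : 0 <= (1 + c) / p%:R * ln (1 + c).
  apply: mulr_ge0; last by rewrite ln_ge0 // lerDl ltW.
  by rewrite divr_ge0 ?addr_ge0 // ltW.
have f1 : (p%:R - 1) / p%:R * c * ln c^-1 <= c * ln c^-1.
  by rewrite -mulrA ler_piMl // ler_pdivrMr // mul1r gerBl.
have L1 := ln_2p_ge1 R p_gt1; have [g0|g0] := lerP g 0; first by lra.
have : g * 1 <= g * ln (2 * p%:R) by rewrite ler_pM2l.
lra.
Qed.

Lemma condB_excess_le1 : 0 <= delta -> condB delta p q l k -> g <= 1.
Proof.
move=> d0; rewrite /condB -/c -/g => -[/andP [c0 c1] gc H].
have p0 : 0 < p%:R :> R by rewrite ltr0n ltnW.
have g0 : 0 < g by apply: lt_le_trans gc; rewrite divr_gt0.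
have := entropy_le1 (c := c); rewrite c0 c1 /entropy => /(_ isT) E.
have : 0 <= g * ln ((c + g) / g).
  by apply: mulr_ge0; [exact: ltW | rewrite ln_ge0 // ler_pdivlMr // mul1r lerDr ltW].
lra.
Qed.

Let cq : 0 < c -> c * q%:R = k%:R.
Proof.
move=> c0; rewrite /c /rate divfK //; apply: contraTneq c0 => q0.
by rewrite /c /rate q0 invr0 mulr0 ltxx.
Qed.

Lemma condA_weight : condA delta p q l k ->
  exists rho : R, [/\ 0 < rho < 1, rho^-1 <= 2 * q%:R &
    rho ^- k * ((1 - rho) ^- D * (1 - rho ^+ p) ^- s)
      <= 2 * p%:R * expR (q%:R * (entropy c - delta))].
Proof.
rewrite /condA -/c -/g => -[/andP [c0 c1] H].
have p0 : 0 < p%:R :> R by rewrite ltr0n ltnW.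
have ck := cq c0.
have k1 : 1 <= k%:R :> R by rewrite ler1n.
have q0 : 0 < q%:R :> R by nra.
have psR : p%:R * s%:R = q%:R :> R by rewrite -natrM ps.
(* The value of [rho^p] that minimizes [rho^(-k) (1 - rho^p)^(-q/p)]. *)
pose sig := c / (1 + c).
have c10 : 0 < 1 + c by rewrite addr_gt0.
have sig0 : 0 < sig by rewrite divr_gt0.
have sig1 : sig < 1 by rewrite ltr_pdivrMr // mul1r; lra.
have lnsig : ln sig = - (ln (1 + c) + ln c^-1).
  by rewrite lnM ?posrE ?invr_gt0 // !lnV ?posrE // opprD opprK addrC.
pose rho := expR (ln sig / p%:R).
have rho0 : 0 < rho by apply: expR_gt0.
have lns : ln sig < 0 by rewrite ln_lt0 // sig0.
have rho1 : rho < 1 by rewrite expR_lt1 pmulr_llt0 // invr_gt0.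
have rhop : rho ^+ p = sig.
  by rewrite -expRM_natl mulrC divfK ?gt_eqF // lnK.
have sigr : sig <= rho.
  rewrite -rhop; have : rho ^+ p <= rho ^+ 1 by rewrite ler_wiXn2l ?ltW // ltnW.
  by rewrite expr1.
exists rho; split; first by rewrite rho0.
  apply: (@le_trans _ _ sig^-1); first by rewrite lef_pV2.
  rewrite invf_div ler_pdivrMr // -mulrA [q%:R * c]mulrC ck; lra.
have s1E : 1 - sig = (1 + c)^-1.
  by rewrite -[1 in LHS](@divff _ (1 + c)) ?gt_eqF // -mulrBl addrK mul1r.
(* [1 - rho^p = 1 / (1 + c)] is at least [1/2] and at most [p (1 - rho)]. The resulting base [2 p]
   is the source of [gamma ln (2 p)] in the condition, and the extra 1 in [D <= gamma q + 1] of the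
   factor [2 p]. *)
have one_rho : (1 - rho)^-1 <= 2 * p%:R.
  have geo : 1 - rho ^+ p <= (1 - rho) * p%:R.
    rewrite -[1 in X in X <= _](expr1n _ p) subrXX; apply: ler_wpM2l; first by rewrite subr_ge0 ltW.
    apply: (@le_trans _ _ (\sum_(i < p) 1)); last by rewrite sumr_const card_ord.
    by apply: ler_sum => i _; rewrite expr1n mul1r exprn_ile1 // ltW.
  rewrite rhop s1E in geo.
  have r10 : 0 < 1 - rho by rewrite subr_gt0.
  rewrite -div1r ler_pdivrMr // mulrC.
  have : (1 + c)^-1 * 2 <= (1 - rho) * p%:R * 2 by rewrite ler_pM2r.
  have : 1 <= (1 + c)^-1 * 2 by rewrite mulrC ler_pdivlMr // mul1r; lra.
  lra.
have L0 : 0 < 2 * p%:R :> R by rewrite mulr_gt0.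
have lnL1 := ln_2p_ge1 R p_gt1.
pose L := ln (2 * p%:R : R); pose a := ln c^-1; pose b := ln (1 - c)^-1; pose u := ln (1 + c).
have w1 : (1 - rho) ^- D <= expR ((g * q%:R + 1) * L).
  rewrite -exprVn; apply: (@le_trans _ _ ((2 * p%:R) ^+ D)).
    by apply: lerXn2r => //; rewrite nnegrE ?invr_ge0 ?subr_ge0 ?(ltW rho1) ?(ltW L0).
  rewrite -[X in X ^+ D]lnK ?posrE // -expRM_natl ler_expR ler_wpM2r //.
  exact: le_trans ler01 lnL1.
have w2 : (1 - rho ^+ p) ^- s = expR (s%:R * u).
  by rewrite rhop s1E exprVn invrK expRM_natl lnK.
have w3 : rho ^- k = expR (k%:R / p%:R * (u + a)).
  rewrite -exprVn -expRN -expRM_natl lnsig -/u -/a; congr expR; ring.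
rewrite w2 w3 -[2 * p%:R in X in _ <= X]lnK ?posrE // -expRD.
apply: (@le_trans _ _ (expR (k%:R / p%:R * (u + a)) * (expR ((g * q%:R + 1) * L) * expR (s%:R * u)))).
  by rewrite ler_pM2l ?expR_gt0 // ler_pM2r ?expR_gt0.
rewrite -!expRD ler_expR /entropy -/L -/a -/b.
have sE : s%:R = q%:R / p%:R :> R by rewrite -psR mulrAC divff ?mul1r // gt_eqF.
have H' : q%:R * (g * L + delta) <= q%:R * ((p%:R - 1) / p%:R * c * a + (1 - c) * b - (1 + c) / p%:R * u).
  by rewrite ler_pM2l.
have p1E : (p%:R - 1) / p%:R = 1 - p%:R^-1 :> R by rewrite mulrBl divff ?mul1r // gt_eqF.
rewrite sE -ck; rewrite p1E in H'; lra.
Qed.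

Lemma condB_weight : condB delta p q l k -> (g <= 1) ->
  exists rho : R, [/\ 0 < rho < 1, rho^-1 <= 2 * q%:R &
    rho ^- k * ((1 - rho) ^- D * (1 - rho ^+ p) ^- s)
      <= 2 * p%:R * 2 ^+ s * expR (q%:R * (entropy c - delta))].
Proof.
rewrite /condB -/c -/g => -[/andP [c0 c1] gc H] g1.
have p0 : 0 < p%:R :> R by rewrite ltr0n ltnW.
have p1 : 1 <= p%:R :> R by rewrite ler1n ltnW.
have g0 : 0 < g by apply: lt_le_trans gc; rewrite divr_gt0.
have ck := cq c0.
have k1 : 1 <= k%:R :> R by rewrite ler1n.
have q0 : 0 < q%:R :> R by nra.
(* The minimizer of [rho^(-k) (1 - rho)^(-gamma q)]. *)
pose rho := c / (c + g).
have cg0 : 0 < c + g by rewrite addr_gt0.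
have rho0 : 0 < rho by rewrite divr_gt0.
have rho1 : rho < 1 by rewrite ltr_pdivrMr // mul1r ltrDl.
have rhoV : rho^-1 = 1 + g / c by rewrite invf_div mulrDl divff ?gt_eqF.
have cgp : c <= g * p%:R by rewrite -ler_pdivrMr.
have gcp : p%:R^-1 <= g / c by rewrite ler_pdivlMr // mulrC.
(* This is where [gamma >= c / p] enters: by Bernoulli, [rho^(-p) = (1 + gamma / c)^p >= 2]. Hence
   the factor with [p]-th powers costs at most [2^s]. *)
have rhop : rho ^+ p <= 1 / 2.
  have bern n (x : R) : 0 <= x -> 1 + n%:R * x <= (1 + x) ^+ n.
    move=> x0; elim: n => [|n IH]; first by rewrite mul0r addr0 expr0.
    rewrite exprS -natr1; have : (1 + x) * (1 + n%:R * x) <= (1 + x) * (1 + x) ^+ n.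
      by rewrite ler_wpM2l // addr_ge0.
    have : 0 <= n%:R * x * x by rewrite !mulr_ge0.
    lra.
  have b2 : 2 <= rho^-1 ^+ p.
    rewrite rhoV; apply: le_trans (bern p (g / c) _); last by rewrite divr_ge0 ?ltW.
    have : p%:R * p%:R^-1 <= p%:R * (g / c) by rewrite ler_pM2l.
    by rewrite divff ?gt_eqF //; lra.
  rewrite div1r -[rho]invrK exprVn lef_pV2 // posrE ?ltr0n //.
  by rewrite exprn_gt0 // invr_gt0.
exists rho; split; first by rewrite rho0.
  rewrite rhoV; have : g / c <= q%:R.
    by rewrite ler_pdivrMr // mulrC ck (le_trans g1 k1).
  have : c * q%:R <= q%:R by rewrite ler_piMl // ltW.
  lra.
pose L := ln (2 * p%:R : R); pose v := ln ((c + g) / g).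
have L0 : 0 < 2 * p%:R :> R by rewrite mulr_gt0.
have cgg0 : 0 < (c + g) / g by rewrite divr_gt0.
have v0 : 0 <= v by rewrite ln_ge0 // ler_pdivlMr // mul1r lerDr ltW.
have vL : v <= L.
  rewrite ler_ln ?posrE // ler_pdivrMr //; nra.
have r1E : (1 - rho)^-1 = (c + g) / g.
  by rewrite -[1 in LHS](@divff _ (c + g)) ?gt_eqF // -mulrBl addrC addKr invf_div.
have w1 : (1 - rho) ^- D <= expR ((g * q%:R + 1) * v).
  by rewrite -exprVn r1E -[X in X ^+ D]lnK ?posrE // -expRM_natl ler_expR ler_wpM2r.
have w2 : (1 - rho ^+ p) ^- s <= 2 ^+ s.
  have h : (2 : R)^-1 <= 1 - rho ^+ p by lra.
  rewrite -exprVn lerXn2r ?nnegrE //.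
    by rewrite invr_ge0; apply: le_trans h; rewrite invr_ge0.
  by rewrite -[X in _ <= X]invrK lef_pV2 // posrE ?invr_gt0 //; apply: lt_le_trans h; rewrite invr_gt0.
have w3 : rho ^- k <= expR (q%:R * g).
  rewrite -exprVn; apply: (@le_trans _ _ (expR (g / c) ^+ k)).
    by rewrite lerXn2r ?nnegrE ?expR_ge0 ?invr_ge0 ?(ltW rho0) // rhoV expR_ge1Dx.
  rewrite -expRM_natl ler_expR -ck le_eqVlt; apply/orP; left; apply/eqP.
  by rewrite mulrAC [c * _]mulrC divfK ?gt_eqF // mulrC.
rewrite -[2 * p%:R in X in _ <= X]lnK ?posrE // -/L.
apply: (@le_trans _ _ (expR (q%:R * g) * (expR ((g * q%:R + 1) * v) * 2 ^+ s))).
  have nn (x : R) n : x < 1 -> 0 <= (1 - x) ^- n.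
    by move=> x1; rewrite invr_ge0 exprn_ge0 // subr_ge0 ltW.
  have rhop1 : rho ^+ p < 1 by lra.
  have rk0 : 0 <= rho ^- k by rewrite invr_ge0 exprn_ge0 // ltW.
  have rD0 := nn rho D rho1; have rs0 := nn _ s rhop1.
  by apply: ler_pM => //; [exact: mulr_ge0 | exact: ler_pM].
rewrite mulrA -expRD [X in _ <= X]mulrAC ler_wpM2r ?exprn_ge0 // -expRD ler_expR /entropy.
have H' : q%:R * (g + g * v + delta) <= q%:R * (c * ln c^-1 + (1 - c) * ln (1 - c)^-1).
  by rewrite ler_pM2l.
lra.
Qed.

End Conditions.

(** * Collecting the estimates *)

Section Assembly.
Variable R : realType.

(** With [t = q^(1/4)], [ln (2 q) <= 4 t] and [3 l + 4 <= 10 t^2], so the power contributes at most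
    [40 t^3] to the exponent. Once [t delta >= 80], half of [delta q] absorbs this; the other half
    reaches [ln eps]. *)
Lemma expR_beats_power (delta eps : R) : 0 < delta -> 0 < eps ->
  exists N : nat, forall q l : nat, (N <= q)%N -> l%:R <= Num.sqrt q%:R + 1 :> R ->
    (2 * q%:R) ^+ (3 * l + 4) * expR (- (q%:R * delta)) <= eps.
Proof.
move=> d0 e0.
pose N1 := (Num.truncn ((80 / delta) ^+ 4)).+1.
pose N2 := (Num.truncn (- (2 * ln eps / delta))).+1.
exists (maxn N1 N2) => q l; rewrite geq_max => /andP [N1q N2q] lq.
have q1 : 1 <= q%:R :> R by rewrite ler1n; apply: leq_trans N1q.
have q0 : 0 < q%:R :> R by apply: lt_le_trans q1.
have qN1 : (80 / delta) ^+ 4 <= q%:R.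
  by apply: le_trans (ltW (truncnS_gt _)) _; rewrite ler_nat.
have qN2 : - (2 * ln eps / delta) <= q%:R.
  by apply: le_trans (ltW (truncnS_gt _)) _; rewrite ler_nat.
pose t : R := Num.sqrt (Num.sqrt q%:R).
have t2 : t ^+ 2 = Num.sqrt q%:R by rewrite sqr_sqrtr ?sqrtr_ge0.
have t4 : t ^+ 4 = q%:R by rewrite (exprM t 2 2) t2 sqr_sqrtr ?ler0n.
have t0 : 0 < t by rewrite !sqrtr_gt0.
have t1 : 1 <= t.
  by rewrite -(@ler_pXn2r _ 4) ?nnegrE ?(ltW t0) // expr1n t4.
have td : 80 <= t * delta.
  rewrite -ler_pdivrMr // -(@ler_pXn2r _ 4) ?nnegrE ?(ltW t0) ?t4 //.
  by rewrite divr_ge0 ?ler0n ?ltW.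
have p20 : 0 < 2 :> R by rewrite ltr0n.
have lnq : ln (2 * q%:R) <= 4 * t.
  rewrite lnM ?posrE // -t4 lnXn // -[ln t *+ 4]mulr_natl.
  have l2 : ln 2 <= 1 :> R by apply: (@le_ln1Dx R 1); lra.
  have : ln t <= t - 1 by rewrite -{1}[t](subrKC 1) le_ln1Dx //; lra.
  lra.
have lq' : (3 * l + 4)%:R <= 10 * t ^+ 2.
  rewrite natrD natrM; have : 1 <= t ^+ 2 by rewrite exprn_ege1.
  rewrite -t2 in lq; lra.
have q20 : 0 < 2 * q%:R :> R by rewrite mulr_gt0.
rewrite -[2 * _]lnK ?posrE // -expRM_natl -expRD -[X in _ <= X]lnK ?posrE // ler_expR.
have lnq0 : 0 <= ln (2 * q%:R : R) by rewrite ln_ge0 //; lra.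
have b1 : (3 * l + 4)%:R * ln (2 * q%:R) <= (10 * t ^+ 2) * (4 * t).
  by rewrite ler_pM.
have b2 : 80 * t ^+ 3 <= t * delta * t ^+ 3 by rewrite ler_wpM2r // exprn_ge0 // ltW.
have b3 : - (2 * ln eps) <= q%:R * delta by rewrite -ler_pdivrMr // mulNr.
have -> : - (q%:R * delta) = - (t * delta * t ^+ 3) / 2 - q%:R * delta / 2.
  by rewrite -t4; field.
have : 10 * t ^+ 2 * (4 * t) = 40 * t ^+ 3 by ring.
lra.
Qed.

(** Here [Q = 2 q] bounds each of [q], [l], [2 p] and [q + 1], which accounts for the 4 in the
    exponent. *)
Lemma collect_powers (Q B x y : R) l :
  Q * (Q * Q ^+ (2 * l) * (Q * B * x * Q ^+ l) * (Q * y)) =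
  Q ^+ (3 * l + 4) * (B * (x * y)).
Proof.
rewrite exprD (mulnC 3) (mulnC 2) (exprM Q l 3) (exprM Q l 2); move: (Q ^+ l) => z.
ring.
Qed.

(** Since [k < j <= k + l] and [rho^(-1) <= 2 q], replacing [rho^(-j)] by [rho^(-k)] costs at most
    [(2 q)^l]; the entropy then cancels against [C(q, k)]. The factor [B] is 1 under condition A and
    [2^(q/p)] under condition B. *)
Lemma relative_error_weight (F : finFieldType) (l k r p e D : nat) (f : {poly F})
    (rho B delta : R) (q := #|F|) (s := (p ^ e.-1)%N) :
  prime p -> (0 < e)%N -> q = (p ^ e)%N -> (0 < l)%N -> (l.-1 ^ 2 * q <= D ^ 2)%N ->
  (0 < k < q)%N -> (6 <= q)%N -> (3 <= k + l)%N -> (r <= k + l)%N ->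
  f \is monic -> size f = (k + l).+1 ->
  l%:R <= 2 * q%:R :> R -> 0 < rho < 1 -> rho^-1 <= 2 * q%:R -> 0 <= B ->
  rho ^- k * ((1 - rho) ^- D * (1 - rho ^+ p) ^- s)
    <= 2 * p%:R * B * expR (q%:R * (entropy (rate R q k) - delta)) ->
  exists theta : R,
    `|theta| <= (2 * q%:R) ^+ (3 * l + 4) * (B * expR (- (q%:R * delta))) /\
    (codewords_at k f r)%:R = (1 + theta) * main_term R q l k r.
Proof.
move=> pp e0 cF l0 Dge kq q6 m3 rm mf sf lq rho01 rhoV B0 W.
have /andP [rho0 rho1] := rho01.
set M := (1 - rho) ^- D * (1 - rho ^+ p) ^- s in W.
have q1 : 1 <= q%:R :> R by rewrite ler1n; lia.
pose Q : R := 2 * q%:R.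
have Q1 : 1 <= Q by rewrite /Q; lra.
have Q0 : 0 <= Q by apply: le_trans Q1.
have M0 : 0 <= M.
  rewrite /M mulr_ge0 // invr_ge0 exprn_ge0 // subr_ge0 ?exprn_ile1 // ltW //.
have rk0 : 0 < rho ^- k by rewrite invr_gt0 exprn_gt0.
pose A := rho ^- k * M * Q ^+ l.
have HA j : (k < j <= k + l)%N -> (majorant D p s j)%:R <= A.
  move=> /andP [kj jkl].
  have := majorant_bound D s j (prime_gt0 pp) rho01.
  rewrite -/M -ler_pdivlMr ?exprn_gt0 // => H; apply: le_trans H _.
  rewrite -{1}(subnKC (ltnW kj)) exprD invfM mulrA [M * _]mulrC.
  apply: ler_wpM2l; first by rewrite mulr_ge0 // ltW.
  rewrite -exprVn; apply: (@le_trans _ _ (Q ^+ (j - k))).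
    by rewrite lerXn2r ?nnegrE // invr_ge0 ltW.
  by rewrite ler_weXn2l // leq_subLR.
have [theta [th main]] := relative_error pp e0 cF l0 Dge kq q6 m3 rm mf sf HA.
exists theta; split=> //; apply: le_trans th _.
rewrite -/q; have Cb := bin_inv_entropy R kq; rewrite -/q in Cb *.
set C := _^-1 in Cb *; set E := entropy _ in Cb W.
have C0 : 0 <= C by rewrite invr_ge0 ler0n.
have pq : p%:R <= q%:R :> R by rewrite ler_nat cF -[X in (X <= _)%N]expn1; apply: leq_pexp2l => //; exact: prime_gt0.
have AB : A <= Q * B * expR (q%:R * (E - delta)) * Q ^+ l.
  apply: ler_wpM2r; first exact: exprn_ge0.
  apply: le_trans W _; apply: ler_wpM2r; first exact: expR_ge0.
  by apply: ler_wpM2r => //; rewrite ler_pM2l // ltr0n.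
have A0 : 0 <= A.
  by apply: mulr_ge0; [apply: mulr_ge0 => //; exact: ltW | exact: exprn_ge0].
have Cb' : C <= Q * expR (- (q%:R * E)).
  by apply: le_trans Cb _; rewrite ler_wpM2r ?expR_ge0 // -natr1 /Q; lra.
have ql : (q ^ (2 * l))%:R <= Q ^+ (2 * l).
  by rewrite natrX lerXn2r ?nnegrE ?ler0n // /Q; lra.
apply: (@le_trans _ _ (Q * (Q * Q ^+ (2 * l) * (Q * B * expR (q%:R * (E - delta)) * Q ^+ l) * (Q * expR (- (q%:R * E)))))).
  have x1 : 0 <= l%:R * (q ^ (2 * l))%:R :> R by rewrite mulr_ge0 ?ler0n.
  have x2 := mulr_ge0 x1 A0; have x3 := mulr_ge0 x2 C0.
  have Qq : q%:R <= Q by rewrite /Q; lra.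
  by apply: ler_pM => //; apply: ler_pM => //; apply: ler_pM => //; apply: ler_pM.
rewrite le_eqVlt; apply/orP; left; apply/eqP.
have -> : - (q%:R * delta) = q%:R * (E - delta) - q%:R * E by ring.
by rewrite expRD; exact: collect_powers.
Qed.

End Assembly.

Local Open Scope classical_set_scope.

Theorem corollary1 (R : realType) (F : nat -> finFieldType)
    (p q l k : nat -> nat) (delta0 : R)
    (p_prime : forall n, prime (p n))
    (q_pow : forall n, exists e : nat, q n = (p n ^ e)%N)
    (card_F : forall n, #|F n| = q n)
    (l_ge1 : forall n, (1 <= l n)%N)
    (k_ge1 : forall n, (1 <= k n)%N)
    (delta0_gt0 : 0 < delta0)
    (cond : (forall n, condA delta0 (p n) (q n) (l n) (k n)) \/
            (p @ \oo --> \oo /\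
             forall n, condB delta0 (p n) (q n) (l n) (k n)))
    (k_oo : k @ \oo --> \oo) :
  forall eps : R, 0 < eps ->
    \forall n \near \oo,
      forall (r : nat) (f : {poly F n}),
        (r <= k n + l n)%N -> f \is monic -> size f = (k n + l n).+1 ->
        exists theta : R, `|theta| <= eps /\
          (codewords_at (k n) f r)%:R
            = (1 + theta) * main_term R (q n) (l n) (k n) r.
Proof.
move=> eps eps0.
(* Half of [delta0] is reserved for the factor [2^(q/p)] of condition B; the other half beats the
   powers of [q]. *)
have d20 : 0 < delta0 / 2 by rewrite divr_gt0 ?ltr0n.
have [N HN] := expR_beats_power d20 eps0.
have weight : \forall n \near \oo,
    [/\ 0 < rate R (q n) (k n) < 1, excess R (q n) (l n) <= 1 &
      forall D s : nat, (p n * s = q n)%N ->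
        D%:R <= excess R (q n) (l n) * (q n)%:R + 1 ->
      exists B rho : R, [/\ 0 <= B,
        B * expR (- ((q n)%:R * delta0)) <= expR (- ((q n)%:R * (delta0 / 2))),
        0 < rho < 1, rho^-1 <= 2 * (q n)%:R &
        rho ^- k n * ((1 - rho) ^- D * (1 - rho ^+ p n) ^- s)
          <= 2 * (p n)%:R * B *
             expR ((q n)%:R * (entropy (rate R (q n) (k n)) - delta0))]].
  case: cond => [A|[p_oo B]].
    near=> n; have An := A n; have [c01 _] := An.
    have g1 := condA_excess_le1 (prime_gt1 (p_prime n)) (ltW delta0_gt0) An.
    split=> // D s ps Dle.
    have [rho [rho01 rhoV W]] := condA_weight (prime_gt1 (p_prime n)) (k_ge1 n) ps Dle An.
    exists 1, rho; rewrite ler01 mul1r mulr1; split=> //.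
    rewrite ler_expR lerN2 ler_wpM2l ?ler0n //; lra.
  near=> n; have Bn := B n; have [c01 _ _] := Bn.
  have g1 := condB_excess_le1 (prime_gt1 (p_prime n)) (ltW delta0_gt0) Bn.
  split=> // D s ps Dle.
  have [rho [rho01 rhoV W]] := condB_weight s (prime_gt1 (p_prime n)) (k_ge1 n) Dle Bn g1.
  exists (2 ^+ s), rho; split=> //.
  have l2 : ln 2 <= 1 :> R by apply: (@le_ln1Dx R 1); lra.
  (* Here [p -> oo] is used: once [p >= 2 / delta0], [2^(q/p)] is at most [exp(q delta0 / 2)]. *)
  have p2 : 2 / delta0 <= (p n)%:R.
    apply: le_trans (ltW (truncnS_gt _)) _; rewrite ler_nat.
    by near: n; move/cvgnyPge: p_oo; apply.
  rewrite ler_pdivrMr // in p2.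
  rewrite -[X in X ^+ s]lnK ?posrE ?ltr0n // -expRM_natl -expRD ler_expR.
  have s1 : s%:R * ln 2 <= s%:R * 1 :> R by rewrite ler_wpM2l ?ler0n.
  have s2 : s%:R * 2 <= s%:R * ((p n)%:R * delta0) by rewrite ler_wpM2l ?ler0n.
  have -> : (q n)%:R = (p n)%:R * s%:R :> R by rewrite -natrM ps.
  lra.
(* As [k < q], large [k] makes [q] large; the 6 is the one required by [mu_lower]. *)
have /cvgnyPge/(_ (maxn N 6)) := k_oo.
apply: filterS2 weight => n [c01 g1 wt] knN r f rkl mf sf.
move: knN; rewrite geq_max => /andP [kN k6].
have kq : (k n < q n)%N.
  case/andP: c01 => c0 c1; have q0 : 0 < (q n)%:R :> R.
    rewrite ltr0n lt0n; apply: contraTneq c0 => ->.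
    by rewrite /rate invr0 mulr0 ltxx.
  by rewrite -(ltr_nat R) -[X in _ < X]mul1r -ltr_pdivrMr.
have [e qe] := q_pow n.
have e0 : (0 < e)%N by rewrite lt0n; apply: contraTneq kq => e0; rewrite qe e0 expn0; lia.
have ps : (p n * p n ^ e.-1 = q n)%N by rewrite -expnS prednK.
have sqq : Num.sqrt (q n)%:R ^+ 2 = (q n)%:R :> R by rewrite sqr_sqrtr ?ler0n.
have q1 : 1 <= (q n)%:R :> R by rewrite ler1n; lia.
have sq1 : 1 <= Num.sqrt (q n)%:R :> R by rewrite -{1}(@sqrtr1 R) ler_sqrt ?ltr0n //; lra.
have sq0 : 0 < Num.sqrt (q n)%:R :> R by apply: lt_le_trans sq1.
have l1 : 1 <= (l n)%:R :> R by rewrite ler1n.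
pose x : R := ((l n)%:R - 1) * Num.sqrt (q n)%:R.
have x0 : 0 <= x by rewrite mulr_ge0 ?subr_ge0 // ltW.
have gq : excess R (q n) (l n) * (q n)%:R = x.
  by rewrite /excess -{2}sqq expr2 mulrA divfK ?gt_eqF.
(* [D] is one more than the integer part of [(l - 1) sqrt q]: large enough for the Weil bound, and
   at most [gamma q + 1]. *)
have Dx : (Num.truncn x).+1%:R <= excess R (q n) (l n) * (q n)%:R + 1.
  by rewrite gq -natr1 lerD2r truncn_le.
have Dge : ((l n).-1 ^ 2 * q n <= (Num.truncn x).+1 ^ 2)%N.
  rewrite -(ler_nat R) natrM !natrX -[X in _ * X]sqq -exprMn.
  rewrite lerXn2r ?nnegrE ?ler0n ?mulr_ge0 ?ler0n //.
  rewrite -subn1 natrB //; exact: ltW (truncnS_gt _).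
have lq : (l n)%:R <= Num.sqrt (q n)%:R + 1 :> R.
  by move: g1; rewrite /excess ler_pdivrMr // mul1r lerBlDr.
have [B [rho [B0 Bd rho01 rhoV W]]] := wt _ _ ps Dx.
have lq2 : (l n)%:R <= 2 * (q n)%:R :> R.
  have sqq_le : Num.sqrt (q n)%:R <= (q n)%:R :> R by rewrite -[X in _ <= X]sqq expr2 ler_peMr // ltW.
  lra.
have qF := esym (card_F n).
rewrite qF in qe.
rewrite qF in Dge.
rewrite qF in kq.
rewrite qF in lq2.
rewrite qF in rhoV.
rewrite qF in W.
have kq' : (0 < k n < #|F n|)%N by apply/andP; split.
have q6 : (6 <= #|F n|)%N by exact: leq_trans k6 (ltnW kq).
have kl3 : (3 <= k n + l n)%N by apply: leq_trans (leq_addr _ _); exact: leq_trans k6.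
have [theta [th main]] := relative_error_weight (p_prime n) e0 qe (l_ge1 n) Dge kq' q6 kl3 rkl mf sf lq2 rho01 rhoV B0 W.
rewrite card_F in main.
exists theta; split=> //; apply: le_trans th _; rewrite card_F.
apply: le_trans (HN (q n) (l n) _ lq).
  by rewrite ler_wpM2l // exprn_ge0 // mulr_ge0 ?ler0n.
by apply: leq_trans kN _; rewrite -card_F ltnW.
Unshelve. all: by end_near.
Qed.
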